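(* Let $\{X_t:t\ge0\}$ be a purely non-Gaussian $d$-dimensional Lévy process with $X_0=0$ whose Lévy measure $\Pi$ is supported by the unit ball $D=\{|y|\le1\}$, let $0<b\le1$, and let $$Y^{(b)}_t=\lim_{\varepsilon\downarrow0}\Big\{\sum_{0<s\le t}\Delta X_s\,1_{\{\varepsilon<|\Delta X_s|\le b\}}-t\int_{\varepsilon<|y|\le b}y\,\Pi(dy)\Big\}\quad\text{a.s.}$$ Given $\delta>0$ there are constants $C_1,C_2>0$ depending on $\delta$ only such that for all $t,x>0$, $$\mathbb{P}\{|Y^{(b)}_t|\ge x\}\ge C_1\exp\Big(-\frac{x^2(1+\delta)^2}{2tV(b)}\Big)-C_2\,t\int_{0<|y|\le b}|y|^3\,\Pi(dy)/x^3.$$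
   Context: Purely non-Gaussian: characteristic triplet $(\gamma,0,\Pi)$. $\Delta X_s=X_s-X_{s-}$. $|\cdot|$ Euclidean norm, $V(b)=\sup_{|z|\le1}\int_{|y|\le b}\langle y,z\rangle^2\,\Pi(dy)$. *)

(* Defs.v *)
From HB Require Import structures.
From mathcomp Require Import all_boot all_order all_algebra.
From mathcomp Require Import all_classical all_reals all_analysis.
Set Implicit Arguments. Unset Strict Implicit. Unset Printing Implicit Defensive.
Import Order.TTheory GRing.Theory Num.Theory.
Import numFieldNormedType.Exports.
Local Open Scope classical_set_scope.
Local Open Scope ring_scope.

(* Vectors of R^d are d-tuples of reals; d.-tuple R carries the product
   (= Borel) sigma-algebra from measurable_structure.v. *)
Section vectors.
Context {R : realType} {d : nat}.
Definition vzero : d.-tuple R := [tuple 0 | i < d].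
Definition vsub (u v : d.-tuple R) : d.-tuple R := [tuple tnth u i - tnth v i | i < d].
Definition dotv (u v : d.-tuple R) : R := \sum_(i < d) tnth u i * tnth v i.
Definition vnorm (u : d.-tuple R) : R := Num.sqrt (\sum_(i < d) tnth u i ^+ 2).
End vectors.

Section levy.
Context {R : realType} {d : nat} {dT : measure_display} {T : measurableType dT}.
Variable P : probability T R.

Definition indep_vecs (n : nat) (Z : 'I_n -> T -> d.-tuple R) : Prop :=
  forall B : 'I_n -> set (d.-tuple R), (forall i, measurable (B i)) ->
    P (\bigcap_(i in [set: 'I_n]) (Z i @^-1` B i)) =
    (\prod_(i < n) P (Z i @^-1` B i))%E.

Definition cadlag (f : R -> d.-tuple R) : Prop :=
  forall i : 'I_d,
    (forall t, 0 <= t -> (tnth (f s) i @[s --> t^'+]) --> tnth (f t) i) /\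
    (forall t, 0 < t -> cvg (tnth (f s) i @[s --> t^'-])).

Definition levy_process (X : R -> T -> d.-tuple R) : Prop :=
  [/\ (forall t, measurable_fun setT (X t)),
      (forall w, X 0 w = vzero),
      (forall (n : nat) (t : nat -> R), 0 <= t 0%N ->
          (forall k, (k < n)%N -> t k < t k.+1) ->
          indep_vecs (fun k : 'I_n => fun w => vsub (X (t k.+1) w) (X (t k) w))),
      (forall s t, 0 <= s -> 0 <= t -> forall B, measurable B ->
          P ((fun w => vsub (X (s + t) w) (X s w)) @^-1` B) = P (X t @^-1` B)) &
      {ae P, forall w, cadlag (fun t => X t w)}].

Definition levy_measure (Pi : {measure set (d.-tuple R) -> \bar R}) : Prop :=
  Pi [set vzero] = 0%E /\
  (\int[Pi]_y (Num.min 1 (vnorm y ^+ 2))%:E < +oo)%E.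

(* X has characteristic triplet (gamma, 0, Pi) (Levy-Khintchine formula with
   truncation function 1_{|y| <= 1}), written via real and imaginary parts:
   E exp(i<th,X_t>) = exp(t psi(th)),
   psi(th) = i<gamma,th> + int (e^{i<th,y>} - 1 - i<th,y>1_{|y|<=1}) Pi(dy). *)
Definition re_psi (Pi : {measure set (d.-tuple R) -> \bar R}) (th : d.-tuple R) : R :=
  Rintegral Pi setT (fun y => cos (dotv th y) - 1).
Definition im_psi (gamma : d.-tuple R) (Pi : {measure set (d.-tuple R) -> \bar R})
    (th : d.-tuple R) : R :=
  dotv gamma th +
  Rintegral Pi setT (fun y => sin (dotv th y) - (if vnorm y <= 1 then dotv th y else 0)).

Definition char_triplet_nongauss (X : R -> T -> d.-tuple R) (gamma : d.-tuple R)
    (Pi : {measure set (d.-tuple R) -> \bar R}) : Prop :=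
  levy_measure Pi /\
  forall t, 0 <= t -> forall th : d.-tuple R,
    Rintegral P setT (fun w => cos (dotv th (X t w))) =
      expR (t * re_psi Pi th) * cos (t * im_psi gamma Pi th) /\
    Rintegral P setT (fun w => sin (dotv th (X t w))) =
      expR (t * re_psi Pi th) * sin (t * im_psi gamma Pi th).

Definition jump (X : R -> T -> d.-tuple R) (s : R) (w : T) : d.-tuple R :=
  vsub (X s w) [tuple lim (tnth (X u w) i @[u --> s^'-]) | i < d].

Definition Yapprox (X : R -> T -> d.-tuple R) (Pi : {measure set (d.-tuple R) -> \bar R})
    (b t eps : R) (w : T) (i : 'I_d) : R :=
  (\sum_(s \in [set s | 0 < s <= t /\ eps < vnorm (jump X s w) <= b])
      tnth (jump X s w) i)
  - t * Rintegral Pi [set y | eps < vnorm y <= b] (fun y => tnth y i).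
End levy.

Section Vdef.
Context {R : realType} {d : nat}.
Definition Vb (Pi : {measure set (d.-tuple R) -> \bar R}) (b : R) : \bar R :=
  ereal_sup [set (\int[Pi]_(y in [set y | (vnorm y <= b)%R]) (dotv y z ^+ 2)%:E)%E
            | z in [set z : d.-tuple R | vnorm z <= 1]].

(* C1 exp(-x^2(1+delta)^2/(2 t V)) with the convention exp(-oo) = 0 when V = 0 *)
Definition gauss_term (C1 delta x t V : R) : R :=
  if 0 < V then C1 * expR (- (x ^+ 2 * (1 + delta) ^+ 2) / (2 * t * V)) else 0.
End Vdef.

(* Main.v *)
(** Let |z| <= 1 be such that int_(|y| <= b) <y, z>^2 nearly attains V(b), and let f
    be a C^2 cutoff with f = 0 on (-oo, x], f = 1 on [(1 + eta) x, oo) and third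
    derivative O(x^-3). Then P(|Y| >= x) >= E f(<z, Y>), and replacing <z, Y> by a
    centred variable with the same variance costs O(t int |y|^3 / x^3) by Lindeberg's
    argument, which is exactly the error allowed; no normal approximation rate is
    needed.

    The law of Y is never computed. Lindeberg's argument is run on the increments of
    X over the grid of mesh t/n, composed with a continuous truncation g of
    y |-> <z, y> 1_(eps < |y| <= b). Since the paths are cadlag, the sums of g over
    the increments converge to the sum of g over the jumps; then g tends to the sharp
    truncation and eps to 0. The moments needed are limits n E h(X_(t/n)) --> t int h dPi.
    They hold for trigonometric polynomials h = O(|y|^2) by the formula for the
    characteristic function, and extend to the required h because
    n E|X_(t/n)|^2 is bounded (Fatou) and h can be approximated by trigonometric
    polynomials within e|y|^2: substitute L sin(y_i / L) for y_i and use Weierstrass.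

    The replacement variables are Rademacher signs; the upper tail of their sum is
    bounded below by exponential tilting and a second moment bound. *)

Require Import Defs.
From HB Require Import structures.
From mathcomp Require Import all_boot all_order all_algebra.
From mathcomp Require Import all_classical all_reals all_analysis.
From mathcomp Require Import measurable_realfun ring lra.
Import Order.TTheory GRing.Theory Num.Theory.
Import numFieldNormedType.Exports.
Local Open Scope classical_set_scope.
Local Open Scope ring_scope.

(** * A smooth cutoff *)

(** The law of [X] is given only through its characteristic function and [Y] only as an almost sure
    limit of compensated jump sums; grid increments are where the two meet. This forces the order of
    the limits. For fixed [eps] and [M] the truncated projection [cproj] is continuous and vanishes
    near 0, so finitely many jumps matter and the mesh can tend to 0. Then [M] grows to reach the
    sharp indicator, and [eps] tends to 0 last. The compensator comes out by itself: it is the limit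
    of the number of cells times the mean by which each truncated increment is centred.

    The Rademacher step [h] shrinks with the mesh. Hence the error [n h^3] that the signs themselves
    contribute vanishes, and the condition [(a + 2 s)^3 h <= s^4] under which the tail bound is
    proved holds eventually. What survives is [tail_low (a / s)], a function of the ratio of level
    to standard deviation alone; this is why the constants depend on [delta] only. *)

Lemma norm_sin_le (R : realType) (x : R) : `|sin x| <= `|x|.
Proof.
wlog x0 : x / 0 < x.
  move=> H; have [->|xn0] := eqVneq x 0; first by rewrite sin0.
  have [/H//|x0] := ltP 0 x.
  by rewrite -normrN -sinN -(normrN x) H// oppr_gt0 lt_neqAle xn0.
have [c _] := MVT x0 (fun y _ => is_derive_sin y) (continuous_subspaceT (@continuous_sin R)).
rewrite sin0 !subr0 => ->; rewrite normrM ler_piMl// cos_max //.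
Qed.

Lemma onem_cos (R : realType) (x : R) : 1 - cos x = 2 * sin (x / 2) ^+ 2.
Proof. by rewrite [in cos x](splitr x) cosD -!expr2 cos2sin2; ring. Qed.

Lemma onem_cos_le (R : realType) (x : R) : 1 - cos x <= x ^+ 2 / 2.
Proof.
rewrite onem_cos; have := norm_sin_le _ (x / 2); rewrite -(@ler_pXn2r _ 2)// ?nnegrE//.
rewrite !real_normK ?num_real//; lra.
Qed.

(** Order two suffices: the remainder is always compared with [|y|^2], the power that a Lévy measure
    integrates near 0. *)
Lemma norm_sin_sub_le (R : realType) (x : R) : `|sin x - x| <= x ^+ 2.
Proof.
wlog x0 : x / 0 < x.
  move=> H; have [->|xn0] := eqVneq x 0; first by rewrite sin0 subr0 normr0 expr0n.
  have [/H//|x0] := ltP 0 x.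
  by rewrite -normrN opprD -sinN -(sqrrN x) H// oppr_gt0 lt_neqAle xn0.
have [c] := MVT x0 (fun y _ => is_derive_sin y) (continuous_subspaceT (@continuous_sin R)).
rewrite in_itv/= => /andP[c0 cx]; rewrite sin0 !subr0 => ->.
have := onem_cos_le _ c; have := cos_geN1 c; have := cos_le1 c => h1 h2 h3.
rewrite -{2}(mul1r x) -mulrBl normrM (gtr0_norm x0) expr2 ler_pM2r//.
rewrite distrC ger0_norm; last by lra.
(* Up to 2, [1 - cos c <= c^2 / 2 <= x^2 / 2 <= x]; beyond 2, [1 - cos c <= 2] is enough. *)
have [x2|x2] := leP x 2; first by nra.
lra.
Qed.

Section smooth_step.
Context {R : realType}.
Implicit Types x y h : R.

Definition cubp x := Num.max x 0 ^+ 3.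

(** The truncated cube is C^2 with a 6-Lipschitz second derivative, so its second-order remainder is
    at most [6 |h|^3 / 3!]. The proof goes through the signs of [x] and [x + h]; when they agree the
    remainder is 0 or [h^3]. *)
Lemma cubp_taylor x h :
  `|cubp (x + h) - cubp x - h * (3 * Num.max x 0 ^+ 2) - h ^+ 2 / 2 * (6 * Num.max x 0)|
  <= `|h| ^+ 3.
Proof.
rewrite /cubp; have [x0|x0] := leP x 0; have [xh|xh] := leP (x + h) 0.
- by rewrite !expr0n/= !mulr0 !subr0 normr0 exprn_ge0.
- rewrite !expr0n/= !mulr0 !subr0 normrX ler_pXn2r ?nnegrE//; first by rewrite !gtr0_norm; lra.
- have h0 : h < 0 by lra.
  rewrite (ltr0_norm h0) expr0n/=.
  have -> : 0 - x ^+ 3 - h * (3 * x ^+ 2) - h ^+ 2 / 2 * (6 * x) = h ^+ 3 - (x + h) ^+ 3 by field.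
  have -> : (- h) ^+ 3 = - h ^+ 3 by ring.
  have : (x + h) * (x + h) ^+ 2 <= 0 by rewrite mulr_le0_ge0 // sqr_ge0.
  have : h * h ^+ 2 <= 0 by rewrite mulr_le0_ge0 ?sqr_ge0// ltW.
  have : (- (x + h)) ^+ 3 <= (- h) ^+ 3.
    by rewrite lerXn2r ?nnegrE ?oppr_ge0// ?lerN2 ?lerDr; exact: ltW.
  have -> : (- (x + h)) ^+ 3 = - (x + h) ^+ 3 by ring.
  have -> : (- h) ^+ 3 = - h ^+ 3 by ring.
  rewrite -!exprS ler_norml => ? ? ?; apply/andP; split; lra.
- rewrite (_ : (x + h) ^+ 3 - _ - _ - _ = h ^+ 3) ?normrX//; by field.
Qed.
End smooth_step.
Section cutoff.
Context {R : realType}.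
Implicit Types x y h : R.

(** Third difference of [cubp] over [3!]: the distribution function of a sum of three independent
    uniform variables on [0, 1], hence a C^2 step from 0 to 1 over [0, 3]. *)
Definition spline3 x : R :=
  (cubp x - 3 * cubp (x - 1) + 3 * cubp (x - 2) - cubp (x - 3)) / 6.

Definition spline3_d1 x : R :=
  (3 * Num.max x 0 ^+ 2 - 3 * (3 * Num.max (x - 1) 0 ^+ 2)
   + 3 * (3 * Num.max (x - 2) 0 ^+ 2) - 3 * Num.max (x - 3) 0 ^+ 2) / 6.

Definition spline3_d2 x : R :=
  (6 * Num.max x 0 - 3 * (6 * Num.max (x - 1) 0)
   + 3 * (6 * Num.max (x - 2) 0) - 6 * Num.max (x - 3) 0) / 6.

(** The remainder is linear in the function, so the constant is at most [(1 + 3 + 3 + 1) / 6],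
    rounded up to 2. *)
Lemma spline3_taylor x h :
  `|spline3 (x + h) - spline3 x - h * spline3_d1 x - h ^+ 2 / 2 * spline3_d2 x|
  <= 2 * `|h| ^+ 3.
Proof.
pose r y := cubp (y + h) - cubp y - h * (3 * Num.max y 0 ^+ 2) - h ^+ 2 / 2 * (6 * Num.max y 0).
have -> : spline3 (x + h) - spline3 x - h * spline3_d1 x - h ^+ 2 / 2 * spline3_d2 x =
   (r x - 3 * r (x - 1) + 3 * r (x - 2) - r (x - 3)) / 6.
  rewrite /r /spline3 /spline3_d1 /spline3_d2.
  have e c : x + h - c = x - c + h by ring.
  by rewrite !e; field.
have := cubp_taylor x h; have := cubp_taylor (x - 1) h.
have := cubp_taylor (x - 2) h; have := cubp_taylor (x - 3) h.
rewrite -/(r x) -/(r (x - 1)) -/(r (x - 2)) -/(r (x - 3)).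
rewrite !ler_norml => /andP[? ?] /andP[? ?] /andP[? ?] /andP[? ?].
apply/andP; split; lra.
Qed.

Lemma spline3_eq0 x : x <= 0 -> spline3 x = 0.
Proof.
move=> x0; rewrite /spline3 /cubp.
have [_|?] := leP x 0; last by lra.
have [_|?] := leP (x - 1) 0; last by lra.
have [_|?] := leP (x - 2) 0; last by lra.
have [_|?] := leP (x - 3) 0; last by lra.
by rewrite expr0n/=; field.
Qed.

Lemma spline3_eq1 x : 3 <= x -> spline3 x = 1.
Proof.
move=> x0; rewrite /spline3 /cubp.
have [?|_] := leP x 0; first by lra.
have [?|_] := leP (x - 1) 0; first by lra.
have [?|_] := leP (x - 2) 0; first by lra.
have [?|_] := leP (x - 3) 0.
  have -> : x = 3 by lra.
  by rewrite expr0n/=; field.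
by field.
Qed.

Lemma spline3_01 x : 0 <= spline3 x <= 1.
Proof.
have [x0|x0] := leP x 0; first by rewrite spline3_eq0 ?lexx ?ler01.
have [x3|x3] := leP 3 x; first by rewrite spline3_eq1 ?lexx ?ler01.
rewrite /spline3 /cubp.
have [?|_] := leP x 0; first by lra.
have [x1|x1] := leP (x - 1) 0.
  have [_|?] := leP (x - 2) 0; last by lra.
  have [_|?] := leP (x - 3) 0; last by lra.
  rewrite expr0n/= !mulr0 !subr0 addr0.
  have : 0 <= x ^+ 3 by rewrite exprn_ge0// ltW.
  have : x ^+ 3 <= 1 by rewrite exprn_ile1; lra.
  by move=> ? ?; apply/andP; split; lra.
have [x2|x2] := leP (x - 2) 0.
  have [_|?] := leP (x - 3) 0; last by lra.
  set v := x - 1; have v01 : 0 <= v <= 1 by apply/andP; rewrite /v; split; lra.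
  have -> : x = v + 1 by rewrite /v; ring.
  by apply/andP; split; nra.
have [_|?] := leP (x - 3) 0; last by lra.
(* Symmetry of the step about 3/2: the last piece is [1 - (3 - x)^3 / 6]. *)
set v := 3 - x; have v01 : 0 <= v <= 1 by apply/andP; rewrite /v; split; lra.
have -> : x ^+ 3 - 3 * (x - 1) ^+ 3 + 3 * (x - 2) ^+ 3 - 0 ^+ 3 = 6 - v ^+ 3.
  by rewrite /v; ring.
have : 0 <= v ^+ 3 by case/andP: v01 => ? ?; rewrite exprn_ge0.
have : v ^+ 3 <= 1 by case/andP: v01 => ? ?; rewrite exprn_ile1.
by move=> ? ?; apply/andP; split; lra.
Qed.

Lemma continuous_cubp : continuous (cubp : R -> R).
Proof.
move=> x; apply: (@continuous_comp _ _ _ (fun y : R => Num.max y 0) (fun y => y ^+ 3)).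
  by apply: (@continuous_max _ _ idfun (cst 0)); [exact: cvg_id|exact: cvg_cst].
exact: exprn_continuous.
Qed.

Lemma continuous_spline3 : continuous (spline3 : R -> R).
Proof.
have H c : continuous (fun y : R => cubp (y - c)).
  move=> x; apply: (@continuous_comp _ _ _ (fun y : R => y - c) cubp).
    by apply: cvgB; [exact: cvg_id|exact: cvg_cst].
  exact: continuous_cubp.
move=> x; apply: cvgM; last exact: cvg_cst.
apply: cvgB; last exact: H.
apply: cvgD; last by apply: cvgM; [exact: cvg_cst|exact: H].
apply: cvgB; last by apply: cvgM; [exact: cvg_cst|exact: H].
exact: continuous_cubp.
Qed.
End cutoff.

(** * Lower tail bound for the symmetric random walk *)

Section rademacher_walk.
Context {R : realType}.
Implicit Types (x h : R) (f g : R -> R).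

(** One Rademacher step as an operator: [iter n (avg h) f 0] is the mean of [f] at the end of the
    walk, without any random variables being built. *)
Definition avg h f x := (f (x + h) + f (x - h)) / 2.

Lemma le_iter_avg h f g n : (forall x, f x <= g x) ->
  forall x, iter n (avg h) f x <= iter n (avg h) g x.
Proof.
move=> fg; elim: n => //= n IH x; rewrite /avg ler_pM2r ?invr_gt0//.
by rewrite lerD.
Qed.

Variables (h lam m c K : R) (c0 : c != 0).
Let E := expR (lam * h).
Let F := expR (- (lam * h)).
(** [tau] is [tanh (lam h)], the mean of an exponentially tilted sign. In [tilted], the tilted walk
    started at [x] has mean [x + n h tau] and variance [n h^2 (1 - tau^2)], and [(E + F) / 2] is the
    normalising [cosh (lam h)]. *)
Let tau := (E - F) / (E + F).
Let tilted n x := K * ((E + F) / 2) ^+ n * expR (lam * x) *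
  (1 - ((x - m + n%:R * h * tau) ^+ 2 + n%:R * h ^+ 2 * (1 - tau ^+ 2)) / c ^+ 2).

(* The family [e^(lam x)] times quadratics is stable under [avg h]: this is
   the exponential change of measure of the random walk. *)
Lemma iter_avg_tilted n x : iter n (avg h) (tilted 0) x = tilted n x.
Proof.
elim: n x => // n IH x; rewrite iterS /avg !IH /tilted.
rewrite (mulrDr lam) (mulrBr lam x) !expRD -/E -/F (mulrSr 1 n) [_ ^+ n.+1]exprS.
have EF : E + F != 0 by rewrite gt_eqF// addr_gt0 ?expR_gt0.
rewrite /tau; set X := expR (lam * x); set Q := _ ^+ n.
by field; rewrite c0 EF.
Qed.

End rademacher_walk.

Section rademacher_tail.
Context {R : realType}.

Lemma tanh_approx (u : R) : 0 <= u <= 1 / 4 ->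
  `|(expR u - expR (- u)) / (expR u + expR (- u)) - u| <= 2 * u ^+ 2.
Proof.
move=> /andP[u0 u1].
set E := expR u; have E0 : 0 < E by exact: expR_gt0.
have e1 : 1 + 2 * u <= E ^+ 2 by rewrite -expRM_natl; exact: expR_ge1Dx.
have e2 : E ^+ 2 * (1 - 2 * u) <= 1.
  have := expR_ge1Dx (- (2 * u)); rewrite expRN expRM_natl -/E => H.
  by rewrite mulrC -ler_pdivlMr ?exprn_gt0// div1r.
have E2 : 0 < E ^+ 2 by rewrite exprn_gt0.
rewrite expRN -/E.
have -> : (E - E^-1) / (E + E^-1) = 1 - 2 / (E ^+ 2 + 1).
  by field; rewrite !gt_eqF ?addr_gt0 ?mulr_gt0//.
rewrite ler_norml; apply/andP; split.
  rewrite lerBrDr lerBrDr addrC -lerBrDr ler_pdivrMr ?addr_gt0//.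
  suff : 2 <= (1 - u + 2 * u ^+ 2) * (2 * u + 2) by nra.
  nra.
suff : 1 - u - 2 * u ^+ 2 <= 2 / (E ^+ 2 + 1) by lra.
rewrite ler_pdivlMr ?addr_gt0//.
have : 0 <= 1 - u - 2 * u ^+ 2 by nra.
nra.
Qed.

(** The loss [u^3] is affordable: with [n u^2 = W^2] and [u W^2 <= 1], it costs at most 1 in the
    exponent of the [n]-th power. With [y = u^2/2 - u^3/2] the proof chains
    [exp (y - y^2) <= 1 + y <= cosh u]. *)
Lemma cosh_ge (u : R) : 0 <= u <= 1 / 4 ->
  expR (u ^+ 2 / 2 - u ^+ 3) <= (expR u + expR (- u)) / 2.
Proof.
move=> /andP[u0 u1].
pose y := u ^+ 2 / 2 - u ^+ 3 / 2.
have y0 : 0 <= y by rewrite /y; nra.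
have y1 : y <= 1 by rewrite /y; nra.
apply: (@le_trans _ _ (1 + y)); last first.
  (* Half-angle identity: [cosh u - 1 = (a - b)^2 / 2], so a lower bound on [a - b] is enough. *)
  pose a := expR (u / 2); pose b := expR (- (u / 2)).
  have ab : a * b = 1 by rewrite /a /b expRxMexpNx_1.
  have -> : expR u = a ^+ 2 by rewrite /a -expRM_natl; congr expR; field.
  have -> : expR (- u) = b ^+ 2 by rewrite /b -expRM_natl; congr expR; field.
  have b0 : 1 - u / 2 <= b by exact: expR_ge1Dx.
  have bb : b ^+ 2 * (1 + u) <= 1.
    have : (1 + u) <= expR u by exact: expR_ge1Dx.
    have -> : b ^+ 2 = (expR u)^-1 by rewrite -expRN /b -expRM_natl; congr expR; field.
    by rewrite mulrC ler_pdivrMr ?expR_gt0// mul1r.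
  have ab2 : u * (1 - u / 2) <= a - b.
    have : u * b <= a - b.
      have bp : 0 < b by exact: expR_gt0.
      rewrite -(ler_pM2r bp) mulrBl ab; nra.
    by apply: le_trans; rewrite ler_wpM2l.
  have p : 0 <= u * (1 - u / 2) by nra.
  have : (u * (1 - u / 2)) ^+ 2 <= (a - b) ^+ 2 by rewrite ler_pXn2r ?nnegrE// (le_trans p).
  have -> : (a - b) ^+ 2 = a ^+ 2 + b ^+ 2 - 2 by rewrite sqrrB ab; ring.
  rewrite /y; nra.
apply: (@le_trans _ _ (expR (y - y ^+ 2))).
  rewrite ler_expR /y; nra.
have w1 : 0 < 1 - y + y ^+ 2 by nra.
have := expR_ge1Dx (- (y - y ^+ 2)); rewrite expRN => H.
have : (1 - y + y ^+ 2) * expR (y - y ^+ 2) <= 1.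
  rewrite -ler_pdivlMr ?expR_gt0// div1r; apply: le_trans H; lra.
move=> H2; rewrite -(ler_pM2l w1); apply: (le_trans H2).
have -> : (1 - y + y ^+ 2) * (1 + y) = 1 + y ^+ 3 by ring.
by rewrite lerDl exprn_ge0.
Qed.

(** With [W = w + 2 = m / s]: the tilting constant contributes [-(W^2 + 2 W)], the power of [cosh]
    at least [W^2 / 2 - 1], and the second moment bound the factor 1/2. *)
Definition tail_low (w : R) := expR (- ((w + 2) ^+ 2 / 2 + 2 * (w + 2) + 1)) / 2.

(* With [m = a + 2s], [c = 2s] and [lam = m / s^2], the indicator of [a, oo)
   dominates [e^(lam (x - m - c)) (1 - ((x - m) / c)^2)], a tilted quadratic. *)
Lemma iter_avg_tail (f : R -> R) (a s h : R) (n : nat) :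
  0 < a -> 0 < s -> 0 < h -> n%:R * h ^+ 2 = s ^+ 2 ->
  (a + 2 * s) ^+ 3 * h <= s ^+ 4 ->
  (forall x, 0 <= f x) -> (forall x, a <= x -> 1 <= f x) ->
  tail_low (a / s) <= iter n (avg h) f 0.
Proof.
move=> a0 s0 h0 nh hs f0 f1.
pose m := a + 2 * s; pose c := 2 * s; pose lam := m / s ^+ 2.
pose K := expR (- (lam * (m + c))).
pose W := m / s.
have m0 : 0 < m by rewrite /m addr_gt0// mulr_gt0.
have c0 : 0 < c by rewrite mulr_gt0.
have lam0 : 0 < lam by rewrite divr_gt0 ?exprn_gt0.
have W2 : 2 <= W by rewrite /W ler_pdivlMr// /m; lra.
have mW : m = W * s by rewrite /W; field; rewrite gt_eqF.
pose u := lam * h.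
have u0 : 0 < u by rewrite mulr_gt0.
(* This is the hypothesis on [h] rewritten; since [n u^2 = W^2], it bounds the total third-order
   loss [n u^3]. *)
have uW : u * W ^+ 2 <= 1.
  have -> : u * W ^+ 2 = m ^+ 3 * h / s ^+ 4.
    by rewrite /u /lam /W; field; rewrite gt_eqF.
  by rewrite ler_pdivrMr ?exprn_gt0// mul1r.
have W4 : 4 <= W ^+ 2 by nra.
have u4 : 0 <= u <= 1 / 4.
  rewrite (ltW u0)/=.
  have : u * 4 <= u * W ^+ 2 by rewrite ler_pM2l.
  lra.
pose E := expR (lam * h). pose F := expR (- (lam * h)).
pose tau := (E - F) / (E + F).
have htau : `|tau - u| <= 2 * u ^+ 2 by exact: tanh_approx.
pose g x := K * ((E + F) / 2) ^+ 0 * expR (lam * x) *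
  (1 - ((x - m + 0%:R * h * tau) ^+ 2 + 0%:R * h ^+ 2 * (1 - tau ^+ 2)) / c ^+ 2).
have gf x : g x <= f x.
  have [xmc|] := leP (`|x - m|) c; last first.
    move=> cx; apply: le_trans (f0 x); rewrite /g expr0 mulr1.
    rewrite mulr_ge0_le0// ?mulr_ge0 ?expR_ge0// subr_le0 !mul0r !addr0.
    rewrite ler_pdivlMr ?exprn_gt0// mul1r -(real_normK (num_real (x - m))).
    by rewrite lerXn2r ?nnegrE// ltW.
  have ax : a <= x by move: xmc; rewrite ler_norml /m /c; lra.
  apply: le_trans (f1 _ ax); rewrite /g expr0 mulr1 !mul0r !addr0 /K -expRD.
  rewrite -[leRHS]mulr1 ler_pM ?expR_ge0//.
  - rewrite subr_ge0 ler_pdivrMr ?exprn_gt0// mul1r -(real_normK (num_real (x - m))).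
    by rewrite lerXn2r ?nnegrE// ltW.
  - rewrite expR_le1 -mulrN -mulrDr pmulr_rle0//.
    by move: xmc; rewrite ler_norml; lra.
  - by rewrite gerBl divr_ge0 ?sqr_ge0.
apply: le_trans (le_iter_avg h g f n gf 0).
rewrite /g (iter_avg_tilted h lam m c K) ?gt_eqF// -/E -/F -/tau.
rewrite mulr0 expR0 mulr1 sub0r.
have EF0 : 0 < E + F by rewrite addr_gt0 ?expR_gt0.
have t1 : tau ^+ 2 <= 1.
  rewrite -(real_normK (num_real tau)) exprn_ile1//.
  rewrite ler_norml /tau ler_pdivrMr// ler_pdivlMr// mul1r mulN1r.
  have : 0 < E by exact: expR_gt0. have : 0 < F by exact: expR_gt0.
  by move=> ? ?; apply/andP; split; lra.
(* [lam] is chosen so that [n h (lam h) = m]; replacing [tanh] by its argument moves the tilted mean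
   by at most [2 W u s <= W^2 u s <= s]. *)
have dev : `|- m + n%:R * h * tau| <= s.
  have -> : - m + n%:R * h * tau = n%:R * h * (tau - u).
    have -> : m = n%:R * h * u; last by ring.
    rewrite /u (_ : n%:R * h * (lam * h) = lam * (n%:R * h ^+ 2)); last by ring.
    by rewrite nh /lam; field; rewrite gt_eqF.
  rewrite normrM ger0_norm; last by rewrite mulr_ge0// ltW.
  apply: (le_trans (ler_wpM2l _ htau)); first by rewrite mulr_ge0// ltW.
  have -> : n%:R * h * (2 * u ^+ 2) = 2 * (n%:R * h ^+ 2) * lam * u by rewrite /u; ring.
  rewrite nh.
  have -> : 2 * s ^+ 2 * lam * u = s * (2 * W * u).
    by rewrite /lam /W; field; rewrite gt_eqF.
  by rewrite -[leRHS]mulr1 ler_pM2l//; nra.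
(* Squared bias and variance are each at most [s^2], and [c^2 = 4 s^2]. *)
have B : 1 / 2 <= 1 - ((- m + n%:R * h * tau) ^+ 2 + n%:R * h ^+ 2 * (1 - tau ^+ 2)) / c ^+ 2.
  rewrite nh.
  have : (- m + n%:R * h * tau) ^+ 2 <= s ^+ 2.
    by rewrite -(real_normK (num_real (_ + _))) lerXn2r ?nnegrE// ltW.
  have : s ^+ 2 * (1 - tau ^+ 2) <= s ^+ 2.
    by rewrite ler_piMr ?sqr_ge0// gerBl sqr_ge0.
  move=> d1 d2.
  have : ((- m + n%:R * h * tau) ^+ 2 + s ^+ 2 * (1 - tau ^+ 2)) / c ^+ 2 <= 1 / 2; last by lra.
  rewrite ler_pdivrMr ?exprn_gt0// /c; lra.
have Kn : expR (W ^+ 2 / 2 - 1) <= ((E + F) / 2) ^+ n.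
  apply: (@le_trans _ _ (expR (u ^+ 2 / 2 - u ^+ 3) ^+ n)); last first.
    rewrite lerXn2r ?nnegrE ?expR_ge0//; first by rewrite divr_ge0// ltW.
    exact: cosh_ge.
  rewrite -expRM_natl ler_expR.
  have nu : n%:R * u ^+ 2 = W ^+ 2.
    rewrite /u exprMn mulrCA nh /W /lam; field; rewrite gt_eqF//.
  have -> : n%:R * (u ^+ 2 / 2 - u ^+ 3) = n%:R * u ^+ 2 / 2 - n%:R * u ^+ 2 * u by ring.
  by rewrite nu; lra.
have -> : tail_low (a / s) = K * expR (W ^+ 2 / 2 - 1) * (1 / 2).
  rewrite /tail_low mul1r; congr (_ * _); rewrite /K -expRD; congr expR.
  by rewrite /W /lam /c /m; field; rewrite gt_eqF.
apply: ler_pM => //; first by rewrite mulr_ge0 ?expR_ge0.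
by rewrite ler_pM2l ?expR_gt0.
Qed.

End rademacher_tail.

(** * Polynomial approximation *)

Section bernstein.
Context {R : realType}.
Implicit Types (phi psi : nat -> R) (u : R).

(* [(bernstein N phi).[u]] is the expectation of [phi] under the binomial law
   with parameters [N] and [u]. *)
Fixpoint bernstein N phi : {poly R} :=
  if N is n.+1 then 'X * bernstein n (phi \o S) + (1 - 'X) * bernstein n phi
  else (phi 0%N)%:P.

Lemma bernsteinS N phi u : (bernstein N.+1 phi).[u] =
  u * (bernstein N (phi \o S)).[u] + (1 - u) * (bernstein N phi).[u].
Proof. by rewrite /= !hornerE. Qed.

Lemma bernstein_lin N a phi psi u : (bernstein N (fun k => a * phi k + psi k)).[u] =
  a * (bernstein N phi).[u] + (bernstein N psi).[u].
Proof.
elim: N phi psi => [|N IH] phi psi; first by rewrite /= !hornerE.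
by rewrite !bernsteinS IH (IH (phi \o S) (psi \o S)); ring.
Qed.

Lemma bernstein_cst N (a u : R) : (bernstein N (fun=> a)).[u] = a.
Proof.
elim: N => [|N IH]; first by rewrite /= !hornerE.
by rewrite bernsteinS (_ : (fun=> a) \o S = (fun=> a)) ?IH; [ring|].
Qed.

(** Binomial variance plus squared mean. The free shift [c] carries the induction, since composing
    with the successor turns [c] into [1 + c]. *)
Lemma bernstein_sqr N (c u : R) : (bernstein N (fun k => (k%:R + c) ^+ 2)).[u] =
  N%:R * u * (1 - u) + (N%:R * u + c) ^+ 2.
Proof.
elim: N c => [|N IH] c; first by rewrite /= !hornerE; ring.
rewrite bernsteinS IH.
have -> : (fun k => (k%:R + c) ^+ 2) \o S = (fun k => (k%:R + (1 + c)) ^+ 2).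
  by apply/funext => k /=; rewrite -natr1; ring.
by rewrite IH -[N.+1%:R]natr1; ring.
Qed.

Lemma bernstein_le N phi psi u : 0 <= u <= 1 -> (forall k, (k <= N)%N -> phi k <= psi k) ->
  (bernstein N phi).[u] <= (bernstein N psi).[u].
Proof.
move=> /andP[u0 u1]; elim: N phi psi => [|N IH] phi psi pp.
  by rewrite /= !hornerE; exact: pp.
rewrite !bernsteinS lerD// ler_wpM2l ?subr_ge0//; apply: IH => k kN; apply: pp => //.
exact: leqW.
Qed.

Lemma bernstein_approx (F : R -> R) (L e : R) :
  0 < e -> (forall x y, `|F x - F y| <= L * `|x - y|) ->
  exists p : {poly R}, forall u, 0 <= u <= 1 -> `|F u - p.[u]| <= e.
Proof.
move=> e0 FL.
have L0 : 0 <= L by have := FL 1 0; rewrite subr0 normr1 mulr1; apply: le_trans.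
have [d d0 Ld] : exists2 d, 0 < d & L * d <= e / 2.
  have L1 : 0 < L + 1 by lra.
  exists (e / (2 * (L + 1))); first by rewrite divr_gt0// mulr_gt0.
  rewrite mulrA ler_pdivrMr ?mulr_gt0//.
  have -> : e / 2 * (2 * (L + 1)) = e * (L + 1) by field.
  by nra.
pose N := (Num.bound (1 / d ^+ 2)).+1.
have N0 : 0 < N%:R :> R by rewrite ltr0n.
have Nd : 1 <= N%:R * d ^+ 2.
  rewrite -ler_pdivrMr ?exprn_gt0//.
  have : 1 / d ^+ 2 < (Num.bound (1 / d ^+ 2))%:R.
    by rewrite archi_boundP// divr_ge0 ?exprn_ge0 ?ltW.
  move=> H.
  by rewrite (le_trans (ltW H))// ler_nat.
exists (bernstein N (fun k => F (k%:R / N%:R))) => u u01.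
(* With [t = k/N - u], the inequality [|t| <= t^2 / d + d] turns the Lipschitz bound into a
   quadratic one, whose mean is known; [N d^2 >= 1] then makes both terms at most [L d]. *)
have key k : `|F (k%:R / N%:R) - F u| <=
    L / (d * N%:R ^+ 2) * (k%:R + (- (N%:R * u))) ^+ 2 + L * d.
  apply: le_trans (FL _ _) _.
  have -> : k%:R + - (N%:R * u) = N%:R * (k%:R / N%:R - u) by field; rewrite gt_eqF.
  set t := _ / _ - u.
  rewrite (_ : _ + L * d = L * (t ^+ 2 / d + d)); last by field; rewrite !gt_eqF.
  apply: ler_wpM2l => //; rewrite -(real_normK (num_real t)).
  rewrite -(ler_pM2r d0) mulrDl divfK ?gt_eqF//.
  have := normr_ge0 t; move: (`|t|) => w w0; nra.
have var : (bernstein N (fun k => L / (d * N%:R ^+ 2) * (k%:R + (- (N%:R * u))) ^+ 2 + L * d)).[u] <= e.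
  rewrite (bernstein_lin _ _ (fun k => (k%:R + - (N%:R * u)) ^+ 2) (fun=> L * d)).
  rewrite bernstein_sqr bernstein_cst subrr expr0n addr0.
  have uu : u * (1 - u) <= 1 by nra.
  have -> : L / (d * N%:R ^+ 2) * (N%:R * u * (1 - u)) = L / (d * N%:R) * (u * (1 - u)).
    by field; rewrite !gt_eqF.
  have c0 : 0 <= L / (d * N%:R) by rewrite divr_ge0// mulr_ge0// ltW.
  have H1 : L / (d * N%:R) * (u * (1 - u)) <= L / (d * N%:R).
    by rewrite -[leRHS]mulr1 ler_wpM2l.
  have H2 : L / (d * N%:R) <= L * d.
    rewrite ler_wpM2l// -[leLHS]div1r ler_pdivrMr ?mulr_gt0//.
    by rewrite mulrCA mulrA mulrC mulrA; rewrite -mulrA -expr2.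
  by have := lerD (le_trans H1 (le_trans H2 Ld)) Ld; rewrite -splitr.
rewrite distrC ler_norml.
have e1 : (bernstein N (fun k => F (k%:R / N%:R))).[u] - F u =
  (bernstein N (fun k => 1 * F (k%:R / N%:R) + - F u)).[u].
  by rewrite bernstein_lin bernstein_cst mul1r.
have e2 : - (bernstein N (fun k => L / (d * N%:R ^+ 2) * (k%:R + (- (N%:R * u))) ^+ 2 + L * d)).[u] = 
  (bernstein N (fun k => (-1) * (L / (d * N%:R ^+ 2) * (k%:R + (- (N%:R * u))) ^+ 2 + L * d) + 0)).[u].
  by rewrite (bernstein_lin _ (-1) (fun k => _ + _)) bernstein_cst addr0 mulN1r.
rewrite e1; apply/andP; split.
  apply: (@le_trans _ _ (- (bernstein N (fun k => L / (d * N%:R ^+ 2) * (k%:R + (- (N%:R * u))) ^+ 2 + L * d)).[u])).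
    by rewrite lerN2.
  rewrite e2; apply: bernstein_le => // k _.
  by have := key k; rewrite mul1r ler_norml mulN1r addr0 => /andP[].
apply: le_trans var; apply: bernstein_le => // k _.
by have := key k; rewrite mul1r ler_norml => /andP[].
Qed.

Lemma weierstrass_lipschitz (F : R -> R) (L K e : R) :
  0 < K -> 0 < e -> (forall x y, `|F x - F y| <= L * `|x - y|) ->
  exists p : {poly R}, forall r, 0 <= r <= K -> `|F r - p.[r]| <= e.
Proof.
move=> K0 e0 FL.
have [|p pP] := @bernstein_approx (fun u => F (K * u)) (L * K) e e0.
  move=> x y; apply: le_trans (FL _ _) _.
  by rewrite -mulrBr normrM (gtr0_norm K0) mulrA.
exists (p \Po (K^-1 *: 'X)) => r /andP[r0 rK].
have := pP (K^-1 * r); rewrite mulVKf ?gt_eqF// horner_comp !hornerE; apply.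
by rewrite mulr_ge0 ?invr_ge0 ?(ltW K0)//= ler_pdivrMl// mulr1.
Qed.

End bernstein.

(** * Integrals and Euclidean vectors *)

Section integral_facts.
Context d (T : measurableType d) (R : realType).

Lemma cvg_Rintegral_dominated (mu : {measure set T -> \bar R}) (D : set T)
    (F_ : nat -> T -> R) (F g : T -> R) :
  measurable D -> (forall n, measurable_fun D (F_ n)) ->
  (forall x, D x -> F_ n x @[n --> \oo] --> F x) ->
  mu.-integrable D (EFin \o g) ->
  (forall n x, D x -> `|F_ n x| <= g x) ->
  Rintegral mu D (F_ n) @[n --> \oo] --> Rintegral mu D F.
Proof.
move=> mD mF FF ig Fg.
have mf : measurable_fun D F by apply: (@measurable_fun_cvg _ _ _ D F_).
have [iF _ H] : [/\ mu.-integrable D (EFin \o F),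
  [sequence \int[mu]_(x in D) (`|(EFin \o F_ n) x - (EFin \o F) x|)]_n @ \oo --> 0 &
  [sequence \int[mu]_(x in D) ((EFin \o F_ n) x)]_n @ \oo --> \int[mu]_(x in D) ((EFin \o F) x)]%E.
  apply: (dominated_convergence mD _ _ _ ig) => //.
  - by move=> n; apply/measurable_EFinP.
  - exact/measurable_EFinP.
  - apply: aeW => x Dx; apply: cvg_EFin; last exact: FF.
    exact: nearW.
  - by apply: aeW => x n Dx; rewrite /= lee_fin; exact: Fg.
by apply: fine_cvg; rewrite fineK// integrable_fin_num.
Qed.

Lemma integrable_bounded (P : probability T R) (D : set T) (h : T -> R) (M : R) :
  measurable D -> measurable_fun D h -> (forall x, D x -> `|h x| <= M) ->
  P.-integrable D (EFin \o h).
Proof.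
move=> mD mh hM; apply: measurable_bounded_integrable => //.
  by rewrite (le_lt_trans (probability_le1 P mD))// ltry.
exists M; split; first exact: num_real.
by move=> x /ltW Mx y Dy; exact: le_trans (hM _ Dy) _.
Qed.
Lemma Rintegral_pushforward_eq d' (T' : measurableType d') (P : probability T R)
    (U V : T -> T') (h : T' -> R) (M : R) :
  measurable_fun setT U -> measurable_fun setT V -> measurable_fun setT h ->
  (forall y, `|h y| <= M) ->
  (forall B, measurable B -> P (U @^-1` B) = P (V @^-1` B)) ->
  Rintegral P setT (h \o U) = Rintegral P setT (h \o V).
Proof.
move=> mU mV mh hM UV.
have bd W : measurable_fun setT W -> P.-integrable setT (EFin \o (h \o W)).
  by move=> mW; apply: (@integrable_bounded _ _ _ M) => //; [exact: measurableT_comp|move=> x _; exact: hM].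
rewrite /Rintegral; congr fine.
transitivity (\int[pushforward P U]_y (h y)%:E)%E.
  by rewrite (integral_pushforward mU)//; [exact/measurable_EFinP|exact: bd].
transitivity (\int[pushforward P V]_y (h y)%:E)%E; last first.
  by rewrite (integral_pushforward mV)//; [exact/measurable_EFinP|exact: bd].
by apply: eq_measure_integral => B mB _; exact: UV.
Qed.

End integral_facts.

Section vector_facts.
Context {R : realType} {d : nat}.
Implicit Types u v y z : d.-tuple R.

Definition vadd u v : d.-tuple R := [tuple tnth u i + tnth v i | i < d].
Definition vscale (a : R) u : d.-tuple R := [tuple a * tnth u i | i < d].
Definition vunit (i : 'I_d) : d.-tuple R := [tuple (i == j)%:R | j < d].

Lemma dotvC u v : dotv u v = dotv v u.
Proof. by apply: eq_bigr => i _; rewrite mulrC. Qed.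

Lemma dotv_addl u v y : dotv (vadd u v) y = dotv u y + dotv v y.
Proof. by rewrite -big_split; apply: eq_bigr => i _; rewrite tnth_mktuple mulrDl. Qed.

Lemma dotv_subl u v y : dotv (vsub u v) y = dotv u y - dotv v y.
Proof. by rewrite -sumrB; apply: eq_bigr => i _; rewrite tnth_mktuple mulrBl. Qed.

Lemma dotv_scalel a u y : dotv (vscale a u) y = a * dotv u y.
Proof. by rewrite mulr_sumr; apply: eq_bigr => i _; rewrite tnth_mktuple mulrA. Qed.

Lemma dotv0l y : dotv vzero y = 0.
Proof. by apply: big1 => i _; rewrite tnth_mktuple mul0r. Qed.

Lemma dotv_unit i y : dotv (vunit i) y = tnth y i.
Proof.
rewrite /dotv (bigD1 i)//= tnth_mktuple eqxx mul1r big1 ?addr0// => j ji.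
by rewrite tnth_mktuple eq_sym (negbTE ji) mul0r.
Qed.

Lemma sumsq_ge0 y : 0 <= \sum_(i < d) tnth y i ^+ 2.
Proof. by apply: sumr_ge0 => i _; exact: sqr_ge0. Qed.

Lemma vnorm_ge0 y : 0 <= vnorm y. Proof. exact: sqrtr_ge0. Qed.

Lemma sqr_vnorm y : vnorm y ^+ 2 = \sum_(i < d) tnth y i ^+ 2.
Proof. by rewrite sqr_sqrtr// sumsq_ge0. Qed.

Lemma dotvv y : dotv y y = vnorm y ^+ 2.
Proof. by rewrite sqr_vnorm; apply: eq_bigr => i _; rewrite expr2. Qed.

Lemma vnorm_eq0 y : vnorm y = 0 -> y = vzero.
Proof.
move=> y0; apply: eq_from_tnth => i; rewrite tnth_mktuple; apply/eqP.
rewrite -sqrf_eq0; have := sqr_vnorm y; rewrite y0 expr0n/= => /esym/eqP.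
by rewrite psumr_eq0 => [/allP/(_ i (mem_index_enum _))|j _]//; exact: sqr_ge0.
Qed.

Lemma vnorm0 : vnorm (vzero : d.-tuple R) = 0.
Proof. by rewrite /vnorm big1 ?sqrtr0// => i _; rewrite tnth_mktuple expr0n. Qed.

(** Cauchy-Schwarz, by expanding the squared norm of [|v| u - |u| v]. *)
Lemma dotv_le u v : `|dotv u v| <= vnorm u * vnorm v.
Proof.
wlog duv : u / 0 <= dotv u v.
  have [d0|d0] := leP 0 (dotv u v); first exact.
  move=> H; have e : dotv (vscale (-1) u) v = - dotv u v by rewrite dotv_scalel mulN1r.
  have n : vnorm (vscale (-1) u) = vnorm u.
    by congr Num.sqrt; apply: eq_bigr => i _; rewrite tnth_mktuple mulN1r sqrrN.
  by rewrite -normrN -e -n; apply: H; rewrite e oppr_ge0 ltW.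
rewrite ger0_norm//.
have [u0|u0] := eqVneq (vnorm u) 0.
  by rewrite (vnorm_eq0 u u0) dotv0l mulr_ge0// vnorm_ge0.
have [v0|v0] := eqVneq (vnorm v) 0.
  by rewrite (vnorm_eq0 v v0) dotvC dotv0l mulr_ge0// vnorm_ge0.
have up : 0 < vnorm u by rewrite lt_neqAle eq_sym u0 vnorm_ge0.
have vp : 0 < vnorm v by rewrite lt_neqAle eq_sym v0 vnorm_ge0.
have : 0 <= \sum_(i < d) (tnth u i * vnorm v - tnth v i * vnorm u) ^+ 2.
  by apply: sumr_ge0 => i _; exact: sqr_ge0.
have -> : \sum_(i < d) (tnth u i * vnorm v - tnth v i * vnorm u) ^+ 2 =
    vnorm u ^+ 2 * vnorm v ^+ 2 + vnorm v ^+ 2 * vnorm u ^+ 2 - 2 * (vnorm u * vnorm v) * dotv u v.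
  rewrite {1}(sqr_vnorm u) {2}(sqr_vnorm v) !mulr_suml mulr_sumr -big_split -sumrB.
  by apply: eq_bigr => i _ /=; ring.
have uvp : 0 < vnorm u * vnorm v by rewrite mulr_gt0.
move=> H; rewrite -(ler_pM2l uvp).
by move: H; nra.
Qed.

Lemma dotv_sqr_le u v : dotv u v ^+ 2 <= vnorm u ^+ 2 * vnorm v ^+ 2.
Proof.
rewrite -exprMn -(real_normK (num_real (dotv u v))).
by rewrite lerXn2r ?nnegrE// ?dotv_le// mulr_ge0// vnorm_ge0.
Qed.

Lemma tnth_le_vnorm y i : `|tnth y i| <= vnorm y.
Proof.
rewrite -(@ler_pXn2r _ 2)// ?nnegrE ?vnorm_ge0// real_normK ?num_real// sqr_vnorm.
by rewrite (bigD1 i)//= lerDl; apply: sumr_ge0 => j _; exact: sqr_ge0.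
Qed.

Lemma vnorm_le_sum y : vnorm y <= \sum_(i < d) `|tnth y i|.
Proof.
have s0 : 0 <= \sum_(i < d) `|tnth y i| by exact: sumr_ge0.
rewrite -(@ler_pXn2r _ 2)// ?nnegrE ?vnorm_ge0// -dotvv expr2 mulr_suml.
apply: ler_sum => i _; rewrite (le_trans (ler_norm _))// normrM ler_wpM2l//.
by rewrite (bigD1 i)//= lerDl; apply: sumr_ge0.
Qed.

Lemma measurable_dotv z : measurable_fun setT (dotv z).
Proof.
apply: measurable_sum => i; apply: measurable_funM; first exact: measurable_cst.
exact: measurable_tnth.
Qed.

Lemma measurable_vnorm : measurable_fun setT (@vnorm R d).
Proof.
apply: (@measurableT_comp _ _ _ _ _ _ (@Num.sqrt R)).
  by apply: continuous_measurable_fun => x; exact: sqrt_continuous.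
by apply: measurable_sum => i; apply: measurable_funX; exact: measurable_tnth.
Qed.

Lemma measurable_vsub d' (T : measurableType d') (f g : T -> d.-tuple R) :
  measurable_fun setT f -> measurable_fun setT g ->
  measurable_fun setT (fun w => vsub (f w) (g w)).
Proof.
move=> mf mg; apply/measurable_fun_tnthP => i.
rewrite (_ : _ \o _ = fun w => tnth (f w) i - tnth (g w) i); last first.
  by apply/funext => w /=; rewrite tnth_mktuple.
by apply: measurable_funB; apply: (measurableT_comp (measurable_tnth i)).
Qed.

End vector_facts.

(** * Second moments from the characteristic function *)

Section levy_measure_facts.
Context {R : realType} {d : nat} (Pi : {measure set (d.-tuple R) -> \bar R}).
Hypothesis PiL : levy_measure Pi.
Hypothesis Pi1 : Pi [set y | 1 < vnorm y] = 0%E.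
Implicit Types (g : d.-tuple R -> R) (th y : d.-tuple R).

Let measurable_gt1 : measurable [set y : d.-tuple R | 1 < vnorm y].
Proof.
rewrite (_ : [set _ | _] = setT `&` (@vnorm R d) @^-1` `]1, +oo[%classic); last first.
  by apply/seteqP; split => y /=; rewrite in_itv/= andbT; [split|case].
by apply: measurable_vnorm => //; exact: measurable_itv.
Qed.

(** Beyond the unit ball [Pi] has no mass, and inside it [min(1, |y|^2)] is [|y|^2]. *)
Lemma levy_integrable g C : measurable_fun setT g ->
  (forall y, vnorm y <= 1 -> `|g y| <= C * vnorm y ^+ 2) ->
  Pi.-integrable setT (EFin \o g).
Proof.
move=> mg gC; case: PiL => _ fin.
pose m (y : d.-tuple R) := Num.min 1 (vnorm y ^+ 2).
have m0 y : 0 <= m y by rewrite /m le_min ler01 sqr_ge0.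
have mm : measurable_fun setT m.
  apply: measurable_minr; first exact: measurable_cst.
  by apply: measurable_funX; exact: measurable_vnorm.
have im : Pi.-integrable setT (EFin \o (fun y => C * m y)).
  apply: (@integrableZl _ _ _ _ _ measurableT C (EFin \o m)).
  apply/integrableP; split; first exact/measurable_EFinP.
  by under eq_integral do rewrite /= ger0_norm//.
apply/(@negligible_integrable _ _ _ Pi setT [set y | 1 < vnorm y]) => //.
  exact/measurable_EFinP.
have mD : measurable (setT `\` [set y : d.-tuple R | 1 < vnorm y]) by exact: measurableD.
have imD := integrableS measurableT mD (@subsetT _ _) im.
apply: (le_integrable mD _ _ imD).
- by apply: measurable_funTS; exact/measurable_EFinP.
- move=> y [_ /= /negP]; rewrite -leNgt => y1; rewrite lee_fin.
  rewrite (le_trans (gC _ y1))// (le_trans _ (ler_norm _))// /m min_r//.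
  by rewrite exprn_ile1// vnorm_ge0.
Qed.

Lemma eq_levy_Rintegral g1 g2 : measurable_fun setT g1 -> measurable_fun setT g2 ->
  (forall y, vnorm y <= 1 -> g1 y = g2 y) ->
  Rintegral Pi setT g1 = Rintegral Pi setT g2.
Proof.
move=> m1 m2 g12; rewrite /Rintegral; congr fine.
apply: ae_eq_integral => //; try exact/measurable_EFinP.
exists [set y | 1 < vnorm y]; split => //.
by move=> y /= /not_implyP[_]; apply: contra_notP => /negP; rewrite -leNgt => /g12 ->.
Qed.

Definition levy_m2 := Rintegral Pi setT (fun y => vnorm y ^+ 2).

Lemma levy_m2_ge0 : 0 <= levy_m2.
Proof. by apply: Rintegral_ge0 => y _; exact: sqr_ge0. Qed.

Let msq : measurable_fun setT (fun y : d.-tuple R => vnorm y ^+ 2).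
Proof. by apply: measurable_funX; exact: measurable_vnorm. Qed.

Lemma levy_Rintegral_le g C : measurable_fun setT g ->
  (forall y, `|g y| <= C * vnorm y ^+ 2) ->
  `|Rintegral Pi setT g| <= C * levy_m2.
Proof.
move=> mg gC.
have ig : Pi.-integrable setT (EFin \o g) by apply: (@levy_integrable _ C).
have isq : Pi.-integrable setT (EFin \o (fun y => vnorm y ^+ 2)).
  by apply: (@levy_integrable _ 1) => // y _; rewrite mul1r ger0_norm// sqr_ge0.
apply: le_trans (le_normr_Rintegral measurableT ig) _.
rewrite /levy_m2 -RintegralZl//; apply: le_Rintegral => //.
- exact: (@integrable_norm _ _ _ _ setT g ig).
- exact: (@integrableZl _ _ _ _ _ measurableT C (EFin \o _)).
Qed.

Lemma measurable_cos_dotv th : measurable_fun setT (fun y => cos (dotv th y)).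
Proof.
apply: (measurableT_comp _ (measurable_dotv th)).
by apply: continuous_measurable_fun; exact: continuous_cos.
Qed.

Lemma measurable_sin_dotv th : measurable_fun setT (fun y => sin (dotv th y)).
Proof.
apply: (measurableT_comp _ (measurable_dotv th)).
by apply: continuous_measurable_fun; exact: continuous_sin.
Qed.

Lemma measurable_vnorm_le1 (f : d.-tuple R -> R) : measurable_fun setT f ->
  measurable_fun setT (fun y => if vnorm y <= 1 then f y else 0).
Proof.
move=> mf; apply: measurable_fun_ifT => //.
by apply: measurable_fun_ler => //; exact: measurable_vnorm.
Qed.

Lemma norm_cos_dotv_le th y : `|cos (dotv th y) - 1| <= vnorm th ^+ 2 / 2 * vnorm y ^+ 2.
Proof.
rewrite distrC ger0_norm ?subr_ge0 ?cos_le1//.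
apply: le_trans (onem_cos_le _ _) _; rewrite [leRHS]mulrAC ler_pM2r ?invr_gt0//.
exact: dotv_sqr_le.
Qed.

Lemma norm_sin_dotv_le th y : `|sin (dotv th y) - dotv th y| <= vnorm th ^+ 2 * vnorm y ^+ 2.
Proof. exact: le_trans (norm_sin_sub_le _ _) (dotv_sqr_le _ _). Qed.

Lemma re_psi_le0 th : re_psi Pi th <= 0.
Proof.
rewrite -oppr_ge0 -mulN1r -RintegralZl//.
  by apply: Rintegral_ge0 => y _; rewrite mulN1r opprB subr_ge0 cos_le1.
apply: (@levy_integrable _ (vnorm th ^+ 2 / 2)) => [|y _]; last exact: norm_cos_dotv_le.
by apply: measurable_funB; [exact: measurable_cos_dotv|exact: measurable_cst].
Qed.

Lemma re_psi_le th : `|re_psi Pi th| <= vnorm th ^+ 2 / 2 * levy_m2.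
Proof.
apply: levy_Rintegral_le => [|y]; last exact: norm_cos_dotv_le.
by apply: measurable_funB; [exact: measurable_cos_dotv|exact: measurable_cst].
Qed.

Lemma im_psiE gamma th : im_psi gamma Pi th =
  dotv gamma th + Rintegral Pi setT (fun y => sin (dotv th y) - dotv th y).
Proof.
congr (_ + _); apply: eq_levy_Rintegral => [||y ->//].
- apply: measurable_funB; first exact: measurable_sin_dotv.
  by apply: measurable_vnorm_le1; exact: measurable_dotv.
- by apply: measurable_funB; [exact: measurable_sin_dotv|exact: measurable_dotv].
Qed.

Lemma im_psi_le gamma th :
  `|im_psi gamma Pi th| <= vnorm gamma * vnorm th + vnorm th ^+ 2 * levy_m2.
Proof.
rewrite im_psiE (le_trans (ler_normD _ _))// lerD ?dotv_le//.
apply: levy_Rintegral_le => [|y]; last exact: norm_sin_dotv_le.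
by apply: measurable_funB; [exact: measurable_sin_dotv|exact: measurable_dotv].
Qed.

End levy_measure_facts.

Set Implicit Arguments. Unset Strict Implicit. Unset Printing Implicit Defensive.

Section second_moment.
Context {R : realType} {d : nat} {dT : measure_display} {T : measurableType dT}.
Context (P : probability T R) (X : R -> T -> d.-tuple R) (gamma : d.-tuple R).
Context (Pi : {measure set (d.-tuple R) -> \bar R}).
Hypothesis mX : forall s, measurable_fun setT (X s).
Hypothesis Xchar : char_triplet_nongauss P X gamma Pi.
Hypothesis Pi1 : Pi [set y | 1 < vnorm y] = 0%E.

Let PiL : levy_measure Pi := Xchar.1.

Lemma measurable_comp_X (g : d.-tuple R -> R) s :
  measurable_fun setT g -> measurable_fun setT (fun w => g (X s w)).
Proof. by move=> mg; exact: (measurableT_comp mg (mX s)). Qed.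

Lemma integrable_cos_X s th : P.-integrable setT (EFin \o (fun w => cos (dotv th (X s w)))).
Proof.
apply: (@integrable_bounded _ _ _ _ _ _ 1) => // [|x _]; last exact: cos_max.
exact: (measurable_comp_X _ (measurable_cos_dotv th)).
Qed.

Lemma Rintegral_cst1 (c : R) : Rintegral P setT (fun=> c) = c.
Proof. by rewrite Rintegral_cst// [X in fine X](_ : _ = 1%E) ?mulr1//; exact: probability_setT. Qed.

(** The real part of the exponent contributes order [s], the imaginary part only order [s^2]. After
    multiplication by [2 k^2] with [|th| = 1/k], both stay bounded as [k] grows, as Fatou's lemma
    requires. *)
Lemma mean_onem_cos_le s th : 0 < s ->
  Rintegral P setT (fun w => 1 - cos (dotv th (X s w))) <=
  s * (vnorm th ^+ 2 / 2 * levy_m2 Pi) +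
  s ^+ 2 * (vnorm gamma * vnorm th + vnorm th ^+ 2 * levy_m2 Pi) ^+ 2 / 2.
Proof.
move=> s0.
rewrite RintegralB//; first last.
- exact: integrable_cos_X.
- by apply: (@integrable_bounded _ _ _ _ _ _ 1) => // x _; rewrite normr1.
rewrite Rintegral_cst1 (Xchar.2 s (ltW s0) th).1.
have := re_psi_le0 Pi PiL Pi1 th; have := re_psi_le Pi PiL Pi1 th.
have := im_psi_le Pi PiL Pi1 gamma th.
set a := re_psi _ _; set b := im_psi _ _ _; set A := _ / 2 * levy_m2 Pi; set B := (vnorm gamma * _ + _) => hb ha a0.
have e1 : 1 - expR (s * a) <= s * A.
  have := expR_ge1Dx (s * a); move: ha; rewrite ler0_norm// => ha h.
  have : s * - a <= s * A by rewrite ler_pM2l.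
  lra.
have e2 : 1 - cos (s * b) <= s ^+ 2 * B ^+ 2 / 2.
  apply: le_trans (onem_cos_le _ _) _; rewrite ler_pM2r ?invr_gt0// exprMn ler_pM2l ?exprn_gt0//.
  rewrite -(real_normK (num_real b)) lerXn2r ?nnegrE//.
  by rewrite (le_trans _ hb).
have e0 : expR (s * a) <= 1 by rewrite expR_le1 pmulr_rle0.
have := cos_geN1 (s * b); have := cos_le1 (s * b); have := expR_ge0 (s * a).
move: e1 e2 e0; set p := expR _; set q := cos _; set u := s * A; set v := _ / 2 => *.
(* That is, [1 - p q <= (1 - p) + (1 - q)]. *)
have : 0 <= (1 - p) * (1 - q) by rewrite mulr_ge0 ?subr_ge0.
lra.
Qed.

Let scaled_cos i (s : R) (k : nat) (w : T) : R :=
  2 * k.+1%:R ^+ 2 * (1 - cos (dotv (vscale k.+1%:R^-1 (vunit i)) (X s w))).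

Let cvg_scaled_cos i s w : scaled_cos i s k w @[k --> \oo] --> tnth (X s w) i ^+ 2.
Proof.
have -> : scaled_cos i s ^~ w =
    (fun k : nat => (2 * k.+1%:R * sin (tnth (X s w) i / (2 * k.+1%:R))) ^+ 2).
  apply/funext => k; rewrite /scaled_cos dotv_scalel dotv_unit onem_cos.
  have -> : k.+1%:R^-1 * tnth (X s w) i / 2 = tnth (X s w) i / (2 * k.+1%:R).
    by field.
  by rewrite exprMn exprMn; ring.
set x := tnth _ _.
apply: (@cvg_comp _ _ _ (fun k : nat => 2 * k.+1%:R * sin (x / (2 * k.+1%:R))) (fun y => y ^+ 2) _ (nbhs x));
  last exact: exprn_continuous.
apply/cvgrPdistC_lt => e e0 /=; near=> k.
have k0 : 0 < 2 * k.+1%:R :> R by rewrite mulr_gt0.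
have -> : 2 * k.+1%:R * sin (x / (2 * k.+1%:R)) - x =
  2 * k.+1%:R * (sin (x / (2 * k.+1%:R)) - x / (2 * k.+1%:R)).
  by rewrite mulrBr mulrCA divff ?gt_eqF// mulr1.
rewrite normrM gtr0_norm//.
have : 2 * k.+1%:R * `|sin (x / (2 * k.+1%:R)) - x / (2 * k.+1%:R)| <=
   2 * k.+1%:R * (x / (2 * k.+1%:R)) ^+ 2.
  by rewrite ler_pM2l// norm_sin_sub_le.
move=> /le_lt_trans; apply.
have -> : 2 * k.+1%:R * (x / (2 * k.+1%:R)) ^+ 2 = (x ^+ 2 / 2) / k.+1%:R by field.
rewrite ltr_pdivrMr// -ltr_pdivrMl//.
by rewrite -[k.+1%:R]natr1 ltr_pwDr//; near: k; exact: nbhs_infty_ger.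
Unshelve. all: by end_near. Qed.

Let vnorm_scaled_unit i (k : nat) : vnorm (vscale k.+1%:R^-1 (vunit i) : d.-tuple R) = k.+1%:R^-1.
Proof.
rewrite -[RHS]ger0_norm ?invr_ge0// -sqrtr_sqr; congr Num.sqrt.
rewrite (bigD1 i)//= !tnth_mktuple eqxx mulr1 big1 ?addr0// => j ji.
by rewrite !tnth_mktuple eq_sym (negbTE ji) mulr0 expr0n.
Qed.

Definition moment_cst (t : R) := levy_m2 Pi + t * (vnorm gamma + levy_m2 Pi) ^+ 2.

(* Fatou's lemma along [2(1 - cos(x/k)) k^2 --> x^2]: the characteristic
   function alone bounds the second moments. *)
Lemma coord_second_moment i s : 0 < s ->
  (\int[P]_w (tnth (X s w) i ^+ 2)%:E <= (s * moment_cst s)%:E)%E.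
Proof.
move=> s0.
have ms k : measurable_fun setT (scaled_cos i s k).
  apply: measurable_funM; first exact: measurable_cst.
  apply: measurable_funB; first exact: measurable_cst.
  exact: (measurable_comp_X _ (measurable_cos_dotv _)).
have s_ge0 k w : 0 <= scaled_cos i s k w.
  by rewrite mulr_ge0 ?mulr_ge0 ?sqr_ge0// subr_ge0 cos_le1.
have bound k : (\int[P]_w (scaled_cos i s k w)%:E <= (s * moment_cst s)%:E)%E.
  have ib : P.-integrable setT (EFin \o (fun w => 1 - cos (dotv (vscale k.+1%:R^-1 (vunit i)) (X s w)))).
    apply: (@integrable_bounded _ _ _ _ _ _ 2) => // [|x _].
      apply: measurable_funB; first exact: measurable_cst.
      exact: (measurable_comp_X _ (measurable_cos_dotv _)).
    by rewrite ger0_norm ?subr_ge0 ?cos_le1//; have := cos_geN1 (dotv (vscale k.+1%:R^-1 (vunit i)) (X s x)); lra.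
  have ib2 := integrableZl measurableT (2 * k.+1%:R ^+ 2) ib.
  rewrite -[leLHS]fineK; last exact: (integrable_fin_num measurableT ib2).
  rewrite lee_fin -/(Rintegral P setT _) RintegralZl//.
  apply: (le_trans (ler_wpM2l _ (mean_onem_cos_le _ s0))); first by rewrite mulr_ge0// sqr_ge0.
  rewrite vnorm_scaled_unit /moment_cst.
  set m2 := levy_m2 Pi; set g := vnorm gamma; set K := k.+1%:R.
  have K1 : 1 <= K by rewrite /K ler1n.
  have K0 : 0 < K by lra.
  have -> : 2 * K ^+ 2 * (s * (K^-1 ^+ 2 / 2 * m2) + s ^+ 2 * (g / K + K^-1 ^+ 2 * m2) ^+ 2 / 2) =
    s * (m2 + s * (g + K^-1 * m2) ^+ 2) by field; rewrite gt_eqF.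
  have m20 : 0 <= m2 by exact: levy_m2_ge0.
  have g0 : 0 <= g by exact: vnorm_ge0.
  have Km : K^-1 * m2 <= m2 by rewrite ler_piMl// invf_le1.
  have Km0 : 0 <= K^-1 * m2 by rewrite mulr_ge0// invr_ge0 ltW.
  rewrite ler_pM2l// lerD2l ler_pM2l// lerXn2r ?nnegrE ?addr_ge0// lerD2l//.
have := @fatou _ _ _ P setT measurableT (fun k w => (scaled_cos i s k w)%:E).
move=> /(_ (fun k => (measurable_EFinP _ _).2 (ms k)) (fun k w _ => (s_ge0 k w : (0 <= (scaled_cos i s k w)%:E)%E))) H.
have -> : (\int[P]_w (tnth (X s w) i ^+ 2)%:E = \int[P]_w limn_einf (fun k => (scaled_cos i s k w)%:E))%E.
  apply: eq_integral => w _; symmetry.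
  have c : ((scaled_cos i s k w)%:E @[k --> \oo] --> (tnth (X s w) i ^+ 2)%:E)%E.
    by apply: cvg_EFin; [exact: nearW|exact: cvg_scaled_cos].
  have [e _] := cvg_limn_einf_sup c; exact: e.
apply: (le_trans H); rewrite limn_einf_lim; apply: lime_le; first exact: is_cvg_einfs.
apply: nearW => k; apply: le_trans (bound k); apply: ereal_inf_lbound; exists k => //=.
Qed.
End second_moment.

(** * Small-time asymptotics of means *)

Section quadratic_functions.
Context {R : realType} {d : nat} {dT : measure_display} {T : measurableType dT}.
Context (P : probability T R) (X : R -> T -> d.-tuple R) (gamma : d.-tuple R).
Context (Pi : {measure set (d.-tuple R) -> \bar R}).
Hypothesis mX : forall s, measurable_fun setT (X s).
Hypothesis Xchar : char_triplet_nongauss P X gamma Pi.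
Hypothesis Pi1 : Pi [set y | 1 < vnorm y] = 0%E.

Let PiL : levy_measure Pi := Xchar.1.
Implicit Types (h q : d.-tuple R -> R) (th y z : d.-tuple R).

Lemma sqnorm_second_moment s : 0 < s ->
  P.-integrable setT (EFin \o (fun w => vnorm (X s w) ^+ 2)) /\
  Rintegral P setT (fun w => vnorm (X s w) ^+ 2) <= d%:R * (s * moment_cst gamma Pi s).
Proof.
move=> s0.
have mc i : measurable_fun setT (fun w => tnth (X s w) i ^+ 2).
  by apply: measurable_funX; exact: (measurableT_comp (measurable_tnth i) (mX s)).
have E : (\int[P]_w (vnorm (X s w) ^+ 2)%:E <= (d%:R * (s * moment_cst gamma Pi s))%:E)%E.
  under eq_integral do rewrite sqr_vnorm -sumEFin.
  rewrite ge0_integral_sum//; first last.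
  - by move=> i w _; rewrite lee_fin sqr_ge0.
  - by move=> i; exact/measurable_EFinP.
  apply: (@le_trans _ _ (\sum_(i < d) (s * moment_cst gamma Pi s)%:E)%E).
    by apply: lee_sum => i _; exact: coord_second_moment.
  by rewrite sumEFin sumr_const card_ord mulr_natl.
have I : P.-integrable setT (EFin \o (fun w => vnorm (X s w) ^+ 2)).
  apply/integrableP; split.
    apply/measurable_EFinP; apply: measurable_funX.
    exact: (measurableT_comp measurable_vnorm (mX s)).
  under eq_integral do rewrite /= ger0_norm ?sqr_ge0//.
  by rewrite (le_lt_trans E)// ltry.
split => //; rewrite -lee_fin fineK//; exact: (integrable_fin_num measurableT I).
Qed.

Lemma quadratic_mean h C s : 0 < s -> measurable_fun setT h ->
  (forall y, `|h y| <= C * vnorm y ^+ 2) ->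
  P.-integrable setT (EFin \o (fun w => h (X s w))) /\
  `|Rintegral P setT (fun w => h (X s w))| <= `|C| * (d%:R * (s * moment_cst gamma Pi s)).
Proof.
move=> s0 mh hC; have [I E] := sqnorm_second_moment s0.
have I2 : P.-integrable setT (EFin \o (fun w => `|C| * vnorm (X s w) ^+ 2)).
  exact: (@integrableZl _ _ _ _ _ measurableT `|C| (EFin \o _)).
have hC' y : `|h y| <= `|C| * vnorm y ^+ 2.
  by rewrite (le_trans (hC y))// ler_wpM2r ?sqr_ge0// ler_norm.
have Ih : P.-integrable setT (EFin \o (fun w => h (X s w))).
  apply: (le_integrable measurableT _ _ I2).
    by apply/measurable_EFinP; exact: (measurableT_comp mh (mX s)).
  by move=> w _; rewrite lee_fin (le_trans (hC' _))// ler_norm.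
split => //; apply: (le_trans (le_normr_Rintegral measurableT Ih)).
apply: (@le_trans _ _ (Rintegral P setT (fun w => `|C| * vnorm (X s w) ^+ 2))).
  apply: le_Rintegral => //; exact: (@integrable_norm _ _ _ _ setT (fun w => h (X s w)) Ih).
by rewrite RintegralZl// ler_wpM2l.
Qed.

Variables (t : R) (t0 : 0 < t).

(** The mean of the sum of [h] over the [n.+1] grid increments of [X] on [0, t]; the successor
    avoids an empty grid. *)
Definition small_mean h n := n.+1%:R * Rintegral P setT (fun w => h (X (t / n.+1%:R) w)).

Lemma time_step_gt0 n : 0 < t / n.+1%:R. Proof. by rewrite divr_gt0. Qed.

Let K := d%:R * (t * (levy_m2 Pi + t * (vnorm gamma + levy_m2 Pi) ^+ 2)).

Lemma small_mean_le h C n : measurable_fun setT h ->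
  (forall y, `|h y| <= C * vnorm y ^+ 2) -> `|small_mean h n| <= `|C| * K.
Proof.
move=> mh hC; have [_ H] := quadratic_mean (time_step_gt0 n) mh hC.
rewrite normrM ger0_norm//; apply: (le_trans (ler_wpM2l _ H)) => //.
rewrite mulrCA; apply: ler_wpM2l => //; rewrite mulrCA; apply: ler_wpM2l => //.
rewrite mulrA (mulrC n.+1%:R) divfK// ler_pM2l// /moment_cst lerD2l ler_wpM2r ?sqr_ge0//.
by rewrite ler_pdivrMr// ler_peMr ?(ltW t0)// ler1n.
Qed.

(* Errors proportional to [|y|^2] are harmless because [n E|X_(t/n)|^2] is bounded. *)
Lemma cvg_small_mean_approx h C : measurable_fun setT h ->
  (forall y, `|h y| <= C * vnorm y ^+ 2) ->
  (forall e, 0 < e -> exists q, [/\ measurable_fun setT q,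
     exists C', forall y, `|q y| <= C' * vnorm y ^+ 2,
     small_mean q n @[n --> \oo] --> t * Rintegral Pi setT q &
     forall y, `|h y - q y| <= e * vnorm y ^+ 2]) ->
  small_mean h n @[n --> \oo] --> t * Rintegral Pi setT h.
Proof.
move=> mh hC happ; apply/cvgrPdist_lt => e e0.
have K0 : 0 <= K.
  apply: mulr_ge0 => //; apply: mulr_ge0; first exact: ltW.
  by apply: addr_ge0; [exact: levy_m2_ge0|apply: mulr_ge0; [exact: ltW|exact: sqr_ge0]].
have m0 : 0 <= levy_m2 Pi by exact: levy_m2_ge0.
pose c := e / (2 * (K + t * levy_m2 Pi + 1)).
have c1 : 0 < K + t * levy_m2 Pi + 1.
  by apply: ltr_wpDl => //; apply: addr_ge0 => //; apply: mulr_ge0 => //; exact: ltW.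
have c0 : 0 < c by rewrite divr_gt0// mulr_gt0.
have ce : c * K + c * (t * levy_m2 Pi) < e / 2.
  have -> : c * K + c * (t * levy_m2 Pi) = e / 2 * ((K + t * levy_m2 Pi) / (K + t * levy_m2 Pi + 1)).
    by rewrite /c; field; rewrite gt_eqF.
  by rewrite gtr_pMr ?divr_gt0// ltr_pdivrMr// mul1r ltrDl.
have [q [mq [C' qC] cq hq]] := happ c c0.
have mhq : measurable_fun setT (fun y => h y - q y) by exact: measurable_funB.
have Iq := @levy_integrable _ _ Pi PiL Pi1 q C' mq (fun y _ => qC y).
have Ih := @levy_integrable _ _ Pi PiL Pi1 h C mh (fun y _ => hC y).
have d1 := levy_Rintegral_le Pi PiL Pi1 _ _ mhq hq.
rewrite RintegralB// in d1.
near=> n.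
have [Iqn _] := quadratic_mean (time_step_gt0 n) mq qC.
have [Ihn _] := quadratic_mean (time_step_gt0 n) mh hC.
have d2 := small_mean_le n mhq hq.
rewrite (gtr0_norm c0) /small_mean RintegralB// mulrBr -/(small_mean h n) -/(small_mean q n) in d2.
have d3 : `|t * Rintegral Pi setT q - small_mean q n| < e / 2.
  by near: n; move/cvgrPdist_lt: cq; apply; rewrite divr_gt0.
have d4 : t * `|Rintegral Pi setT h - Rintegral Pi setT q| <= c * (t * levy_m2 Pi).
  by rewrite mulrCA ler_pM2l.
have -> : t * Rintegral Pi setT h - small_mean h n =
  t * (Rintegral Pi setT h - Rintegral Pi setT q) + (t * Rintegral Pi setT q - small_mean q n) -
  (small_mean h n - small_mean q n) by ring.
apply: (le_lt_trans (ler_normB _ _)).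
apply: (le_lt_trans (lerD (ler_normD _ _) (lexx _))).
rewrite normrM (gtr0_norm t0).
lra.
Unshelve. all: by end_near. Qed.

End quadratic_functions.

(** * Trigonometric polynomials and their small-time limits *)

Section trigonometric_polynomials.
Context {R : realType} {d : nat}.
Implicit Types (f g : d.-tuple R -> R) (th y z : d.-tuple R).

(** Linear statements about the characteristic function pass to this class by induction, while the
    product-to-sum formulas make it an algebra; polynomials in sines of the coordinates therefore
    belong to it. *)
Inductive trigpoly : (d.-tuple R -> R) -> Prop :=
| trig_cos th : trigpoly (fun y => cos (dotv th y))
| trig_sin th : trigpoly (fun y => sin (dotv th y))
| trig_lin (a : R) f g : trigpoly f -> trigpoly g -> trigpoly (fun y => a * f y + g y).

Lemma trig_zero : trigpoly (fun=> 0).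
Proof.
rewrite (_ : (fun=> 0) = (fun y => sin (dotv vzero y))); first exact: trig_sin.
by apply/funext => y; rewrite dotv0l sin0.
Qed.

Lemma trig_cst (a : R) : trigpoly (fun=> a).
Proof.
rewrite (_ : (fun=> a) = (fun y => a * cos (dotv vzero y) + 0)).
  by apply: trig_lin; [exact: trig_cos|exact: trig_zero].
by apply/funext => y; rewrite dotv0l cos0 mulr1 addr0.
Qed.

Lemma trig_scale (a : R) f : trigpoly f -> trigpoly (fun y => a * f y).
Proof.
move=> tf; rewrite (_ : (fun y => _) = (fun y => a * f y + 0)).
  by apply: trig_lin => //; exact: trig_zero.
by apply/funext => y; rewrite addr0.
Qed.

Lemma trig_add f g : trigpoly f -> trigpoly g -> trigpoly (fun y => f y + g y).
Proof.
move=> tf tg; rewrite (_ : (fun y => _) = (fun y => 1 * f y + g y)).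
  exact: trig_lin.
by apply/funext => y; rewrite mul1r.
Qed.

Lemma trig_mul f g : trigpoly f -> trigpoly g -> trigpoly (fun y => f y * g y).
Proof.
move=> tf; elim: tf g => [th|th|a f1 f2 _ IH1 _ IH2] g tg.
- elim: tg => [et|et|a g1 g2 _ IH1 _ IH2].
  + rewrite (_ : (fun y => _) = (fun y => 2^-1 * cos (dotv (vadd th et) y) +
      (2^-1 * cos (dotv (vsub th et) y)))).
      by apply: trig_lin; [|apply: trig_scale]; exact: trig_cos.
    by apply/funext => y; rewrite dotv_addl dotv_subl cosD cosB; field.
  + rewrite (_ : (fun y => _) = (fun y => 2^-1 * sin (dotv (vadd th et) y) +
      (- 2^-1 * sin (dotv (vsub th et) y)))).
      by apply: trig_lin; [|apply: trig_scale]; exact: trig_sin.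
    by apply/funext => y; rewrite dotv_addl dotv_subl sinD sinB; field.
  + rewrite (_ : (fun y => _) = (fun y => a * (cos (dotv th y) * g1 y) + cos (dotv th y) * g2 y)).
      exact: trig_lin.
    by apply/funext => y; ring.
- elim: tg => [et|et|a g1 g2 _ IH1 _ IH2].
  + rewrite (_ : (fun y => _) = (fun y => 2^-1 * sin (dotv (vadd th et) y) +
      (2^-1 * sin (dotv (vsub th et) y)))).
      by apply: trig_lin; [|apply: trig_scale]; exact: trig_sin.
    by apply/funext => y; rewrite dotv_addl dotv_subl sinD sinB; field.
  + rewrite (_ : (fun y => _) = (fun y => 2^-1 * cos (dotv (vsub th et) y) +
      (- 2^-1 * cos (dotv (vadd th et) y)))).
      by apply: trig_lin; [|apply: trig_scale]; exact: trig_cos.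
    by apply/funext => y; rewrite dotv_addl dotv_subl cosB cosD; field.
  + rewrite (_ : (fun y => _) = (fun y => a * (sin (dotv th y) * g1 y) + sin (dotv th y) * g2 y)).
      exact: trig_lin.
    by apply/funext => y; ring.
- rewrite (_ : (fun y => _) = (fun y => a * (f1 y * g y) + f2 y * g y)).
    by apply: trig_lin; [exact: IH1|exact: IH2].
  by apply/funext => y; ring.
Qed.

Lemma trig_exp f n : trigpoly f -> trigpoly (fun y => f y ^+ n).
Proof.
move=> tf; elim: n => [|n IH]; first exact: trig_cst.
rewrite (_ : (fun y => _) = (fun y => f y * f y ^+ n)); first exact: trig_mul.
by apply/funext => y; rewrite exprS.
Qed.

Lemma trig_sum (I : Type) (r : seq I) (F : I -> d.-tuple R -> R) :
  (forall i, trigpoly (F i)) -> trigpoly (fun y => \sum_(i <- r) F i y).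
Proof.
move=> tF; elim: r => [|i r IH].
  rewrite (_ : (fun y => _) = fun=> 0); first exact: trig_zero.
  by apply/funext => y; rewrite big_nil.
rewrite (_ : (fun y => _) = (fun y => F i y + \sum_(j <- r) F j y)); first exact: trig_add.
by apply/funext => y; rewrite big_cons.
Qed.

Lemma trig_horner (p : {poly R}) f : trigpoly f -> trigpoly (fun y => p.[f y]).
Proof.
move=> tf; rewrite (_ : (fun y => _) = (fun y => \sum_(i < size p) p`_i * f y ^+ i)).
  by apply: trig_sum => i; apply: trig_scale; exact: trig_exp.
by apply/funext => y; rewrite horner_coef.
Qed.

Lemma measurable_trig f : trigpoly f -> measurable_fun setT f.
Proof.
elim=> [th|th|a f1 f2 _ IH1 _ IH2].
- exact: measurable_cos_dotv.
- exact: measurable_sin_dotv.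
- by apply: measurable_funD => //; apply: measurable_funM => //.
Qed.

Lemma trig_bounded f : trigpoly f -> exists M, forall y, `|f y| <= M.
Proof.
elim=> [th|th|a f1 f2 _ [M1 H1] _ [M2 H2]].
- by exists 1 => y; exact: cos_max.
- by exists 1 => y; exact: sin_max.
- exists (`|a| * M1 + M2) => y; rewrite (le_trans (ler_normD _ _))// lerD//.
  by rewrite normrM ler_wpM2l.
Qed.

End trigonometric_polynomials.

Lemma cvg_time_step (R : realType) (t : R) : t / n.+1%:R @[n --> \oo] --> 0.
Proof.
rewrite -[X in _ --> X](mulr0 t); apply: cvgM; first exact: cvg_cst.
exact: cvg_harmonic.
Qed.

Lemma cvg_diff_quotient (R : realType) (t : R) (f : R -> R) (df : R) : 0 < t ->
  is_derive (0 : R) (1 : R) f df ->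
  n.+1%:R * (f (t / n.+1%:R) - f 0) @[n --> \oo] --> t * df.
Proof.
move=> t0 [fd fE].
have /cvgr_dnbhsP H : (fun h : R => h^-1 *: ((f \o shift 0) (h *: 1) - f 0)) h @[h --> 0^'] --> df.
  by rewrite -fE.
have {}H := H (fun n => t / n.+1%:R) (conj (fun n => _) (cvg_time_step t)).
have -> : (fun n : nat => n.+1%:R * (f (t / n.+1%:R) - f 0)) =
  (fun n : nat => t * ((t / n.+1%:R)^-1 *: ((f \o shift 0) ((t / n.+1%:R) *: 1) - f 0))).
  apply/funext => n /=; rewrite /GRing.scale/= mulr1 addr0.
  by set Z := _ - f 0; field; rewrite ?gt_eqF ?pnatr_eq0.
apply: cvgM; first exact: cvg_cst.
by apply: H => n; rewrite mulf_neq0 ?gt_eqF ?invr_gt0.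
Qed.

Section cvg_trig.
Context {R : realType} {d : nat} {dT : measure_display} {T : measurableType dT}.
Context (P : probability T R) (X : R -> T -> d.-tuple R) (gamma : d.-tuple R).
Context (Pi : {measure set (d.-tuple R) -> \bar R}).
Hypothesis mX : forall s, measurable_fun setT (X s).
Hypothesis Xchar : char_triplet_nongauss P X gamma Pi.
Hypothesis Pi1 : Pi [set y | 1 < vnorm y] = 0%E.
Variables (t : R) (t0 : 0 < t).

Let PiL : levy_measure Pi := Xchar.1.
Implicit Types (h q f : d.-tuple R -> R) (th y z : d.-tuple R).

Lemma cvg_trig_cos th :
  n.+1%:R * (Rintegral P setT (fun w => cos (dotv th (X (t / n.+1%:R) w))) - 1) @[n --> \oo]
    --> t * re_psi Pi th.
Proof.
have D : is_derive (0 : R) (1 : R)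
   (fun s => expR (s * re_psi Pi th) * cos (s * im_psi gamma Pi th)) (re_psi Pi th).
  apply: is_derive_eq; rewrite /GRing.scale/= !(mul0r, expR0, cos0, sin0, mulr0, mul1r, mulr1).
  by rewrite ?(oppr0, mulr0, add0r, addr0, mul1r, mulr1, mul0r).
have := cvg_diff_quotient t0 D.
rewrite !mul0r expR0 cos0 mul1r.
rewrite (_ : (fun n : nat => _) = (fun n : nat => n.+1%:R *
   (Rintegral P setT (fun w => cos (dotv th (X (t / n.+1%:R) w))) - 1)))//.
apply/funext => n; have [|-> _ //] := Xchar.2 (t / n.+1%:R) _ th.
by rewrite divr_ge0// ltW.
Qed.

Lemma cvg_trig_sin th :
  n.+1%:R * Rintegral P setT (fun w => sin (dotv th (X (t / n.+1%:R) w))) @[n --> \oo]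
    --> t * im_psi gamma Pi th.
Proof.
have D : is_derive (0 : R) (1 : R)
   (fun s => expR (s * re_psi Pi th) * sin (s * im_psi gamma Pi th)) (im_psi gamma Pi th).
  apply: is_derive_eq; rewrite /GRing.scale/= !(mul0r, expR0, cos0, sin0, mulr0, mul1r, mulr1).
  by rewrite ?(oppr0, mulr0, add0r, addr0, mul1r, mulr1).
have := cvg_diff_quotient t0 D.
rewrite !mul0r expR0 sin0 mul1r.
rewrite (_ : (fun n : nat => _) = (fun n : nat => n.+1%:R *
   Rintegral P setT (fun w => sin (dotv th (X (t / n.+1%:R) w)))))//.
apply/funext => n; have [|_ -> ] := Xchar.2 (t / n.+1%:R) _ th; last by rewrite subr0.
by rewrite divr_ge0// ltW.
Qed.

(** The limit is [t] times the generator of [X] applied to [f] at the origin, with [v] the gradient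
    of [f] there. A single sine or cosine need not be [O(|y|^2)], so the induction has to carry the
    value and the gradient at 0. *)
Lemma cvg_trig f : trigpoly f -> exists v C,
  (forall y, `|f y - f vzero - dotv v y| <= C * vnorm y ^+ 2) /\
  n.+1%:R * (Rintegral P setT (fun w => f (X (t / n.+1%:R) w)) - f vzero) @[n --> \oo]
    --> t * (Rintegral Pi setT (fun y => f y - f vzero - dotv v y) + dotv gamma v).
Proof.
elim=> [th|th|a f1 f2 tf1 [v1 [C1 [b1 c1]]] tf2 [v2 [C2 [b2 c2]]]].
- exists vzero, (vnorm th ^+ 2 / 2); split.
    move=> y; rewrite dotv0l (dotvC th vzero) dotv0l cos0 subr0; exact: norm_cos_dotv_le.
  rewrite (dotvC th vzero) (dotvC gamma) !dotv0l cos0 addr0.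
  rewrite (_ : (fun y => _) = (fun y => cos (dotv th y) - 1)); first exact: cvg_trig_cos.
  by apply/funext => y; rewrite dotv0l subr0.
- exists th, (vnorm th ^+ 2); split.
    move=> y; rewrite (dotvC th vzero) dotv0l sin0 subr0; exact: norm_sin_dotv_le.
  rewrite (dotvC th vzero) dotv0l sin0.
  rewrite (_ : (fun y => _) = (fun y => sin (dotv th y) - dotv th y)); last first.
    by apply/funext => y; rewrite subr0.
  rewrite addrC -(im_psiE Pi Pi1).
  rewrite (_ : (fun n : nat => _) = (fun n : nat => n.+1%:R *
     Rintegral P setT (fun w => sin (dotv th (X (t / n.+1%:R) w))))); first exact: cvg_trig_sin.
  by apply/funext => n; rewrite subr0.
- exists (vadd (vscale a v1) v2), (`|a| * C1 + C2).
  have e y : a * f1 y + f2 y - (a * f1 vzero + f2 vzero) - dotv (vadd (vscale a v1) v2) y =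
     a * (f1 y - f1 vzero - dotv v1 y) + (f2 y - f2 vzero - dotv v2 y).
    by rewrite dotv_addl dotv_scalel; ring.
  have mr g v : trigpoly g -> measurable_fun setT (fun y => g y - g vzero - dotv v y).
    move=> tf; apply: measurable_funB; last exact: measurable_dotv.
    by apply: measurable_funB; [exact: measurable_trig|exact: measurable_cst].
  have ig g C v : trigpoly g -> (forall y, `|g y - g vzero - dotv v y| <= C * vnorm y ^+ 2) ->
      Pi.-integrable setT (EFin \o (fun y => g y - g vzero - dotv v y)).
    by move=> tf fC; apply: (levy_integrable Pi PiL Pi1 _ C) => // ; exact: mr.
  split.
    move=> y; rewrite e (le_trans (ler_normD _ _))// mulrDl lerD// normrM -mulrA ler_wpM2l//.
  rewrite (_ : (fun y => _) = (fun y =>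
     a * (f1 y - f1 vzero - dotv v1 y) + (f2 y - f2 vzero - dotv v2 y))); last first.
    by apply/funext => y; exact: e.
  rewrite RintegralD//; [|exact: (@integrableZl _ _ _ _ _ measurableT a _ (ig _ _ _ tf1 b1))|exact: ig b2].
  rewrite RintegralZl//; last exact: ig b1.
  rewrite dotvC dotv_addl dotv_scalel !(dotvC _ gamma).
  rewrite (_ : t * _ = a * (t * (Rintegral Pi setT (fun y => f1 y - f1 vzero - dotv v1 y) + dotv gamma v1)) +
    t * (Rintegral Pi setT (fun y => f2 y - f2 vzero - dotv v2 y) + dotv gamma v2)); last by ring.
  have iP g s : trigpoly g -> P.-integrable setT (EFin \o (fun w => g (X s w))).
    move=> tf; have [M fM] := trig_bounded tf.
    apply: (@integrable_bounded _ _ _ _ _ _ M) => //.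
    exact: (measurableT_comp (measurable_trig tf) (mX s)).
  rewrite (_ : (fun n : nat => _) = (fun n : nat =>
    a * (n.+1%:R * (Rintegral P setT (fun w => f1 (X (t / n.+1%:R) w)) - f1 vzero)) +
    n.+1%:R * (Rintegral P setT (fun w => f2 (X (t / n.+1%:R) w)) - f2 vzero))); last first.
    apply/funext => n; rewrite RintegralD//.
    - by rewrite RintegralZl//; [ring|exact: iP].
    - exact: (@integrableZl _ _ _ _ _ measurableT a _ (iP _ _ tf1)).
    - exact: iP.
  by apply: cvgD => //; apply: cvgM => //; exact: cvg_cst.
Qed.

Lemma cvg_trig_quadratic f C : trigpoly f -> (forall y, `|f y| <= C * vnorm y ^+ 2) ->
  small_mean P X t f n @[n --> \oo] --> t * Rintegral Pi setT f.
Proof.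
move=> tf fC; have [v [D [fD]]] := cvg_trig tf.
have f0 : f vzero = 0.
  by apply/eqP; rewrite -normr_le0 (le_trans (fC _))// vnorm0 expr0n mulr0.
(* A linear form that is [O(|y|^2)] vanishes: test it at [v / B] with [B > |C| + |D|]. Thus [gamma]
   leaves the limit. *)
have v0 : v = vzero.
  apply: vnorm_eq0; apply/eqP; apply: contraT => vn.
  have vp : 0 < vnorm v by rewrite lt_neqAle eq_sym vn vnorm_ge0.
  pose B := `|C| + `|D| + 1.
  have B0 : 0 < B by rewrite /B ltr_wpDl// addr_ge0.
  have H y : `|dotv v y| <= (`|C| + `|D|) * vnorm y ^+ 2.
    have := fD y; have := fC y; rewrite f0 subr0 => h1 h2.
    have -> : dotv v y = f y - (f y - dotv v y) by ring.
    rewrite (le_trans (ler_normB _ _))// mulrDl lerD//.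
      by rewrite (le_trans h1)// ler_wpM2r ?sqr_ge0// ler_norm.
    by rewrite (le_trans h2)// ler_wpM2r ?sqr_ge0// ler_norm.
  have := H (vscale B^-1 v).
  have e1 : dotv v (vscale B^-1 v) = B^-1 * vnorm v ^+ 2 by rewrite dotvC dotv_scalel dotvv.
  have e2 : vnorm (vscale B^-1 v) ^+ 2 = B^-1 * (B^-1 * vnorm v ^+ 2).
    by rewrite -dotvv dotv_scalel e1.
  rewrite e1 e2 ger0_norm; last by rewrite mulr_ge0 ?sqr_ge0// invr_ge0 ltW.
  rewrite [leRHS]mulrCA ler_pM2l ?invr_gt0// mulrA ler_pMl ?exprn_gt0//.
  by rewrite ler_pdivlMr// mul1r /B gerDl ler10.
rewrite v0 (dotvC gamma) dotv0l addr0.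
rewrite (_ : (fun y => _) = f); last by apply/funext => y; rewrite f0 dotv0l !subr0.
rewrite (_ : (fun n : nat => _) = small_mean P X t f)//.
by apply/funext => n; rewrite f0 subr0.
Qed.

End cvg_trig.

(** * Bounded Lipschitz profiles of one variable *)

Section lipschitz_bounded.
Context {R : realType}.
Implicit Types f g : R -> R.

(** Boundedness is included because it makes the class closed under products. *)
Definition lipb f := exists L, [/\ 0 < L, forall x y, `|f x - f y| <= L * `|x - y|
  & forall x, `|f x| <= L].

Lemma lipb_mul f g : lipb f -> lipb g -> lipb (fun x => f x * g x).
Proof.
move=> [L [L0 Lf Bf]] [M [M0 Mg Bg]]; exists (2 * L * M + L * M).
have LM : 0 < L * M by rewrite mulr_gt0.
split=> [|x y|x]; first by nra.
  have -> : f x * g x - f y * g y = f x * (g x - g y) + (f x - f y) * g y by ring.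
  rewrite (le_trans (ler_normD _ _))// !normrM.
  have h1 : `|f x| * `|g x - g y| <= L * (M * `|x - y|) by exact: ler_pM.
  have h2 : `|f x - f y| * `|g y| <= L * `|x - y| * M by exact: ler_pM.
  have := normr_ge0 (x - y); move: h1 h2; set u := `|x - y| => h1 h2 u0.
  have : 0 <= L * M * u by rewrite mulr_ge0// ltW.
  lra.
rewrite normrM; have : `|f x| * `|g x| <= L * M by exact: ler_pM.
lra.
Qed.

Lemma lipb_exp f n : lipb f -> lipb (fun x => f x ^+ n.+1).
Proof.
move=> lf; elim: n => [|n IH].
  by rewrite (_ : (fun x => _) = f)//; apply/funext => x; rewrite expr1.
rewrite (_ : (fun x => _) = (fun x => f x * f x ^+ n.+1)); first exact: lipb_mul.
by apply/funext => x; rewrite exprS.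
Qed.

Definition clip (a b x : R) := Num.min (Num.max x a) b.

Lemma clip_lip a b x y : `|clip a b x - clip a b y| <= `|x - y|.
Proof.
wlog xy : x y / x <= y.
  move=> H; have [xy|/ltW xy] := leP x y; first exact: H.
  by rewrite distrC (distrC x); exact: H.
rewrite !(distrC x) !(distrC (clip a b x)) (ger0_norm (x := y - x)) ?subr_ge0// /clip.
have [h1|h1] := leP x a; have [h2|h2] := leP y a; rewrite /Num.min;
  repeat case: ifP => ?; rewrite ler_norml; apply/andP; split; lra.
Qed.

Lemma clip_bounds a b x : a <= b -> a <= clip a b x <= b.
Proof.
by move=> ab; rewrite /clip ge_min lexx orbT andbT le_min ab andbT le_max lexx orbT.
Qed.

Lemma clip_id a b x : a <= x <= b -> clip a b x = x.
Proof. by move=> /andP[ax xb]; rewrite /clip max_l// min_l. Qed.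

Lemma lipb_clip a b : 0 <= a <= b -> lipb (clip a b).
Proof.
move=> /andP[a0 ab]; exists (b + 1); split=> [|x y|x]; first by lra.
  rewrite (le_trans (clip_lip _ _ _ _))// ler_peMl//; lra.
by have /andP[c1 c2] := clip_bounds x ab; rewrite ger0_norm; lra.
Qed.

Lemma lipb_clip_inv a b : 0 < a <= b -> lipb (fun x => (clip a b x)^-1).
Proof.
move=> /andP[a0 ab]; exists ((a^-1 + 1) ^+ 2); split=> [|x y|x].
- by rewrite exprn_gt0// addr_gt0// invr_gt0.
- have /andP[c1 _] := clip_bounds x ab; have /andP[c2 _] := clip_bounds y ab.
  have x0 : 0 < clip a b x by exact: lt_le_trans c1.
  have y0 : 0 < clip a b y by exact: lt_le_trans c2.
  have -> : (clip a b x)^-1 - (clip a b y)^-1 =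
     (clip a b y - clip a b x) * ((clip a b x)^-1 * (clip a b y)^-1).
    by field; rewrite !gt_eqF.
  rewrite normrM mulrC distrC ler_pM ?clip_lip//.
  rewrite ger0_norm ?mulr_ge0 ?invr_ge0 ?(ltW x0) ?(ltW y0)// expr2 ler_pM ?invr_ge0 ?(ltW x0) ?(ltW y0)//.
    by rewrite (@le_trans _ _ a^-1) ?lef_pV2// lerDl.
  by rewrite (@le_trans _ _ a^-1) ?lef_pV2// lerDl.
- have /andP[c1 _] := clip_bounds x ab.
  have x0 : 0 < clip a b x by exact: lt_le_trans c1.
  have i0 : 0 < a^-1 by rewrite invr_gt0.
  rewrite ger0_norm ?invr_ge0 ?(ltW x0)// (@le_trans _ _ a^-1) ?lef_pV2//.
  nra.
Qed.

Lemma lipb_clip_sqrt a b : 0 < a <= b -> lipb (fun x => Num.sqrt (clip a b x)).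
Proof.
move=> /andP[a0 ab]; pose s := Num.sqrt a.
have s0 : 0 < s by rewrite sqrtr_gt0.
have b0 : 0 < b by exact: lt_le_trans ab.
have lo x : s <= Num.sqrt (clip a b x).
  by apply: ler_wsqrtr; have /andP[] := clip_bounds x ab.
exists (s^-1 + Num.sqrt b); split=> [|x y|x].
- by rewrite addr_gt0 ?invr_gt0// sqrtr_gt0.
- have /andP[c1 _] := clip_bounds x ab; have /andP[c2 _] := clip_bounds y ab.
  have x0 : 0 <= clip a b x by lra.
  have y0 : 0 <= clip a b y by lra.
  apply: (@le_trans _ _ (s^-1 * `|x - y|)); last first.
    by rewrite ler_wpM2r// lerDl sqrtr_ge0.
  rewrite ler_pdivlMl//; apply: le_trans (clip_lip a b _ _).
  rewrite -{2}(sqr_sqrtr x0) -{2}(sqr_sqrtr y0) subr_sqr normrM mulrC ler_wpM2l//.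
  by rewrite ger0_norm ?addr_ge0 ?sqrtr_ge0// (le_trans (lo x))// lerDl sqrtr_ge0.
- rewrite ger0_norm ?sqrtr_ge0// (@le_trans _ _ (Num.sqrt b))//.
    by apply: ler_wsqrtr; have /andP[] := clip_bounds x ab.
  by rewrite lerDr invr_ge0 ltW.
Qed.

Lemma lipb_measurable f : lipb f -> measurable_fun setT f.
Proof.
move=> [L [L0 fL _]]; apply: continuous_measurable_fun => x.
apply/cvgrPdist_lt => e e0; near=> y.
apply: (le_lt_trans (fL _ _)); rewrite -ltr_pdivlMl//.
near: y; apply: (@cvgr_dist_lt _ _ _ _ _ (fun y : R => y) x) => //.
by rewrite mulr_gt0// invr_gt0.
Unshelve. all: by end_near. Qed.

End lipschitz_bounded.

(** * Approximation of quadratic functions by trigonometric polynomials *)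

Section sine_folding.
Context {R : realType} {d : nat}.
Implicit Types (y z : d.-tuple R) (L : R).

(* A bounded substitute for the identity, with [vsin L y] close to [y] for large
   [L], whose coordinates are trigonometric polynomials. *)
Definition vsin L y : d.-tuple R := [tuple L * sin (tnth y i / L) | i < d].

Lemma tnth_vsin_le L y i : 0 < L -> `|tnth (vsin L y) i| <= `|tnth y i|.
Proof.
move=> L0; rewrite tnth_mktuple normrM gtr0_norm// -ler_pdivlMl//.
apply: (le_trans (norm_sin_le _ _)); rewrite normrM mulrC ger0_norm//.
by rewrite invr_ge0 ltW.
Qed.

Lemma tnth_vsin_sub_le L y i : 0 < L ->
  `|tnth y i - tnth (vsin L y) i| <= tnth y i ^+ 2 / L.
Proof.
move=> L0; rewrite tnth_mktuple distrC.
have -> : L * sin (tnth y i / L) - tnth y i = L * (sin (tnth y i / L) - tnth y i / L).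
  by field; rewrite gt_eqF.
rewrite normrM gtr0_norm// -ler_pdivlMl//.
apply: (le_trans (norm_sin_sub_le _ _)).
by rewrite [leRHS](_ : _ = (tnth y i / L) ^+ 2)//; field; rewrite gt_eqF.
Qed.

Lemma sqnorm_vsin_le L y : 0 < L -> vnorm (vsin L y) ^+ 2 <= vnorm y ^+ 2.
Proof.
move=> L0; rewrite !sqr_vnorm; apply: ler_sum => i _.
rewrite -[leLHS]real_normK ?num_real// -[leRHS]real_normK ?num_real//.
by rewrite lerXn2r ?nnegrE//; exact: tnth_vsin_le.
Qed.

Lemma vnorm_vsin_le L y : 0 < L -> vnorm (vsin L y) <= vnorm y.
Proof. by move=> L0; rewrite -(@ler_pXn2r _ 2) ?nnegrE ?vnorm_ge0 ?sqnorm_vsin_le. Qed.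

Lemma sqnorm_vsin_bounded L y : vnorm (vsin L y) ^+ 2 <= d%:R * L ^+ 2.
Proof.
rewrite sqr_vnorm (@le_trans _ _ (\sum_(i < d) L ^+ 2))//; last first.
  by rewrite sumr_const card_ord mulr_natl.
apply: ler_sum => i _; rewrite tnth_mktuple exprMn ler_piMr ?sqr_ge0//.
Qed.

Lemma sqnorm_vsin_sub_le L y : 0 < L ->
  `|vnorm y ^+ 2 - vnorm (vsin L y) ^+ 2| <= 2 * vnorm y * (vnorm y ^+ 2 / L).
Proof.
move=> L0; rewrite (_ : _ - _ = \sum_(i < d) (tnth y i ^+ 2 - tnth (vsin L y) i ^+ 2)); last by rewrite !sqr_vnorm sumrB.
rewrite [in _ * (_ / L)]sqr_vnorm (le_trans (ler_norm_sum _ _ _))//.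
rewrite mulr_suml mulr_sumr; apply: ler_sum => i _.
rewrite subr_sqr normrM mulrC ler_pM ?tnth_vsin_sub_le//.
rewrite (le_trans (ler_normD _ _))//.
have := tnth_le_vnorm y i; have := tnth_vsin_le y i L0; lra.
Qed.

Lemma dotv_vsin_sub_le L z y : 0 < L -> vnorm z <= 1 ->
  `|dotv z y - dotv z (vsin L y)| <= vnorm y ^+ 2 / L.
Proof.
move=> L0 z1; rewrite -sumrB (le_trans (ler_norm_sum _ _ _))//.
rewrite sqr_vnorm mulr_suml; apply: ler_sum => i _.
rewrite -mulrBr normrM -[leRHS]mul1r ler_pM ?tnth_vsin_sub_le//.
by rewrite (le_trans (tnth_le_vnorm _ _)).
Qed.

Lemma trig_vsin L i : trigpoly (fun y : d.-tuple R => tnth (vsin L y) i).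
Proof.
rewrite (_ : (fun y => _) = (fun y => L * sin (dotv (vscale L^-1 (vunit i)) y))).
  by apply: trig_scale; exact: trig_sin.
by apply/funext => y; rewrite tnth_mktuple dotv_scalel dotv_unit [L^-1 * _]mulrC.
Qed.

Lemma trig_sqnorm_vsin L : trigpoly (fun y : d.-tuple R => vnorm (vsin L y) ^+ 2).
Proof.
rewrite (_ : (fun y => _) = (fun y => \sum_(i < d) tnth (vsin L y) i ^+ 2)).
  by apply: trig_sum => i; apply: trig_exp; exact: trig_vsin.
by apply/funext => y; rewrite sqr_vnorm.
Qed.

Lemma trig_dotv_vsin L z : trigpoly (fun y : d.-tuple R => dotv z (vsin L y)).
Proof. by apply: trig_sum => i; apply: trig_scale; exact: trig_vsin. Qed.

End sine_folding.

Section radial_approximation.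
Context {R : realType} {d : nat}.
Implicit Types (y z : d.-tuple R) (L : R).

Lemma exp_sub_le2 (a b K : R) k : (k <= 2)%N -> 1 <= K -> `|a| <= K -> `|b| <= K ->
  `|a ^+ k - b ^+ k| <= 2 * K * `|a - b|.
Proof.
move=> k2 K1 aK bK; have u0 := normr_ge0 (a - b).
case: k k2 => [|[|[|//]]] _.
- by rewrite !expr0 subrr normr0 mulr_ge0// mulr_ge0//; lra.
- rewrite !expr1; nra.
- rewrite subr_sqr normrM mulrC ler_wpM2r// (le_trans (ler_normD _ _))//; lra.
Qed.

Lemma exp_norm_le2 (a K : R) k : (k <= 2)%N -> 1 <= K -> `|a| <= K -> `|a ^+ k| <= K ^+ 2.
Proof.
move=> k2 K1 aK; rewrite normrX (@le_trans _ _ (K ^+ k))//.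
  by rewrite lerXn2r ?nnegrE// (le_trans _ aK).
by rewrite ler_weXn2l.
Qed.

(** The explicit factor [|y|^2] makes approximation errors in [H] relative to [|y|^2], and [H]
    depends on one variable, so the one-dimensional Weierstrass theorem is enough. [k = 1, 2] serve
    for the truncated projection and its square, [k = 0] for third moments. *)
Definition radial z k (H : R -> R) y := dotv z y ^+ k * (vnorm y ^+ 2 * H (vnorm y ^+ 2)).

Variables (z : d.-tuple R) (k : nat) (H : R -> R).
Hypotheses (z1 : vnorm z <= 1) (k2 : (k <= 2)%N).
Hypotheses (HL : lipb H) (H2 : forall r, 2 <= r -> H r = 0).

Lemma measurable_radial : measurable_fun setT (radial z k H).
Proof.
have mv : measurable_fun setT (fun y : d.-tuple R => vnorm y ^+ 2).
  by apply: measurable_funX; exact: measurable_vnorm.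
apply: measurable_funM; first by apply: measurable_funX; exact: measurable_dotv.
by apply: measurable_funM => //; exact: (measurableT_comp (lipb_measurable HL) mv).
Qed.

Lemma norm_dotv_le1 y : `|dotv z y| <= vnorm y.
Proof. by rewrite (le_trans (dotv_le _ _))// ler_piMl ?vnorm_ge0. Qed.

Lemma radial_bounded : exists B, forall y, `|radial z k H y| <= B.
Proof.
have [L [L0 _ BL]] := HL; exists (2 ^+ 2 * (2 * L)) => y; rewrite /radial.
have [y2|y2] := leP 2 (vnorm y ^+ 2).
  by rewrite H2// !mulr0 normr0 !mulr_ge0// ltW.
have vy2 : vnorm y <= 2 by have := vnorm_ge0 y; nra.
rewrite normrM ler_pM//; first by apply: exp_norm_le2 => //; [rewrite ler1n|exact: le_trans (norm_dotv_le1 y) vy2].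
by rewrite normrM ler_pM// ger0_norm ?sqr_ge0// ltW.
Qed.

Lemma radial_quadratic : exists C, forall y, `|radial z k H y| <= C * vnorm y ^+ 2.
Proof.
have [L [L0 _ BL]] := HL; exists (2 ^+ 2 * L) => y; rewrite /radial.
have [y2|y2] := leP 2 (vnorm y ^+ 2).
  by rewrite H2// !mulr0 normr0 mulr_ge0 ?sqr_ge0// mulr_ge0// ltW.
have vy2 : vnorm y <= 2 by have := vnorm_ge0 y; nra.
rewrite normrM -[leRHS]mulrA ler_pM//; first by apply: exp_norm_le2 => //; [rewrite ler1n|exact: le_trans (norm_dotv_le1 y) vy2].
by rewrite normrM mulrC ler_pM// ger0_norm ?sqr_ge0.
Qed.

Lemma radial_vsin_approx e : 0 < e -> exists L, 0 < L /\
  forall y, `|radial z k H y - radial z k H (vsin L y)| <= e * vnorm y ^+ 2.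
Proof.
move=> e0; have [B BP] := radial_bounded.
have B0 : 0 <= B by apply: le_trans (BP vzero).
(* [r H r] itself is to be Lipschitz on [r >= 0]; since [H] vanishes beyond 2, the factor [r] may be
   clipped. *)
have [G [G0 GL GB]] : lipb (fun r => clip 0 2 r * H r).
  by apply: lipb_mul => //; apply: lipb_clip; rewrite lexx ler0n.
have GE r : 0 <= r -> clip 0 2 r * H r = r * H r.
  move=> r0; have [r2|r2] := leP r 2; first by rewrite clip_id// r0.
  by rewrite H2 ?mulr0// ltW.
pose K := 1 + 2 * B / e.
have K1 : 1 <= K by rewrite /K lerDl divr_ge0 ?mulr_ge0// ltW.
pose C := 2 * K * G + K ^+ 2 * (G * (2 * K)).
have C0 : 0 < C by rewrite /C addr_gt0// !mulr_gt0 ?exprn_gt0//; lra.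
exists (C / e); split; first by rewrite divr_gt0.
move=> y; set L := C / e; have L0 : 0 < L by rewrite divr_gt0.
have n0 := vnorm_ge0 y.
(* Beyond [K] the trivial bound [2 B <= e K] is enough, as [K <= |y|^2] there; below [K] the error
   of [vsin L] is of order [|y|^2 / L]. *)
have [yK|yK] := leP (vnorm y) K; last first.
  apply: (@le_trans _ _ (2 * B)).
    rewrite (le_trans (ler_normB _ _))//.
    have := BP y; have := BP (vsin L y); lra.
  apply: (@le_trans _ _ (e * K)).
    have -> : e * K = e + 2 * B by rewrite /K; field; rewrite gt_eqF.
    lra.
  by rewrite ler_pM2l//; nra.
have d1 := dotv_vsin_sub_le y L0 z1.
have d2 := sqnorm_vsin_sub_le y L0.
have sy := vnorm_vsin_le y L0.
rewrite /radial -!GE ?sqr_ge0//.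
set a := dotv z y in d1 *; set b := dotv z (vsin L y) in d1 *.
set r := vnorm y ^+ 2 in d1 d2 *; set r' := vnorm (vsin L y) ^+ 2 in d2 *.
have r0 : 0 <= r by exact: sqr_ge0.
have aK : `|a| <= K by rewrite (le_trans (norm_dotv_le1 _)).
have bK : `|b| <= K by rewrite (le_trans (norm_dotv_le1 _))// (le_trans sy).
set Gr := clip 0 2 r * H r; set Gr' := clip 0 2 r' * H r'.
have -> : a ^+ k * Gr - b ^+ k * Gr' = (a ^+ k - b ^+ k) * Gr + b ^+ k * (Gr - Gr') by ring.
apply: (@le_trans _ _ (2 * K * (r / L) * G + K ^+ 2 * (G * (2 * K * (r / L))))).
  rewrite (le_trans (ler_normD _ _))// lerD// normrM ler_pM//.
  - rewrite (le_trans (exp_sub_le2 k2 K1 aK bK))// ler_pM2l//; lra.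
  - exact: GB.
  - exact: exp_norm_le2.
  - apply: (le_trans (GL _ _)); rewrite ler_pM2l// (le_trans d2)// ler_wpM2r//.
      by rewrite divr_ge0// ltW.
    by rewrite ler_pM2l.
rewrite [leLHS](_ : _ = C * (r / L)); last by rewrite /C; ring.
by rewrite /L [leLHS](_ : _ = e * r)//; field; rewrite !gt_eqF.
Qed.

(** [|vsin L y|^2] stays in the bounded interval [0, S], so [H] may be replaced there by a
    polynomial; the factor [|vsin L y|^2 <= |y|^2] is kept exact. *)
Lemma radial_vsin_trig L e : 0 < L -> 0 < e -> exists q, [/\ trigpoly q,
  exists C, forall y, `|q y| <= C * vnorm y ^+ 2 &
  forall y, `|radial z k H (vsin L y) - q y| <= e * vnorm y ^+ 2].
Proof.
move=> L0 e0; have [l [l0 lH _]] := HL.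
pose S := d%:R * L ^+ 2 + 1.
have S1 : 1 <= S by rewrite /S lerDr mulr_ge0// sqr_ge0.
have S0 : 0 < S by lra.
have sS y : vnorm (vsin L y) ^+ 2 <= S.
  by rewrite (le_trans (sqnorm_vsin_bounded L y))// lerDl.
have dS y : `|dotv z (vsin L y) ^+ k| <= S ^+ 2.
  apply: exp_norm_le2 => //; rewrite (le_trans (norm_dotv_le1 _))//.
  have := sS y; have := vnorm_ge0 (vsin L y); nra.
have [p pP] := @weierstrass_lipschitz _ H l S (e / S ^+ 2) S0 (divr_gt0 e0 (exprn_gt0 2 S0)) lH.
pose q (y : d.-tuple R) := dotv z (vsin L y) ^+ k *
  (vnorm (vsin L y) ^+ 2 * p.[vnorm (vsin L y) ^+ 2]).
have tp : trigpoly (fun y : d.-tuple R => p.[vnorm (vsin L y) ^+ 2]).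
  by apply: trig_horner; exact: trig_sqnorm_vsin.
exists q; split.
- apply: trig_mul; first by apply: trig_exp; exact: trig_dotv_vsin.
  by apply: trig_mul => //; exact: trig_sqnorm_vsin.
- have [M MP] := trig_bounded tp.
  exists (S ^+ 2 * `|M|) => y; rewrite /q normrM -[leRHS]mulrA ler_pM//.
  rewrite normrM mulrC ler_pM//; first by rewrite (le_trans (MP y))// ler_norm.
  by rewrite ger0_norm ?sqr_ge0// sqnorm_vsin_le.
- move=> y; rewrite /radial /q -mulrBr -mulrBr normrM.
  rewrite [leRHS](_ : _ = S ^+ 2 * (vnorm y ^+ 2 * (e / S ^+ 2))); last first.
    by field; rewrite gt_eqF.
  apply: ler_pM => //; rewrite normrM ler_pM//.
    by rewrite ger0_norm ?sqr_ge0// sqnorm_vsin_le.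
  by apply: pP; rewrite sqr_ge0/=.
Qed.

End radial_approximation.

Section cvg_radial.
Context {R : realType} {d : nat} {dT : measure_display} {T : measurableType dT}.
Context (P : probability T R) (X : R -> T -> d.-tuple R) (gamma : d.-tuple R).
Context (Pi : {measure set (d.-tuple R) -> \bar R}).
Hypothesis mX : forall s, measurable_fun setT (X s).
Hypothesis Xchar : char_triplet_nongauss P X gamma Pi.
Hypothesis Pi1 : Pi [set y | 1 < vnorm y] = 0%E.
Variables (t : R) (t0 : 0 < t).

Lemma cvg_small_mean_radial (z : d.-tuple R) (k : nat) (H : R -> R) :
  vnorm z <= 1 -> (k <= 2)%N -> lipb H -> (forall r, 2 <= r -> H r = 0) ->
  small_mean P X t (radial z k H) n @[n --> \oo] --> t * Rintegral Pi setT (radial z k H).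
Proof.
move=> z1 k2 HL H2; have [C CP] := radial_quadratic z1 k2 HL H2.
apply: (cvg_small_mean_approx mX Xchar Pi1 t0 (C := C)) => //; first exact: measurable_radial.
move=> e e0; have e2 : 0 < e / 2 by rewrite divr_gt0.
have [L [L0 La]] := radial_vsin_approx z1 k2 HL H2 e2.
have [q [tq [C' qC] qa]] := radial_vsin_trig z1 k2 HL L0 e2.
exists q; split => //.
- exact: measurable_trig.
- by exists C'.
- exact: (cvg_trig_quadratic mX Xchar Pi1 t0 tq qC).
- move=> y.
  have -> : radial z k H y - q y = (radial z k H y - radial z k H (vsin L y)) +
    (radial z k H (vsin L y) - q y) by ring.
  rewrite (le_trans (ler_normD _ _))//; have := La y; have := qa y; lra.
Qed.

End cvg_radial.

(** * Lindeberg replacement for independent increments *)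

Section rectangles.
Context d1 d2 (T1 : measurableType d1) (T2 : measurableType d2) (R : realType).

Lemma measure_unique_rectangles (m1 m2 : {measure set (T1 * T2) -> \bar R}) :
  (m1 setT < +oo)%E ->
  (forall A B, measurable A -> measurable B -> m1 (A `*` B) = m2 (A `*` B)) ->
  forall C, measurable C -> m1 C = m2 C.
Proof.
move=> m1T m12 C mC.
pose G : set (set (T1 * T2)) :=
  [set C | exists A, measurable A /\ exists B, measurable B /\ C = A `*` B].
apply: (measure_unique G (fun=> setT)) => //.
- rewrite measurable_prod_measurableType //; congr (<<s _ >>).
  rewrite predeqE; split => [[A mA [B mB <-]]|[A [mA [B [mB ->]]]]].
    by exists A; split => //; exists B.
  by exists A => //; exists B.
- move=> /= _ _ [X1 [mX1 [X2 [mX2 ->]]]] [Y1 [mY1 [Y2 [mY2 ->]]]].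
  rewrite -setXI; exists (X1 `&` Y1); split; first exact: measurableI.
  by exists (X2 `&` Y2); split => //; exact: measurableI.
- by move=> _; exists setT; split => //; exists setT; split => //; rewrite setXTT.
- by rewrite bigcup_const.
- by move=> A [X [mX [Y [mY ->]]]]; exact: m12.
Qed.

End rectangles.

Section independence.
Context {R : realType} {dT dV : measure_display} {T : measurableType dT} {V : measurableType dV}.
Variable P : probability T R.

Lemma indep_integral (S : T -> R) (Z : T -> V) (F : R * V -> \bar R) :
  measurable_fun setT S -> measurable_fun setT Z -> measurable_fun setT F ->
  (forall x, (0 <= F x)%E) ->
  (forall A B, measurable A -> measurable B ->
     P (S @^-1` A `&` Z @^-1` B) = (P (S @^-1` A) * P (Z @^-1` B))%E) ->
  (\int[P]_w F (S w, Z w) = \int[P]_w \int[P]_w' F (S w, Z w'))%E.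
Proof.
move=> mS mZ mF F0 SZ.
pose psi0 (w : T) := (S w, Z w).
pose psi (u : T * T) := (S u.1, Z u.2).
have m0 : measurable_fun setT psi0 by exact: measurable_fun_pair.
have m1 : measurable_fun setT psi.
  by apply: measurable_fun_pair; [exact: (measurableT_comp mS)|exact: (measurableT_comp mZ)].
transitivity (\int[pushforward P psi0]_x F x)%E.
  by rewrite (ge0_integral_pushforward m0).
transitivity (\int[pushforward (P \x P)%E psi]_x F x)%E; last first.
  rewrite (ge0_integral_pushforward m1)// preimage_setT fubini_tonelli1//; last by move=> x; exact: F0.
  by apply: (measurableT_comp mF).
apply: eq_measure_integral => C mC _.
apply: measure_unique_rectangles mC.
  rewrite /= /pushforward preimage_setT; apply: (@le_lt_trans _ _ 1%E); last exact: ltry.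
  exact: probability_le1.
move=> A B mA mB; rewrite /= /pushforward.
rewrite (_ : psi @^-1` (A `*` B) = (S @^-1` A) `*` (Z @^-1` B))//.
rewrite product_measure1E.
- by rewrite -SZ.
- by rewrite -[X in measurable X]setTI; exact: mS.
- by rewrite -[X in measurable X]setTI; exact: mZ.
Qed.

Definition mutually_indep (n : nat) (Z : 'I_n -> T -> V) : Prop :=
  forall B : 'I_n -> set V, (forall i, measurable (B i)) ->
    P (\bigcap_(i in [set: 'I_n]) (Z i @^-1` B i)) =
    (\prod_(i < n) P (Z i @^-1` B i))%E.

Variables (n : nat) (Z : 'I_n -> T -> V) (g : V -> R).
Hypotheses (mZ : forall i, measurable_fun setT (Z i)) (mg : measurable_fun setT g).
Hypothesis indZ : mutually_indep Z.

Definition partial_sum (j : nat) (w : T) : R := \sum_(i < n | (i < j)%N) g (Z i w).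

Definition tail_event (j : nat) (B : 'I_n -> set V) : set T :=
  [set w | forall i : 'I_n, (j <= i)%N -> B i (Z i w)].

Lemma measurable_partial_sum j : measurable_fun setT (partial_sum j).
Proof.
rewrite (_ : partial_sum j = fun w => \sum_(i < n) (if (i < j)%N then g (Z i w) else 0)).
  apply: measurable_sum => i; case: (i < j)%N; last exact: measurable_cst.
  exact: (measurableT_comp mg (mZ i)).
by apply/funext => w; rewrite /partial_sum big_mkcond.
Qed.

Let mpre i B : measurable B -> measurable (Z i @^-1` B).
Proof. by move=> mB; rewrite -[X in measurable X]setTI; exact: mZ. Qed.

Lemma tail_eventE j B : tail_event j B =
  \bigcap_(i in [set: 'I_n]) (Z i @^-1` (if (j <= i)%N then B i else setT)).
Proof.
apply/seteqP; split => [w H i _ /=|w H i ji /=]; first by case: ifP => // ji; exact: H.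
by have := H i I => /=; rewrite ji.
Qed.

Lemma measurable_tail_event j B : (forall i, measurable (B i)) -> measurable (tail_event j B).
Proof.
move=> mB; rewrite tail_eventE; apply: fin_bigcap_measurable; first exact: finite_finset.
by move=> i _; apply: mpre; case: ifP.
Qed.

Lemma partial_sumS (j : 'I_n) w : partial_sum j.+1 w = partial_sum j w + g (Z j w).
Proof.
rewrite /partial_sum (bigD1 j)//= addrC; congr (_ + _); apply: eq_bigl => i.
by rewrite ltnS [RHS]ltn_neqAle andbC.
Qed.

Lemma tail_eventS (j : 'I_n) B : tail_event j B = Z j @^-1` B j `&` tail_event j.+1 B.
Proof.
apply/seteqP; split => [w H|w [H1 H2] i].
  by split; [exact: H|move=> i ji; apply: H; exact: ltnW].
rewrite leq_eqVlt => /orP[/eqP ji|]; last exact: H2.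
by rewrite (_ : i = j)//; exact/val_inj.
Qed.

(** Independence of the partial sum from the next variable alone does not propagate; the induction
    keeps all later variables in play and moves one of them at a time from the tail into the sum. *)
Lemma indep_sum_tail (j : nat) : (j <= n)%N ->
  forall A B, measurable A -> (forall i, measurable (B i)) ->
  P (partial_sum j @^-1` A `&` tail_event j B) =
  (P (partial_sum j @^-1` A) * \prod_(i < n | (j <= i)%N) P (Z i @^-1` B i))%E.
Proof.
elim: j => [_ A B mA mB|j IH jn A B mA mB].
  have tE : P (tail_event 0 B) = (\prod_(i < n | (0 <= i)%N) P (Z i @^-1` B i))%E.
    by rewrite tail_eventE indZ.
  have s0 w : partial_sum 0 w = 0 by exact: big_pred0.
  have [A0|A0] := pselect (A 0).
    rewrite (_ : partial_sum 0 @^-1` A = setT) ?setTI ?probability_setT ?mul1e//.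
    by apply/seteqP; split => // w _ /=; rewrite s0.
  rewrite (_ : partial_sum 0 @^-1` A = set0) ?set0I ?measure0 ?mul0e//.
  by apply/seteqP; split => // w /=; rewrite s0.
pose i0 := Ordinal jn.
have prod_split (C : 'I_n -> set V) : (\prod_(i < n | (j <= i)%N) P (Z i @^-1` C i) =
   P (Z i0 @^-1` C i0) * \prod_(i < n | (j.+1 <= i)%N) P (Z i @^-1` C i))%E.
  rewrite (bigD1 i0)//=; congr (_ * _)%E; apply: eq_bigl => i.
  by rewrite [RHS]ltn_neqAle eq_sym andbC.
(* The induction hypothesis on rectangles: [upd] imposes [B0] on the variable that is about to join
   the sum. *)
have rect (C : 'I_n -> set V) A0 B0 : (forall i, measurable (C i)) ->
  measurable A0 -> measurable B0 ->
  P (partial_sum j @^-1` A0 `&` Z i0 @^-1` B0 `&` tail_event j.+1 C) =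
  (P (partial_sum j @^-1` A0) * P (Z i0 @^-1` B0) *
    \prod_(i < n | (j.+1 <= i)%N) P (Z i @^-1` C i))%E.
  move=> mC mA0 mB0; pose upd i := if i == i0 then B0 else C i.
  have mupd i : measurable (upd i) by rewrite /upd; case: ifP.
  have tail_upd : tail_event j.+1 upd = tail_event j.+1 C.
    apply/seteqP; split => w H i ji; have := H i ji; rewrite /upd; case: eqP => // iE;
      by move: ji; rewrite iE ltnn.
  have prod_upd : (\prod_(i < n | (j.+1 <= i)%N) P (Z i @^-1` upd i) =
      \prod_(i < n | (j.+1 <= i)%N) P (Z i @^-1` C i))%E.
    by apply: eq_bigr => i ji; rewrite /upd; case: eqP => // iE; move: ji; rewrite iE ltnn.
  have := IH (ltnW jn) A0 upd mA0 mupd.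
  by rewrite (tail_eventS i0) prod_split prod_upd tail_upd /upd eqxx setIA muleA.
have rect0 A0 B0 : measurable A0 -> measurable B0 ->
    P (partial_sum j @^-1` A0 `&` Z i0 @^-1` B0) =
    (P (partial_sum j @^-1` A0) * P (Z i0 @^-1` B0))%E.
  move=> mA0 mB0; have := rect (fun=> setT) A0 B0 (fun=> measurableT) mA0 mB0.
  rewrite (_ : tail_event _ _ = setT) ?setIT; last by apply/seteqP; split.
  by rewrite big1 ?mule1// => i _; rewrite preimage_setT probability_setT.
pose c := (\prod_(i < n | (j.+1 <= i)%N) P (Z i @^-1` B i))%E.
have [c0 cfin] : (0 <= c)%E /\ c \is a fin_num.
  rewrite /c; elim/big_ind: _ => [//|x y [x0 xf] [y0 yf]|i _].
    by split; [exact: mule_ge0|exact: fin_numM].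
  by split; [exact: measure_ge0|exact/fin_num_measure/mpre].
have c0' : 0 <= fine c by exact: fine_ge0.
have mR := measurable_tail_event j.+1 mB.
have mS := measurable_partial_sum j.
pose psi0 (w : T) := (partial_sum j w, Z i0 w).
have m0 : measurable_fun setT psi0 by exact: measurable_fun_pair.
pose E := [set u : R * V | A (u.1 + g u.2)].
have mE : measurable E.
  rewrite -[E]setTI; apply: (_ : measurable_fun setT (fun u : R * V => u.1 + g u.2)) => //.
  by apply: measurable_funD => //; exact: (measurableT_comp mg).
have EE : partial_sum j.+1 @^-1` A = psi0 @^-1` E.
  by apply/seteqP; split => w; rewrite /E /psi0/= -(partial_sumS i0).
rewrite EE -/c -(fineK cfin) muleC.
(* Two finite measures agree on rectangles, hence on [E]: the law of (sum, next variable) restricted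
   to the tail event, and [c] times its full law. *)
have := @measure_unique_rectangles _ _ _ _ _ (pushforward (mrestr P mR) psi0)
  (mscale (NngNum c0') (pushforward P psi0)) _ _ E mE.
apply.
- rewrite /= /pushforward/= /mrestr preimage_setT setTI.
  by apply: (@le_lt_trans _ _ 1%E); [exact: probability_le1|exact: ltry].
- move=> A0 B0 mA0 mB0; rewrite /= /mscale /pushforward /mrestr/= /pushforward.
  rewrite (_ : psi0 @^-1` (A0 `*` B0) = (partial_sum j @^-1` A0) `&` (Z i0 @^-1` B0))//.
  by rewrite rect// rect0// -/c fineK// muleC.
Qed.

Lemma indep_partial_sum (j : 'I_n) A B : measurable A -> measurable B ->
  P (partial_sum j @^-1` A `&` Z j @^-1` B) = (P (partial_sum j @^-1` A) * P (Z j @^-1` B))%E.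
Proof.
move=> mA mB; pose upd i := if i == j then B else setT.
have := @indep_sum_tail j (ltnW (ltn_ord j)) A upd mA.
have mupd i : measurable (upd i) by rewrite /upd; case: ifP.
move=> /(_ mupd); rewrite (tail_eventS j) (bigD1 j)//= {1}/upd eqxx.
rewrite (_ : tail_event j.+1 upd = setT) ?setIT; last first.
  by apply/seteqP; split => // w _ i ji; rewrite /upd; case: eqP => // iE; move: ji; rewrite iE ltnn.
rewrite big1 ?mule1 => [|i /andP[_ ij]]; last first.
  by rewrite /upd (negbTE ij) preimage_setT probability_setT.
by rewrite /upd eqxx.
Qed.

End independence.

Section integrable_EFin.
Context d (T : measurableType d) (R : realType) (mu : {measure set T -> \bar R}).
Implicit Types V W : T -> R.

Lemma integrable_add V W : mu.-integrable setT (EFin \o V) -> mu.-integrable setT (EFin \o W) ->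
  mu.-integrable setT (EFin \o (fun w => V w + W w)).
Proof. exact: (@integrableD _ _ _ _ _ measurableT (EFin \o V) (EFin \o W)). Qed.

Lemma integrable_sub V W : mu.-integrable setT (EFin \o V) -> mu.-integrable setT (EFin \o W) ->
  mu.-integrable setT (EFin \o (fun w => V w - W w)).
Proof. exact: (@integrableB _ _ _ _ _ measurableT (EFin \o V) (EFin \o W)). Qed.

Lemma integrable_scale (c : R) V : mu.-integrable setT (EFin \o V) ->
  mu.-integrable setT (EFin \o (fun w => c * V w)).
Proof. exact: (@integrableZl _ _ _ _ _ measurableT c (EFin \o V)). Qed.

End integrable_EFin.

(** * Replacement of the steps of a walk, one operator at a time *)

Section shift_mean.
Context {R : realType} {dT : measure_display} {T : measurableType dT} (P : probability T R).
Implicit Types (phi psi f : R -> R) (U : T -> R).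

Definition unit_valued phi := measurable_fun setT phi /\ forall x, 0 <= phi x <= 1.

(** One step of the walk with increments distributed as [U], the counterpart of [avg]. *)
Definition smean U phi x := Rintegral P setT (fun w => phi (x + U w)).

Lemma measurable_shift U x : measurable_fun setT U -> measurable_fun setT (fun w => x + U w).
Proof. by move=> mU; apply: measurable_funD => //; exact: measurable_cst. Qed.

Lemma integrable_shift U phi x : measurable_fun setT U -> unit_valued phi ->
  P.-integrable setT (EFin \o (fun w => phi (x + U w))).
Proof.
move=> mU [mp p01]; apply: (@integrable_bounded _ _ _ _ _ _ 1) => // [|w _].
  exact: (measurableT_comp mp (measurable_shift x mU)).
by have /andP[h0 h1] := p01 (x + U w); rewrite ger0_norm.
Qed.

Lemma smean_le U phi psi e x : measurable_fun setT U -> unit_valued phi -> unit_valued psi ->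
  (forall y, `|phi y - psi y| <= e) -> `|smean U phi x - smean U psi x| <= e.
Proof.
move=> mU p01 q01 pq.
have ip := integrable_shift x mU p01; have iq := integrable_shift x mU q01.
rewrite /smean -RintegralB//.
have ipq := integrable_sub ip iq.
apply: (le_trans (le_normr_Rintegral measurableT ipq)).
rewrite -[leRHS](Rintegral_cst1 P); apply: le_Rintegral => //.
- exact: (@integrable_norm _ _ _ _ setT (fun w => phi (x + U w) - psi (x + U w)) ipq).
- by apply: (@integrable_bounded _ _ _ _ _ _ `|e|).
Qed.

Lemma smean_unit_valued U phi : measurable_fun setT U -> unit_valued phi ->
  unit_valued (smean U phi).
Proof.
move=> mU p01; have [mp b01] := p01; split; last first.
  move=> x; apply/andP; split.
    by apply: Rintegral_ge0 => w _; have /andP[] := b01 (x + U w).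
  rewrite -[leRHS](Rintegral_cst1 P); apply: le_Rintegral => //.
  - exact: integrable_shift.
  - by apply: (@integrable_bounded _ _ _ _ _ _ 1) => // w _; rewrite normr1.
  - by move=> w _; have /andP[] := b01 (x + U w).
apply: (@measurableT_comp _ _ _ _ _ _ (fine : \bar R -> R)) => //.
apply: (@measurable_fun_fubini_tonelli_F _ _ _ _ _ P
  (fun u : R * T => (phi (u.1 + U u.2))%:E)) => //.
  apply/measurable_EFinP; apply: (measurableT_comp mp).
  by apply: measurable_funD => //; exact: (measurableT_comp mU).
by move=> u; rewrite lee_fin; have /andP[] := b01 (u.1 + U u.2).
Qed.

Lemma avg_unit_valued h phi : unit_valued phi -> unit_valued (avg h phi).
Proof.
move=> [mp b01]; split.
  apply: measurable_funM; last exact: measurable_cst.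
  apply: measurable_funD; apply: (measurableT_comp mp).
    by apply: measurable_funD => //; exact: measurable_cst.
  by apply: measurable_funB => //; exact: measurable_cst.
move=> x; have := b01 (x + h); have := b01 (x - h); rewrite /avg; lra.
Qed.

Lemma iter_avg_unit_valued h phi n : unit_valued phi -> unit_valued (iter n (avg h) phi).
Proof. by move=> p01; elim: n => //= n; exact: avg_unit_valued. Qed.

Lemma iter_smean_unit_valued U phi n : measurable_fun setT U -> unit_valued phi ->
  unit_valued (iter n (smean U) phi).
Proof. by move=> mU p01; elim: n => //= n; exact: smean_unit_valued. Qed.

Lemma smean_avg U h phi x : measurable_fun setT U -> unit_valued phi ->
  smean U (avg h phi) x = avg h (smean U phi) x.
Proof.
move=> mU p01; rewrite /smean /avg.
have i1 := integrable_shift (x + h) mU p01; have i2 := integrable_shift (x - h) mU p01.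
rewrite (_ : (fun w => _) = (fun w => (phi (x + h + U w) + phi (x - h + U w)) / 2)); last first.
  by apply/funext => w; rewrite (addrAC x (U w) h) (addrAC x (U w) (- h)).
have i12 := integrable_add i1 i2.
by rewrite (RintegralZr 2^-1 measurableT i12) (RintegralD measurableT i1 i2).
Qed.

Lemma smean_iter_avg U h phi n x : measurable_fun setT U -> unit_valued phi ->
  smean U (iter n (avg h) phi) x = iter n (avg h) (smean U phi) x.
Proof.
move=> mU p01; elim: n x => // n IH x.
rewrite !iterS smean_avg//; last exact: iter_avg_unit_valued.
by rewrite /avg !IH.
Qed.

Lemma iter_avg_dist h n phi psi e : (forall y, `|phi y - psi y| <= e) ->
  forall x, `|iter n (avg h) phi x - iter n (avg h) psi x| <= e.
Proof.
move=> pq; elim: n => // n IH x; rewrite !iterS /avg -mulrBl normrM.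
have := IH (x + h); have := IH (x - h); rewrite [`|2^-1|]ger0_norm//.
set a := iter _ _ _ _; set b := iter _ _ _ _; set c := iter _ _ _ _; set d := iter _ _ _ _.
move=> h1 h2; have -> : c + a - (d + b) = (c - d) + (a - b) by ring.
have := ler_normD (c - d) (a - b); lra.
Qed.

(** Both one-step operators contract the sup distance, and they commute. By commutation the
    difference of the operators always acts on [phi] itself, so the smoothness of its iterates is
    never examined. *)
Lemma telescoping U h phi e n x : measurable_fun setT U -> unit_valued phi ->
  (forall y, `|smean U phi y - avg h phi y| <= e) ->
  `|iter n (smean U) phi x - iter n (avg h) phi x| <= n%:R * e.
Proof.
move=> mU p01 He; elim: n x => [|n IH] x; first by rewrite subrr normr0 mul0r.
rewrite iterS [in X in _ - X]iterSr.
have -> : smean U (iter n (smean U) phi) x - iter n (avg h) (avg h phi) x =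
  (smean U (iter n (smean U) phi) x - smean U (iter n (avg h) phi) x) +
  (iter n (avg h) (smean U phi) x - iter n (avg h) (avg h phi) x).
  by rewrite smean_iter_avg//; ring.
rewrite (le_trans (ler_normD _ _))// -natr1 mulrDl mul1r lerD//.
- apply: smean_le => //; [exact: iter_smean_unit_valued|exact: iter_avg_unit_valued].
- exact: iter_avg_dist.
Qed.

(** Mean 0 and variance [h^2] match those of the sign step, so the Taylor terms of order at most two
    cancel and the two third-order remainders are left. *)
Lemma smean_avg_taylor U f (h x f1 f2 C M : R) : measurable_fun setT U -> unit_valued f ->
  (forall w, `|U w| <= M) ->
  (forall u : R, `|f (x + u) - f x - u * f1 - u ^+ 2 / 2 * f2| <= C * `|u| ^+ 3) ->
  Rintegral P setT U = 0 -> 0 <= h -> Rintegral P setT (fun w => U w ^+ 2) = h ^+ 2 ->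
  `|smean U f x - avg h f x| <= C * (Rintegral P setT (fun w => `|U w| ^+ 3) + h ^+ 3).
Proof.
move=> mU f01 UM T1 U1 h0 U2.
have mU2 : measurable_fun setT (fun w => U w ^+ 2) by apply: measurable_funX.
have mU3 : measurable_fun setT (fun w => `|U w| ^+ 3).
  by apply: measurable_funX; exact: (measurableT_comp (@normr_measurable R setT)).
have iU : P.-integrable setT (EFin \o U) by apply: (@integrable_bounded _ _ _ _ _ _ M).
have iU2 : P.-integrable setT (EFin \o (fun w => U w ^+ 2)).
  apply: (@integrable_bounded _ _ _ _ _ _ (M ^+ 2)) => // w _.
  by rewrite normrX lerXn2r ?nnegrE// (le_trans _ (UM w)).
have iU3 : P.-integrable setT (EFin \o (fun w => `|U w| ^+ 3)).
  apply: (@integrable_bounded _ _ _ _ _ _ (M ^+ 3)) => // w _.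
  by rewrite normrX normr_id lerXn2r ?nnegrE// (le_trans _ (UM w)).
have ic c : P.-integrable setT (EFin \o (fun=> c)).
  by apply: (@integrable_bounded _ _ _ _ _ _ `|c|).
have iF := integrable_shift x mU f01.
pose r w := f (x + U w) - f x - f1 * U w - f2 / 2 * U w ^+ 2.
have i1 := integrable_sub iF (ic (f x)).
have iU' := integrable_scale f1 iU.
have iU2' := integrable_scale (f2 / 2) iU2.
have i2 := integrable_sub i1 iU'.
have ir : P.-integrable setT (EFin \o r) := integrable_sub i2 iU2'.
have e1 : Rintegral P setT r = smean U f x - f x - h ^+ 2 / 2 * f2.
  rewrite /r (RintegralB measurableT i2 iU2') (RintegralB measurableT i1 iU').
  rewrite (RintegralB measurableT iF (ic (f x))) (RintegralZl f1 measurableT iU).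
  rewrite (RintegralZl (f2 / 2) measurableT iU2) U1 U2 Rintegral_cst1 /smean; ring.
have e2 : `|Rintegral P setT r| <= C * Rintegral P setT (fun w => `|U w| ^+ 3).
  apply: (le_trans (le_normr_Rintegral measurableT ir)).
  rewrite -(RintegralZl C measurableT iU3); apply: le_Rintegral => //.
  - exact: (@integrable_norm _ _ _ _ setT r ir).
  - exact: integrable_scale.
  - by move=> w _; rewrite /r [X in `|X|](_ : _ = f (x + U w) - f x - U w * f1 - U w ^+ 2 / 2 * f2) ?T1//; field.
have := T1 h; have := T1 (- h); rewrite normrN (ger0_norm h0) => t2 t1.
have -> : smean U f x - avg h f x = Rintegral P setT r -
  ((f (x + h) - f x - h * f1 - h ^+ 2 / 2 * f2) +
   (f (x + - h) - f x - - h * f1 - (- h) ^+ 2 / 2 * f2)) / 2.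
  by rewrite e1 /avg; field.
rewrite (le_trans (ler_normB _ _))// mulrDr lerD// normrM [`|2^-1|]ger0_norm//.
move: t1 t2; set a := _ - _ - _ - _; set b := _ - _ - _ - _ => t1 t2.
have := ler_normD a b; lra.
Qed.

Lemma lindeberg_tail U f (a s h C M : R) n : measurable_fun setT U -> unit_valued f ->
  (forall x, a <= x -> 1 <= f x) ->
  (forall x, exists f1 f2 : R, forall u,
    `|f (x + u) - f x - u * f1 - u ^+ 2 / 2 * f2| <= C * `|u| ^+ 3) ->
  (forall w, `|U w| <= M) ->
  Rintegral P setT U = 0 -> Rintegral P setT (fun w => U w ^+ 2) = h ^+ 2 ->
  0 < a -> 0 < s -> 0 < h -> n%:R * h ^+ 2 = s ^+ 2 -> (a + 2 * s) ^+ 3 * h <= s ^+ 4 ->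
  tail_low (a / s) - C * (n%:R * Rintegral P setT (fun w => `|U w| ^+ 3) + n%:R * h ^+ 3)
    <= iter n (smean U) f 0.
Proof.
move=> mU f01 f1 fT UM U1 U2 a0 s0 h0 nh hs.
have H := @iter_avg_tail _ f a s h n a0 s0 h0 nh hs (fun x => proj1 (andP (f01.2 x))) f1.
have hd y : `|smean U f y - avg h f y| <= C * (Rintegral P setT (fun w => `|U w| ^+ 3) + h ^+ 3).
  have [g1 [g2 T1]] := fT y.
  by apply: (smean_avg_taylor mU f01 UM T1 U1 _ U2); exact: ltW.
have := telescoping n 0 mU f01 hd.
rewrite ler_norml => /andP[H2 _].
rewrite -[n%:R * _ + n%:R * _]mulrDr [C * (n%:R * _)]mulrCA; lra.
Qed.

End shift_mean.

Section sums_of_increments.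
Context {R : realType} {dT dV : measure_display} {T : measurableType dT} {V : measurableType dV}.
Variables (P : probability T R) (n : nat) (Z : 'I_n -> T -> V) (Z0 : T -> V) (g : V -> R).
Hypotheses (mZ : forall i, measurable_fun setT (Z i)) (mZ0 : measurable_fun setT Z0).
Hypotheses (mg : measurable_fun setT g) (indZ : mutually_indep P Z).
Hypothesis lawZ : forall i B, measurable B -> P (Z i @^-1` B) = P (Z0 @^-1` B).

Lemma mean_partial_sumS (j : 'I_n) (phi : R -> R) : unit_valued phi ->
  Rintegral P setT (fun w => phi (partial_sum Z g j.+1 w)) =
  Rintegral P setT (fun w => smean P (g \o Z0) phi (partial_sum Z g j w)).
Proof.
move=> p01; have [mp b01] := p01.
pose F (u : R * V) := (phi (u.1 + g u.2))%:E.
have mF : measurable_fun setT F.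
  apply/measurable_EFinP; apply: (measurableT_comp mp).
  by apply: measurable_funD => //; exact: (measurableT_comp mg).
have F0 u : (0 <= F u)%E by rewrite lee_fin; have /andP[] := b01 (u.1 + g u.2).
rewrite /Rintegral; congr fine.
under eq_integral do rewrite partial_sumS.
rewrite (indep_integral (measurable_partial_sum mZ mg j) (mZ j) mF F0 (indep_partial_sum mZ mg indZ j)).
apply: eq_integral => w _.
have -> : smean P (g \o Z0) phi (partial_sum Z g j w) =
    Rintegral P setT ((fun v => phi (partial_sum Z g j w + g v)) \o Z j).
  symmetry; apply: (@Rintegral_pushforward_eq _ _ _ _ _ _ _ _ _ 1) => //.
  - exact: (measurableT_comp mp (measurable_shift _ mg)).
  - by move=> v; have /andP[h0 h1] := b01 (partial_sum Z g j w + g v); rewrite ger0_norm.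
  - by move=> B mB; exact: lawZ.
have I : P.-integrable setT (EFin \o ((fun v => phi (partial_sum Z g j w + g v)) \o Z j)).
  exact: (@integrable_shift _ _ _ P (g \o Z j) phi (partial_sum Z g j w)
    (measurableT_comp mg (mZ j)) p01).
by rewrite /Rintegral fineK//; exact: (integrable_fin_num measurableT I).
Qed.

Lemma mean_sum_smean (phi : R -> R) : unit_valued phi ->
  Rintegral P setT (fun w => phi (\sum_(i < n) g (Z i w))) = iter n (smean P (g \o Z0)) phi 0.
Proof.
(* The test function must vary: integrating out the last variable replaces [psi] by
   [smean P (g \o Z0) psi]. *)
have E j psi : (j <= n)%N -> unit_valued psi ->
    Rintegral P setT (fun w => psi (partial_sum Z g j w)) = iter j (smean P (g \o Z0)) psi 0.
  elim: j psi => [|j IH] psi jn p01.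
    rewrite (_ : (fun w => _) = fun=> psi 0) ?Rintegral_cst1//.
    by apply/funext => w; rewrite /partial_sum big_pred0.
  rewrite (mean_partial_sumS (Ordinal jn))// iterSr -IH//; first exact: ltnW.
  exact: (smean_unit_valued _ (measurableT_comp mg mZ0) p01).
move=> p01; rewrite -E//; congr Rintegral; apply/funext => w.
by congr phi; rewrite /partial_sum; apply: eq_bigl => i; rewrite ltn_ord.
Qed.

End sums_of_increments.

(** * Jumps of cadlag paths *)

Section vector_norm.
Context {R : realType} {d : nat}.
Implicit Types u v w y : d.-tuple R.

Lemma vnorm_add_le u v : vnorm (vadd u v) <= vnorm u + vnorm v.
Proof.
rewrite -(@ler_pXn2r _ 2)// ?nnegrE ?addr_ge0 ?vnorm_ge0//.
rewrite -dotvv dotv_addl !(dotvC _ (vadd _ _)) !dotv_addl !dotvv sqrrD.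
have := le_trans (ler_norm _) (dotv_le u v); rewrite (dotvC v u); lra.
Qed.

Lemma vnorm_subC u v : vnorm (vsub u v) = vnorm (vsub v u).
Proof. by congr Num.sqrt; apply: eq_bigr => i _; rewrite !tnth_mktuple -sqrrN opprB. Qed.

Lemma vnorm_sub_trans u v w : vnorm (vsub u w) <= vnorm (vsub u v) + vnorm (vsub v w).
Proof.
rewrite (_ : vsub u w = vadd (vsub u v) (vsub v w)); first exact: vnorm_add_le.
by apply: eq_from_tnth => i; rewrite !tnth_mktuple; ring.
Qed.

Lemma vnorm_near (T : Type) (F : set_system T) (FF : Filter F) (f : T -> d.-tuple R) y :
  (forall i, tnth (f x) i @[x --> F] --> tnth y i) ->
  forall e, 0 < e -> \forall x \near F, vnorm (vsub (f x) y) < e.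
Proof.
move=> fy e e0.
have d0 : 0 < d%:R + 1 :> R by rewrite ltr_wpDl.
have H : \forall x \near F, forall i, `|tnth (f x) i - tnth y i| < e / (d%:R + 1).
  apply: filter_forall => i; move/cvgrPdistC_lt: (fy i); apply; exact: divr_gt0.
near=> x.
apply: (le_lt_trans (vnorm_le_sum _)).
apply: (@le_lt_trans _ _ (\sum_(i < d) e / (d%:R + 1))).
  apply: ler_sum => i _; rewrite tnth_mktuple ltW//.
  by move: i; near: x.
rewrite sumr_const card_ord -[ltLHS]mulr_natr mulrAC -mulrA gtr_pMr// ltr_pdivrMr// mul1r ltrDl//.
Unshelve. all: by end_near. Qed.

End vector_norm.

Section cadlag_paths.
Context {R : realType} {d : nat}.
Variable f : R -> d.-tuple R.
Hypothesis fc : cadlag f.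
Implicit Types (s t u a b eta : R) (l : seq R).

Definition left_limit s : d.-tuple R := [tuple lim (tnth (f u) i @[u --> s^'-]) | i < d].
(** For the path of [X] at [w] this is convertible to [jump X s w]. *)
Definition path_jump s : d.-tuple R := vsub (f s) (left_limit s).

Lemma cadlag_right s e : 0 <= s -> 0 < e ->
  exists r, 0 < r /\ forall u, s <= u < s + r -> vnorm (vsub (f u) (f s)) < e.
Proof.
move=> s0 e0.
have := vnorm_near _ (fun i => (fc i).1 s s0) e0.
move=> /(_ _)/nbhs_ballP[r /= r0 H]; exists r; split => // u /andP[su ur].
move: su; rewrite le_eqVlt => /orP[/eqP<-|su].
  have -> : vsub (f s) (f s) = vzero.
    by apply: eq_from_tnth => i; rewrite !tnth_mktuple subrr.
  by rewrite vnorm0.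
by apply: H => //; rewrite /ball/= ltr_distlC; apply/andP; split; lra.
Qed.

Lemma cadlag_left s e : 0 < s -> 0 < e ->
  exists r, 0 < r /\ forall u, s - r < u < s -> vnorm (vsub (f u) (left_limit s)) < e.
Proof.
move=> s0 e0.
have H0 i : tnth (f u) i @[u --> s^'-] --> tnth (left_limit s) i.
  by rewrite tnth_mktuple; exact: ((fc i).2 s s0).
have := vnorm_near _ H0 e0.
move=> /(_ _)/nbhs_ballP[r /= r0 H]; exists r; split => // u /andP[su ur].
by apply: H => //; rewrite /ball/= ltr_distlC; apply/andP; split; lra.
Qed.

Definition small_increments l t eta := forall a b, 0 <= a -> a < b -> b <= t ->
  (forall p, p \in l -> ~~ (a < p <= b)) -> vnorm (vsub (f b) (f a)) < eta.

(** Supremum argument: the left limit at the supremum [m] shows that [m] itself is reached, and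
    right continuity would push past [m] if [m < t]. *)
Lemma cadlag_partition t eta : 0 <= t -> 0 < eta -> exists l, small_increments l t eta.
Proof.
move=> t0 eta0.
pose E := [set s | 0 <= s <= t /\ exists l, small_increments l s eta].
have eta2 : 0 < eta / 2 by rewrite divr_gt0.
have E0 : E 0.
  split; first by rewrite lexx.
  by exists [::] => a b a0 ab b0; have := lt_le_trans (le_lt_trans a0 ab) b0; rewrite ltxx.
have supE : has_sup E.
  by split; [exists 0|exists t => s [/andP[]]].
pose m := sup E.
have m0 : 0 <= m by exact: sup_upper_bound.
have mt : m <= t by apply: sup_le_ub; [exists 0|move=> s [/andP[]]].
have Em : E m.
  split; first by rewrite m0.
  have [->|mn0] := eqVneq m 0; first exact: E0.2.
  have mp : 0 < m by rewrite lt_neqAle eq_sym mn0.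
  have [r [r0 Hr]] := cadlag_left mp eta2.
  have [s Es] := sup_adherent r0 supE; rewrite -/m => ms.
  have sm : s <= m by exact: sup_upper_bound.
  case: (Es) => /andP[s0 st] [l Hl].
  exists [:: m, s & l] => a b a0 ab bm Hp.
  have am : a < m by exact: lt_le_trans bm.
  have bltm : b < m.
    rewrite lt_neqAle bm andbT; apply/eqP => bE.
    by have := Hp m; rewrite inE eqxx bE am lexx => /(_ isT).
  have [bs|sb] := leP b s.
    by apply: Hl => // p pl; apply: Hp; rewrite !inE pl !orbT.
  have sa : s <= a.
    rewrite leNgt; apply/negP => as_.
    by have := Hp s; rewrite !inE eqxx orbT as_ (ltW sb) => /(_ isT).
  apply: (le_lt_trans (vnorm_sub_trans _ (left_limit m) _)).
  have h1 : vnorm (vsub (f b) (left_limit m)) < eta / 2 by apply: Hr; apply/andP; split; lra.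
  have : vnorm (vsub (f a) (left_limit m)) < eta / 2 by apply: Hr; apply/andP; split; lra.
  rewrite vnorm_subC; lra.
have [tm|mt'] := leP t m.
  have -> : t = m by apply/eqP; rewrite eq_le tm mt.
  exact: Em.2.
have [r [r0 Hr]] := cadlag_right m0 eta2.
pose s := Num.min t (m + r / 2).
have ms : m < s by rewrite /s lt_min mt' ltrDl divr_gt0.
have st : s <= t by rewrite /s ge_min lexx.
have sr : s < m + r.
  by rewrite /s gt_min; apply/orP; right; rewrite ltrD2l; lra.
suff : E s by move/(sup_upper_bound supE); rewrite leNgt ms.
split; first by rewrite st andbT; lra.
case: Em => _ [l Hl]; exists (m :: l) => a b a0 ab bs Hp.
have [bm|mb] := leP b m.
  by apply: Hl => // p pl; apply: Hp; rewrite inE pl orbT.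
have ma : m <= a.
  rewrite leNgt; apply/negP => am.
  by have := Hp m; rewrite inE eqxx am (ltW mb) => /(_ isT).
apply: (le_lt_trans (vnorm_sub_trans _ (f m) _)).
have h1 : vnorm (vsub (f b) (f m)) < eta / 2 by apply: Hr; apply/andP; split; lra.
have : vnorm (vsub (f a) (f m)) < eta / 2 by apply: Hr; apply/andP; split; lra.
rewrite (vnorm_subC (f a)); lra.
Qed.

(** A jump at a time [s] outside [l] is a limit of increments over intervals (u, s] free of points
    of [l], so its norm is at most [eta]. *)
Lemma cadlag_jump_times t eta : 0 <= t -> 0 < eta -> exists l,
  [/\ uniq l, forall p, p \in l -> 0 < p <= t, small_increments l t eta &
   forall s, 0 < s <= t -> eta < vnorm (path_jump s) -> s \in l].
Proof.
move=> t0 eta0; have [l0 Hl] := cadlag_partition t0 eta0.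
pose l := undup [seq p <- l0 | 0 < p <= t].
have lE p : p \in l = (0 < p <= t) && (p \in l0) by rewrite mem_undup mem_filter.
have Hl' : small_increments l t eta.
  move=> a b a0 ab bt Hp; apply: Hl => // p pl; apply/negP => /andP[ap pb].
  have : p \in l by rewrite lE pl andbT (le_trans pb bt) andbT (le_lt_trans a0 ap).
  by move=> /Hp; rewrite ap pb.
exists l; split => //.
- exact: undup_uniq.
- by move=> p; rewrite lE => /andP[].
move=> s /andP[s0 st] js; apply: contraT => sl.
have e0 : 0 < vnorm (path_jump s) - eta by lra.
have [r [r0 Hr]] := cadlag_left s0 e0.
(* a point of (s - r, s) beyond the points of [l] smaller than [s] *)
pose q := \big[Num.max/Num.max 0 (s - r)]_(p <- l | p < s) p.
have qs : q < s.
  by rewrite /q; elim/big_ind: _ => //; [rewrite gt_max s0/=; lra|move=> x y xs ys; rewrite gt_max xs ys].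
pose u := (q + s) / 2.
have us : u < s by rewrite /u; lra.
have qu : q < u by rewrite /u; lra.
have q0 : Num.max 0 (s - r) <= q by exact: bigmax_ge_id.
have [q1 q2] : 0 <= q /\ s - r <= q by move: q0; rewrite ge_max => /andP[].
have u0 : 0 <= u by lra.
have small : vnorm (vsub (f s) (f u)) < eta.
  apply: Hl' => // p pl; apply/negP => /andP[up ps].
  have ps' : p < s.
    by rewrite lt_neqAle ps andbT; apply: contraNneq sl => <-.
  have : p <= q by rewrite /q; exact: (bigmax_sup_seq _ p (fun p => p < s) p id pl ps').
  lra.
have := vnorm_sub_trans (f s) (f u) (left_limit s).
have : vnorm (vsub (f u) (left_limit s)) < vnorm (path_jump s) - eta.
  by apply: Hr; apply/andP; split; lra.
rewrite -/(path_jump s); lra.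
Qed.

End cadlag_paths.

Lemma near_all_seq (T : Type) (F : set_system T) (FF : Filter F) (I : eqType)
    (l : seq I) (Q : I -> T -> Prop) :
  (forall p, p \in l -> \forall x \near F, Q p x) ->
  \forall x \near F, forall p, p \in l -> Q p x.
Proof.
elim: l => [_|p l IH H]; first by apply: nearW => x p; rewrite in_nil.
have H1 := H p (mem_head _ _).
have H2 := IH (fun q ql => H q (mem_behead (s := p :: l) ql)).
near=> x => q; rewrite inE => /orP[/eqP->|]; first by near: x.
by move: q; near: x.
Unshelve. all: by end_near. Qed.

(** * From sums over grid increments to sums over jumps *)

Section jump_sums.
Context {R : realType} {d : nat}.
Variables (f : R -> d.-tuple R) (t : R).
Hypotheses (fc : cadlag f) (t0 : 0 < t).
Implicit Types (y : d.-tuple R) (g : d.-tuple R -> R) (n k : nat).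

Definition grid n k : R := k%:R * (t / n.+1%:R).

Lemma gridS n k : grid n k.+1 = grid n k + t / n.+1%:R.
Proof. by rewrite /grid -[k.+1%:R]natr1 mulrDl mul1r. Qed.

Lemma grid_end n : grid n n.+1 = t.
Proof. by rewrite /grid mulrCA divff ?mulr1// gt_eqF. Qed.

Lemma grid_ge0 n k : 0 <= grid n k.
Proof. by rewrite mulr_ge0// divr_ge0// ltW. Qed.

Lemma ltr_gridS n k : grid n k < grid n k.+1.
Proof. by rewrite gridS ltrDl divr_gt0. Qed.

Lemma ler_grid n k j : (k <= j)%N -> grid n k <= grid n j.
Proof. by move=> kj; rewrite ler_pM2r ?divr_gt0// ler_nat. Qed.

Definition cell n k p := grid n k < p <= grid n k.+1.

Lemma cell_exists n p : 0 < p <= t -> exists k : 'I_n.+1, cell n k p.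
Proof.
move=> /andP[p0 pt].
have ex : exists k, p <= grid n k.+1 by exists n; rewrite grid_end.
have [k pk kmin] := ex_minnP ex.
have kn : (k < n.+1)%N by rewrite ltnS; apply: kmin; rewrite grid_end.
exists (Ordinal kn); rewrite /cell /= pk andbT.
case: k pk kmin kn => [|k] pk kmin kn; first by rewrite /grid mul0r.
rewrite ltNge; apply/negP => /kmin; rewrite ltnn //.
Qed.

Lemma cell_uniq n k j p : cell n k p -> cell n j p -> k = j.
Proof.
move=> /andP[k1 k2] /andP[j1 j2]; apply/eqP; rewrite eqn_leq; apply/andP; split.
  rewrite leqNgt; apply/negP => jk.
  by have := lt_le_trans k1 (le_trans j2 (ler_grid n jk)); rewrite ltxx.
rewrite leqNgt; apply/negP => kj.
by have := lt_le_trans j1 (le_trans k2 (ler_grid n kj)); rewrite ltxx.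
Qed.

Definition increment n k : d.-tuple R := vsub (f (grid n k.+1)) (f (grid n k)).

Definition vcontinuous g := forall y e, 0 < e ->
  exists r, 0 < r /\ forall y', vnorm (vsub y' y) < r -> `|g y' - g y| < e.

Lemma near_time_step r : 0 < r -> \forall n \near \oo, t / n.+1%:R < r.
Proof.
move=> r0; near=> n; rewrite ltr_pdivrMr// -ltr_pdivrMl//.
by rewrite -[n.+1%:R]natr1 ltr_pwDr//; near: n; exact: nbhs_infty_ger.
Unshelve. all: by end_near. Qed.

(** Cells are open on the left and closed on the right: the left end of the cell of [p] approaches
    [p] strictly from below, the right end from above or at [p]. *)
Lemma cvg_cell_increment g p : vcontinuous g -> 0 < p <= t ->
  \sum_(k < n.+1) (if cell n k p then g (increment n k) else 0) @[n --> \oo]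
    --> g (path_jump f p).
Proof.
move=> gc pt; have /andP[p0 _] := pt.
apply/cvgrPdistC_lt => e e0.
have [r [r0 Hr]] := gc (path_jump f p) e e0.
have r2 : 0 < r / 2 by rewrite divr_gt0.
have [r1 [r10 H1]] := cadlag_right fc (ltW p0) r2.
have [r3 [r30 H3]] := cadlag_left fc p0 r2.
near=> n.
have [k kp] := cell_exists n pt.
rewrite (bigD1 k)//= kp big1 ?addr0; last first.
  move=> j jk; case: ifP => // jp; move: jk.
  by rewrite (val_inj (cell_uniq jp kp)) eqxx.
apply: Hr; rewrite /increment /path_jump.
move: kp; rewrite /cell gridS => /andP[k1 k2].
set a := grid n k in k1 k2 *.
have n1 : t / n.+1%:R < r1 by near: n; exact: near_time_step.
have n3 : t / n.+1%:R < r3 by near: n; exact: near_time_step.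
move: k1 k2 n1 n3; set tau := t / n.+1%:R => k1 k2 n1 n3.
have d1 : vnorm (vsub (f (a + tau)) (f p)) < r / 2 by apply: H1; apply/andP; split; lra.
have d2 : vnorm (vsub (f a) (left_limit f p)) < r / 2 by apply: H3; apply/andP; split; lra.
rewrite (_ : vsub (vsub (f (a + tau)) (f a)) (vsub (f p) (left_limit f p)) =
   vadd (vsub (f (a + tau)) (f p)) (vsub (left_limit f p) (f a))); last first.
  by apply: eq_from_tnth => i; rewrite !tnth_mktuple; ring.
apply: (le_lt_trans (vnorm_add_le _ _)); rewrite (vnorm_subC (left_limit _ _)); lra.
Unshelve. all: by end_near. Qed.

Lemma cvg_sum_seq (I : eqType) (l : seq I) (u : I -> nat -> R) (a : I -> R) :
  (forall i, i \in l -> u i n @[n --> \oo] --> a i) ->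
  \sum_(i <- l) u i n @[n --> \oo] --> \sum_(i <- l) a i.
Proof.
elim: l => [|i l IH] ua.
  by rewrite big_nil; under eq_fun do rewrite big_nil; exact: cvg_cst.
rewrite big_cons; under eq_fun do rewrite big_cons.
apply: cvgD; first by apply: ua; exact: mem_head.
by apply: IH => j jl; apply: ua; rewrite inE jl orbT.
Qed.

(** Cells missing [l] have increments below [eta], where [g] vanishes. *)
Lemma cvg_jump_sum g eta l : vcontinuous g -> uniq l -> (forall p, p \in l -> 0 < p <= t) ->
  small_increments f l t eta -> (forall y, vnorm y < eta -> g y = 0) ->
  \sum_(k < n.+1) g (increment n k) @[n --> \oo] --> \sum_(p <- l) g (path_jump f p).
Proof.
move=> gc lu lt lsmall g0.
have H : \sum_(p <- l) \sum_(k < n.+1) (if cell n k p then g (increment n k) else 0)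
    @[n --> \oo] --> \sum_(p <- l) g (path_jump f p).
  by apply: cvg_sum_seq => p pl; apply: cvg_cell_increment => //; exact: lt.
apply: cvg_trans H; apply: near_eq_cvg.
(* For a fine mesh no cell contains two points of [l], so the sum over cells can be reindexed by
   [l]. *)
have sep : \forall n \near \oo, forall p, p \in l -> forall q, q \in l -> p != q ->
    t / n.+1%:R < `|p - q|.
  apply: near_all_seq => p pl; apply: near_all_seq => q ql.
  have [->|pq] := eqVneq p q; first by apply: nearW => n.
  near=> n => _; near: n; apply: near_time_step.
  by rewrite normr_gt0 subr_eq0.
near=> n.
have sepn : forall p, p \in l -> forall q, q \in l -> p != q -> t / n.+1%:R < `|p - q|.
  by near: n.
rewrite exchange_big; apply: eq_bigr => k _ /=.
have [/hasP[p pl kp]|/hasPn no] := boolP (has (cell n k) l).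
  rewrite (bigD1_seq p)//= kp big1_seq ?addr0// => q /andP[qp ql].
  case: ifP => // kq; have := sepn p pl q ql; rewrite eq_sym qp => /(_ isT).
  move: kp kq; rewrite /cell gridS => /andP[k1 k2] /andP[k3 k4].
  move: k1 k2 k3 k4; set tau := t / n.+1%:R => k1 k2 k3 k4.
  by rewrite ltNge ler_norml => /negP; case; apply/andP; split; lra.
rewrite big1_seq; last by move=> p /andP[_ pl]; rewrite (negbTE (no p pl)).
rewrite g0//; apply: lsmall; [exact: grid_ge0|exact: ltr_gridS| |].
  by rewrite -[leRHS](grid_end n); apply: ler_grid.
exact: no.
Unshelve. all: by end_near. Qed.

End jump_sums.

(** * Truncated projections of the jumps *)

Section cutoff_function.
Context {R : realType}.
Implicit Types (eps b r : R) (M : nat).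

(* In the variable [r = |y|^2], a Lipschitz approximation of the indicator of
   (eps^2, b^2], converging pointwise even at [r = b^2], which [Pi] may charge. *)
Definition cutoff eps b M r :=
  clip 0 1 (M.+1%:R * (r - eps ^+ 2)) * clip 0 1 (1 + M.+1%:R * (b ^+ 2 - r)).

Lemma clip01 (x : R) : 0 <= clip 0 1 x <= 1.
Proof. exact: clip_bounds. Qed.

Lemma clip01_eq0 (x : R) : x <= 0 -> clip 0 1 x = 0.
Proof. by move=> x0; rewrite /clip max_r// min_l. Qed.

Lemma clip01_eq1 (x : R) : 1 <= x -> clip 0 1 x = 1.
Proof. by move=> x1; rewrite /clip max_l ?min_r//; apply: le_trans x1. Qed.

Lemma cutoff01 eps b M r : 0 <= cutoff eps b M r <= 1.
Proof.
have /andP[a0 a1] := clip01 (M.+1%:R * (r - eps ^+ 2)).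
have /andP[c0 c1] := clip01 (1 + M.+1%:R * (b ^+ 2 - r)).
by rewrite /cutoff mulr_ge0//= mulr_ile1.
Qed.

Lemma cutoff_small eps b M r : r <= eps ^+ 2 -> cutoff eps b M r = 0.
Proof. by move=> re; rewrite /cutoff clip01_eq0 ?mul0r// mulr_ge0_le0// subr_le0. Qed.

Lemma cutoff_large eps b M r : 0 < b <= 1 -> 2 <= r -> cutoff eps b M r = 0.
Proof.
move=> /andP[b0 b1] r2; rewrite /cutoff [X in _ * X]clip01_eq0 ?mulr0//.
have M1 : 1 <= M.+1%:R :> R by rewrite ler1n.
have b2 : b ^+ 2 <= 1 by rewrite exprn_ile1// ltW.
set K := M.+1%:R in M1 *; nra.
Qed.

Lemma lipb_clip_affine (c e : R) : lipb (fun r => clip 0 1 (c * r + e)).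
Proof.
exists (`|c| + 1); split=> [|x y|x].
- by rewrite ltr_wpDl.
- rewrite (le_trans (clip_lip _ _ _ _))//.
  have -> : c * x + e - (c * y + e) = c * (x - y) by ring.
  by rewrite normrM ler_wpM2r// lerDl.
- by have /andP[h0 h1] := clip01 (c * x + e); rewrite ger0_norm// (le_trans h1)// lerDr.
Qed.

Lemma lipb_cutoff eps b M : lipb (cutoff eps b M).
Proof.
apply: lipb_mul.
  rewrite (_ : (fun x => _) = (fun r => clip 0 1 (M.+1%:R * r + (- (M.+1%:R * eps ^+ 2))))).
    exact: lipb_clip_affine.
  by apply/funext => r; rewrite mulrBr.
rewrite (_ : (fun x => _) = (fun r => clip 0 1 (- M.+1%:R * r + (1 + M.+1%:R * b ^+ 2)))).
  exact: lipb_clip_affine.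
by apply/funext => r; congr clip; ring.
Qed.

Lemma near_nat_mul_ge1 (u : R) : 0 < u -> \forall M \near \oo, 1 <= M.+1%:R * u.
Proof.
move=> u0; near=> M; rewrite -ler_pdivrMr// div1r.
apply: (@le_trans _ _ M%:R); last by rewrite ler_nat.
by near: M; exact: nbhs_infty_ger.
Unshelve. all: by end_near. Qed.

Lemma cvg_cutoff eps b r : cutoff eps b M r @[M --> \oo] -->
  (if (eps ^+ 2 < r) && (r <= b ^+ 2) then 1 else 0 : R).
Proof.
apply: cvg_near_cst; have [re|re] := leP r (eps ^+ 2).
  by apply: nearW => M; rewrite cutoff_small.
have [rb|rb] /= := leP r (b ^+ 2).
  near=> M; rewrite /cutoff [X in _ * X]clip01_eq1; last by rewrite lerDl mulr_ge0// subr_ge0.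
  rewrite mulr1 clip01_eq1//; near: M; apply: near_nat_mul_ge1; rewrite subr_gt0//.
near=> M; rewrite /cutoff [X in _ * X]clip01_eq0 ?mulr0//.
suff : 1 <= M.+1%:R * (r - b ^+ 2) by rewrite -opprB mulrN; lra.
by near: M; apply: near_nat_mul_ge1; rewrite subr_gt0.
Unshelve. all: by end_near. Qed.

End cutoff_function.

Section cutoff_projection.
Context {R : realType} {d : nat}.
Variables (z : d.-tuple R) (eps b : R).
Hypotheses (z1 : vnorm z <= 1) (eps0 : 0 < eps) (eps1 : eps <= 1) (b01 : 0 < b <= 1).
Implicit Types (y : d.-tuple R) (M : nat).

Definition cproj M y := dotv z y * cutoff eps b M (vnorm y ^+ 2).

Let inv_clip r : R := (clip (eps ^+ 2) 2 r)^-1.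

Let e2 : 0 < eps ^+ 2 <= 2.
Proof. by rewrite exprn_gt0//= (@le_trans _ _ 1) ?ler1n// exprn_ile1// ltW. Qed.

Lemma cutoff_div M r : r * (cutoff eps b M r * inv_clip r) = cutoff eps b M r.
Proof.
have [re|re] := leP r (eps ^+ 2); first by rewrite cutoff_small// mul0r mulr0.
have [r2|r2] := leP 2 r; first by rewrite cutoff_large// mul0r mulr0.
rewrite /inv_clip clip_id; last by rewrite !ltW.
by rewrite mulrCA divff ?mulr1// gt_eqF// (lt_trans _ re)//; case/andP: e2.
Qed.

(* With these profiles, [cproj], its square and [|y|^3] times the cubed cutoff are
   of the form [radial z k H], for which the small-time limit is known; clipping
   only serves to make them Lipschitz. *)
Definition profile1 M r := cutoff eps b M r * inv_clip r.
Definition profile2 M r := cutoff eps b M r * (cutoff eps b M r * inv_clip r).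
Definition profile3 M r := cutoff eps b M r ^+ 3 * Num.sqrt (clip (eps ^+ 2) 2 r).

Lemma lipb_profile1 M : lipb (profile1 M).
Proof. by apply: lipb_mul; [exact: lipb_cutoff|exact: lipb_clip_inv]. Qed.

Lemma lipb_profile2 M : lipb (profile2 M).
Proof. by apply: lipb_mul; [exact: lipb_cutoff|exact: lipb_profile1]. Qed.

Lemma lipb_profile3 M : lipb (profile3 M).
Proof. by apply: lipb_mul; [apply: lipb_exp; exact: lipb_cutoff|exact: lipb_clip_sqrt]. Qed.

Lemma profile1_large M r : 2 <= r -> profile1 M r = 0.
Proof. by move=> r2; rewrite /profile1 cutoff_large// mul0r. Qed.

Lemma profile2_large M r : 2 <= r -> profile2 M r = 0.
Proof. by move=> r2; rewrite /profile2 cutoff_large// mul0r. Qed.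

Lemma profile3_large M r : 2 <= r -> profile3 M r = 0.
Proof. by move=> r2; rewrite /profile3 cutoff_large// expr0n mul0r. Qed.

Lemma radial_profile1 M y : radial z 1 (profile1 M) y = cproj M y.
Proof. by rewrite /radial expr1 cutoff_div. Qed.

Lemma radial_profile2 M y : radial z 2 (profile2 M) y = cproj M y ^+ 2.
Proof. by rewrite /radial /profile2 (mulrCA (vnorm y ^+ 2)) cutoff_div exprMn -expr2. Qed.

Lemma radial_profile3 M y : radial z 0 (profile3 M) y = vnorm y ^+ 3 * cutoff eps b M (vnorm y ^+ 2) ^+ 3.
Proof.
rewrite /radial expr0 mul1r /profile3.
have [re|re] := leP (vnorm y ^+ 2) (eps ^+ 2).
  by rewrite cutoff_small// expr0n !mul0r !mulr0.
have [r2|r2] := leP 2 (vnorm y ^+ 2).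
  by rewrite cutoff_large// expr0n !mul0r !mulr0.
rewrite clip_id; last by rewrite !ltW.
by rewrite sqrtr_sqr ger0_norm ?vnorm_ge0//; ring.
Qed.

Lemma cproj_bounded M y : `|cproj M y| <= 2.
Proof.
have /andP[c0 c1] := cutoff01 eps b M (vnorm y ^+ 2).
have [r2|r2] := leP 2 (vnorm y ^+ 2).
  by rewrite /cproj cutoff_large// mulr0 normr0.
have vy2 : vnorm y <= 2 by have := vnorm_ge0 y; nra.
rewrite /cproj normrM -[leRHS]mulr1 ler_pM//; last by rewrite ger0_norm.
exact: le_trans (norm_dotv_le1 z1 y) vy2.
Qed.

Lemma cproj_small M y : vnorm y < eps -> cproj M y = 0.
Proof.
move=> ye; rewrite /cproj cutoff_small ?mulr0//.
by rewrite lerXn2r ?nnegrE ?vnorm_ge0// ltW.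
Qed.

(** This majorant has a form whose small-time mean is known, and loses only [|<z, y>| <= |y|], as
    the error term of the theorem allows. *)
Lemma cproj_cube M y : `|cproj M y| ^+ 3 <= radial z 0 (profile3 M) y.
Proof.
have /andP[c0 c1] := cutoff01 eps b M (vnorm y ^+ 2).
rewrite radial_profile3 /cproj normrM exprMn ler_pM ?exprn_ge0//.
  by rewrite lerXn2r ?nnegrE ?vnorm_ge0// norm_dotv_le1.
by rewrite ger0_norm.
Qed.

Lemma measurable_cproj M : measurable_fun setT (cproj M).
Proof.
rewrite (_ : cproj M = radial z 1 (profile1 M)); last by apply/funext => y; rewrite radial_profile1.
by apply: measurable_radial; exact: lipb_profile1.
Qed.

Lemma cproj_continuous M : vcontinuous (cproj M).
Proof.
have [L [L0 cL _]] := lipb_cutoff eps b M.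
move=> y e e0; pose K := 1 + vnorm y * (L * (2 * vnorm y + 1)).
have n0 := vnorm_ge0 y.
have K0 : 0 < K by rewrite /K ltr_wpDr// mulr_ge0// mulr_ge0 ?(ltW L0)//; lra.
exists (Num.min 1 (e / K)); split; first by rewrite lt_min ltr01 divr_gt0.
move=> y'; rewrite lt_min => /andP[yy1 yyK].
set v := vnorm (vsub y' y) in yy1 yyK.
have v0 : 0 <= v by exact: vnorm_ge0.
have vv : vnorm y' <= v + vnorm y.
  have := vnorm_add_le (vsub y' y) y; rewrite (_ : vadd _ y = y')//.
  by apply: eq_from_tnth => i; rewrite !tnth_mktuple subrK.
have vv' : vnorm y <= v + vnorm y'.
  have := vnorm_add_le (vsub y y') y'; rewrite (_ : vadd _ y' = y) 1?vnorm_subC//.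
  by apply: eq_from_tnth => i; rewrite !tnth_mktuple subrK.
have d1 : `|dotv z y' - dotv z y| <= v.
  rewrite !(dotvC z) -dotv_subl dotvC; exact: norm_dotv_le1.
have d2 : `|vnorm y' ^+ 2 - vnorm y ^+ 2| <= v * (2 * vnorm y + 1).
  have n0' := vnorm_ge0 y'.
  rewrite subr_sqr normrM ler_pM//; first by rewrite ler_norml; apply/andP; split; lra.
  by rewrite ger0_norm ?addr_ge0//; lra.
set c' := cutoff eps b M (vnorm y' ^+ 2); set c := cutoff eps b M (vnorm y ^+ 2).
have d3 : `|c' - c| <= L * (v * (2 * vnorm y + 1)).
  by apply: (le_trans (cL _ _)); rewrite ler_pM2l.
have /andP[c0 c1] := cutoff01 eps b M (vnorm y' ^+ 2).
rewrite /cproj -/c -/c'.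
have -> : dotv z y' * c' - dotv z y * c = (dotv z y' - dotv z y) * c' + dotv z y * (c' - c) by ring.
apply: (@le_lt_trans _ _ (v * K)); last by rewrite -ltr_pdivlMr.
rewrite (le_trans (ler_normD _ _))// !normrM.
have -> : v * K = v * 1 + vnorm y * (L * (v * (2 * vnorm y + 1))) by rewrite /K; ring.
by rewrite lerD// ler_pM// ?norm_dotv_le1// -normrM ger0_norm.
Qed.

End cutoff_projection.

Lemma Rintegral_conull d (T : measurableType d) (R : realType) (P : probability T R)
    (D : set T) (g : T -> R) :
  measurable D -> P (~` D) = 0%E -> P.-integrable setT (EFin \o g) ->
  Rintegral P setT g = Rintegral P D g.
Proof.
move=> mD D0 ig; rewrite /Rintegral; congr fine.
have := @negligible_integral _ _ _ P setT (~` D) _ (measurableC mD) measurableT ig D0.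
by rewrite setTD setCK.
Qed.

Lemma cvg_continuous (R : realType) (h : R -> R) (u : nat -> R) (l : R) :
  continuous h -> u n @[n --> \oo] --> l -> h (u n) @[n --> \oo] --> h l.
Proof. by move=> hc ul; apply: (@cvg_comp _ _ _ u h _ (nbhs l)) => //; exact: hc. Qed.

(** The limit variance must be positive for [a / sqrt] to be continuous; hence the positivity
    conditions on variances in the bounds below. *)
Lemma cvg_tail_low (R : realType) (a l : R) (u : nat -> R) : 0 < l ->
  u n @[n --> \oo] --> l ->
  tail_low (a / Num.sqrt (u n)) @[n --> \oo] --> tail_low (a / Num.sqrt l).
Proof.
move=> l0 ul.
have c1 : a / Num.sqrt (u n) @[n --> \oo] --> a / Num.sqrt l.
  apply: cvgM; first exact: cvg_cst.
  apply: cvgV; first by rewrite gt_eqF// sqrtr_gt0.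
  exact: (cvg_continuous (@sqrt_continuous R) ul).
apply: cvg_continuous c1 => w0.
rewrite (_ : (tail_low : R -> R) = fun w => expR (- ((w + 2) * (w + 2) / 2 + 2 * (w + 2) + 1)) / 2);
  last by apply/funext => w; rewrite /tail_low expr2.
rewrite /continuous_at.
apply: cvgM; last exact: cvg_cst.
apply: (@cvg_comp _ _ _ (fun w : R => - ((w + 2) * (w + 2) / 2 + 2 * (w + 2) + 1)) expR);
  last exact: continuous_expR.
have c2 : (w + 2) @[w --> w0] --> w0 + 2 by apply: cvgD; [exact: cvg_id|exact: cvg_cst].
apply: cvgN; apply: cvgD; last exact: cvg_cst.
apply: cvgD; last by apply: cvgM => //; exact: cvg_cst.
by apply: cvgM; [exact: cvgM|exact: cvg_cst].
Qed.

(** * The limit of the mesh at a fixed cutoff *)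

Section cutoff_level.
Context {R : realType} {d : nat} {dT : measure_display} {T : measurableType dT}.
Context (P : probability T R) (X : R -> T -> d.-tuple R) (gamma : d.-tuple R).
Context (Pi : {measure set (d.-tuple R) -> \bar R}).
Hypothesis XL : levy_process P X.
Hypothesis Xchar : char_triplet_nongauss P X gamma Pi.
Hypothesis Pi1 : Pi [set y | 1 < vnorm y] = 0%E.
Variables (t : R) (t0 : 0 < t) (D : set T) (mD : measurable D) (D0 : P (~` D) = 0%E).
Variables (z : d.-tuple R) (z1 : vnorm z <= 1) (b : R) (b01 : 0 < b <= 1).
Variables (f : R -> R) (a C : R) (a0 : 0 < a) (C0 : 0 <= C).
Hypotheses (f01 : unit_valued f) (fcont : continuous f) (fa : forall x, a <= x -> 1 <= f x).
Hypothesis fT : forall x, exists f1 f2 : R, forall u : R,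
    `|f (x + u) - f x - u * f1 - u ^+ 2 / 2 * f2| <= C * `|u| ^+ 3.

Let mX s : measurable_fun setT (X s). Proof. by case: XL. Qed.

Section fixed_cutoff.
Variables (eps : R) (eps0 : 0 < eps) (eps1 : eps <= 1) (M : nat).

Let G := cproj z eps b M.
Let mG : measurable_fun setT G. Proof. exact: measurable_cproj. Qed.
Let GX n w := G (X (t / n.+1%:R) w).
Let mGX n : measurable_fun setT (GX n). Proof. exact: (measurableT_comp mG (mX _)). Qed.

Let Gmean n := Rintegral P setT (GX n).
Let Gvar n := Rintegral P setT (fun w => GX n w ^+ 2) - Gmean n ^+ 2.
Let Gsum n w := \sum_(k < n.+1) G (increment (X ^~ w) t n k).

Let incr_indep n : mutually_indep P (fun (k : 'I_n.+1) w => increment (X ^~ w) t n k).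
Proof.
case: XL => _ _ H _ _; apply: H; first by rewrite /grid mul0r.
by move=> k _; exact: ltr_gridS.
Qed.

Let incr_law n (k : 'I_n.+1) B : measurable B ->
  P ((fun w => increment (X ^~ w) t n k) @^-1` B) = P (X (t / n.+1%:R) @^-1` B).
Proof.
move=> mB; case: XL => _ _ _ H _.
rewrite -(H (grid t n k) (t / n.+1%:R))//; last by rewrite divr_ge0// ltW.
  by rewrite /increment gridS.
exact: grid_ge0.
Qed.

Let measurable_incr n k : measurable_fun setT (fun w => increment (X ^~ w) t n k).
Proof. exact: measurable_vsub. Qed.

Let measurable_Gsum n : measurable_fun setT (Gsum n).
Proof. by apply: measurable_sum => k; exact: (measurableT_comp mG (measurable_incr n k)). Qed.

Let GX_bounded n w : `|GX n w| <= 2. Proof. exact: cproj_bounded. Qed.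

Let integrable_GX n : P.-integrable setT (EFin \o GX n).
Proof. by apply: (@integrable_bounded _ _ _ _ _ _ 2). Qed.

Let integrable_GX2 n : P.-integrable setT (EFin \o (fun w => GX n w ^+ 2)).
Proof.
apply: (@integrable_bounded _ _ _ _ _ _ (2 ^+ 2)) => //; first exact: measurable_funX.
by move=> w _; rewrite normrX lerXn2r ?nnegrE.
Qed.

Let integrable_cst c : P.-integrable setT (EFin \o (fun=> c)).
Proof. by apply: (@integrable_bounded _ _ _ _ _ _ `|c|). Qed.

Let centered_sum n w : \sum_(k < n.+1) (G (increment (X ^~ w) t n k) - Gmean n) =
  Gsum n w - n.+1%:R * Gmean n.
Proof. by rewrite sumrB sumr_const card_ord mulr_natl. Qed.

(** Convexity, [(u + v)^3 <= 4 u^3 + 4 v^3]. The mean is of order one over the number of cells, so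
    its cubes vanish after summation and only the first 4 survives. *)
Let centered_third_moment n :
  Rintegral P setT (fun w => `|GX n w - Gmean n| ^+ 3) <=
  4 * Rintegral P setT (fun w => radial z 0 (profile3 eps b M) (X (t / n.+1%:R) w)) + 4 * `|Gmean n| ^+ 3.
Proof.
have [L LP] := radial_bounded z1 (isT : (0 <= 2)%N) (lipb_profile3 b eps0 eps1 M) (@profile3_large _ eps b b01 M).
have i3 : P.-integrable setT (EFin \o (fun w => radial z 0 (profile3 eps b M) (X (t / n.+1%:R) w))).
  apply: (@integrable_bounded _ _ _ _ _ _ L) => //.
  by apply: (measurableT_comp _ (mX _)); apply: measurable_radial; exact: lipb_profile3.
have i4 := integrable_scale 4 i3.
rewrite -(RintegralZl 4 measurableT i3) -[X in _ + X](Rintegral_cst1 P).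
rewrite -RintegralD//; apply: le_Rintegral => //.
- apply: (@integrable_bounded _ _ _ _ _ _ ((2 + `|Gmean n|) ^+ 3)) => //.
    apply: measurable_funX; apply: (measurableT_comp (@normr_measurable R setT)).
    by apply: measurable_funB => //; exact: measurable_cst.
  move=> w _; rewrite normrX normr_id lerXn2r ?nnegrE ?addr_ge0//.
  by rewrite (le_trans (ler_normB _ _))// lerD2r.
- exact: (integrable_add i4 (integrable_cst _)).
move=> w _; apply: (@le_trans _ _ (4 * `|GX n w| ^+ 3 + 4 * `|Gmean n| ^+ 3)); last first.
  by rewrite lerD2r ler_pM2l// /GX cproj_cube.
apply: (@le_trans _ _ ((`|GX n w| + `|Gmean n|) ^+ 3)).
  by rewrite lerXn2r ?nnegrE ?addr_ge0// ler_normB.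
move: (normr_ge0 (GX n w)) (normr_ge0 (Gmean n)); set u := `|_|; set v := `|_| => u0 v0.
have : 0 <= (u + v) * (u - v) ^+ 2 by rewrite mulr_ge0 ?sqr_ge0// addr_ge0.
lra.
Qed.

Let level_n n : let h := Num.sqrt (Gvar n) in let s := Num.sqrt (n.+1%:R * Gvar n) in
  0 < Gvar n -> (a + 2 * s) ^+ 3 * h <= s ^+ 4 ->
  tail_low (a / s) - C * (n.+1%:R * (4 * Rintegral P setT (fun w => radial z 0 (profile3 eps b M) (X (t / n.+1%:R) w)) + 4 * `|Gmean n| ^+ 3) + n.+1%:R * h ^+ 3)
  <= Rintegral P D (fun w => f (Gsum n w - n.+1%:R * Gmean n)).
Proof.
move=> h s v0 hs.
have h0 : 0 < h by rewrite sqrtr_gt0.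
have nv0 : 0 < n.+1%:R * Gvar n by rewrite mulr_gt0.
have s0 : 0 < s by rewrite sqrtr_gt0.
have hE : h ^+ 2 = Gvar n by rewrite sqr_sqrtr// ltW.
have sE : n.+1%:R * h ^+ 2 = s ^+ 2 by rewrite hE sqr_sqrtr// ltW.
pose g y := G y - Gmean n.
have mg : measurable_fun setT g by apply: measurable_funB => //; exact: measurable_cst.
pose U w := g (X (t / n.+1%:R) w).
have mU : measurable_fun setT U by exact: (measurableT_comp mg (mX _)).
have UM w : `|U w| <= 2 + `|Gmean n|.
  by rewrite (le_trans (ler_normB _ _))// lerD2r; exact: GX_bounded.
have U1 : Rintegral P setT U = 0.
  rewrite (RintegralB measurableT (integrable_GX n) (integrable_cst (Gmean n))).
  by rewrite Rintegral_cst1 subrr.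
have U2 : Rintegral P setT (fun w => U w ^+ 2) = h ^+ 2.
  have i1 := integrable_scale (2 * Gmean n) (integrable_GX n).
  have i2 := integrable_sub (integrable_GX2 n) i1.
  rewrite (_ : (fun w => U w ^+ 2) = (fun w => GX n w ^+ 2 - 2 * Gmean n * GX n w + Gmean n ^+ 2)); last first.
    by apply/funext => w; rewrite /U /g /GX; ring.
  rewrite (RintegralD measurableT i2 (integrable_cst (Gmean n ^+ 2))).
  rewrite (RintegralB measurableT (integrable_GX2 n) i1).
  rewrite (RintegralZl _ measurableT (integrable_GX n)) Rintegral_cst1 hE /Gvar -/(Gmean n); ring.
have := lindeberg_tail mU f01 fa fT UM U1 U2 a0 s0 h0 sE hs.
have -> : iter n.+1 (smean P U) f 0 = Rintegral P D (fun w => f (Gsum n w - n.+1%:R * Gmean n)).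
  rewrite -(mean_sum_smean (fun k => measurable_incr n k) (mX (t / n.+1%:R)) mg (@incr_indep n)
    (@incr_law n) f01).
  under eq_fun do rewrite centered_sum.
  apply: Rintegral_conull => //.
  apply: (@integrable_bounded _ _ _ _ _ _ 1) => //.
    apply: (measurableT_comp f01.1); apply: measurable_funB => //; exact: measurable_cst.
  by move=> w _; have /andP[h1 h2] := f01.2 (Gsum n w - n.+1%:R * Gmean n); rewrite ger0_norm.
apply: le_trans; rewrite lerD2l lerN2 ler_wpM2l// lerD2r ler_wpM2l//.
exact: centered_third_moment.
Qed.

(** With [n] cells, [n Gmean] tends to the compensator and [n Gvar] to the variance, because
    [n Gmean^2] tends to 0. The term [n h^3] is [(n Gvar) sqrt Gvar] and vanishes too. *)
Lemma cutoff_level_bound (J : T -> R) :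
  (forall w, D w -> \sum_(k < n.+1) cproj z eps b M (increment (X ^~ w) t n k) @[n --> \oo] --> J w) ->
  0 < Rintegral Pi setT (fun y => cproj z eps b M y ^+ 2) ->
  measurable_fun D J /\
  tail_low (a / Num.sqrt (t * Rintegral Pi setT (fun y => cproj z eps b M y ^+ 2)))
    - C * (4 * (t * Rintegral Pi setT (radial z 0 (profile3 eps b M))))
  <= Rintegral P D (fun w => f (J w - t * Rintegral Pi setT (cproj z eps b M))).
Proof.
move=> SJ k20; rewrite -/G in SJ k20 *.
set k1 := Rintegral Pi setT G; set k2 := Rintegral Pi setT _ in k20 *.
set k3 := Rintegral Pi setT _.
have e1 : radial z 1 (profile1 eps b M) = G by apply/funext => y; exact: radial_profile1.
have e2 : radial z 2 (profile2 eps b M) = (fun y => G y ^+ 2) by apply/funext => y; exact: radial_profile2.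
have c1 : n.+1%:R * Gmean n @[n --> \oo] --> t * k1.
  have := @cvg_small_mean_radial _ _ _ _ P X gamma Pi mX Xchar Pi1 t t0 z 1 (profile1 eps b M) z1 isT
    (lipb_profile1 b eps0 eps1 M) (@profile1_large _ eps b b01 M).
  by rewrite e1.
have c2 : n.+1%:R * Rintegral P setT (fun w => GX n w ^+ 2) @[n --> \oo] --> t * k2.
  have := @cvg_small_mean_radial _ _ _ _ P X gamma Pi mX Xchar Pi1 t t0 z 2 (profile2 eps b M) z1 isT
    (lipb_profile2 b eps0 eps1 M) (@profile2_large _ eps b b01 M).
  by rewrite e2.
have c3 : n.+1%:R * Rintegral P setT (fun w => radial z 0 (profile3 eps b M) (X (t / n.+1%:R) w))
    @[n --> \oo] --> t * k3.
  exact: (@cvg_small_mean_radial _ _ _ _ P X gamma Pi mX Xchar Pi1 t t0 z 0 (profile3 eps b M) z1 isT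
    (lipb_profile3 b eps0 eps1 M) (@profile3_large _ eps b b01 M)).
have inv0 : n.+1%:R^-1 @[n --> \oo] --> (0 : R) by exact: cvg_harmonic.
have cm : Gmean n @[n --> \oo] --> 0.
  rewrite -(mulr0 (t * k1)).
  rewrite (_ : (fun n => Gmean n) = (fun n => n.+1%:R * Gmean n * n.+1%:R^-1)); first exact: cvgM.
  by apply/funext => n; rewrite mulrAC divff ?mul1r.
have cs : n.+1%:R * Gvar n @[n --> \oo] --> t * k2.
  rewrite -[X in _ --> X]subr0 -(mulr0 (t * k1)).
  rewrite (_ : (fun n => _) = (fun n => n.+1%:R * Rintegral P setT (fun w => GX n w ^+ 2) -
    n.+1%:R * Gmean n * Gmean n)); first by apply: cvgB => //; exact: cvgM.
  by apply/funext => n; rewrite /Gvar; ring.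
have cv : Gvar n @[n --> \oo] --> 0.
  rewrite -(mulr0 (t * k2)).
  rewrite (_ : (fun n => Gvar n) = (fun n => n.+1%:R * Gvar n * n.+1%:R^-1)); first exact: cvgM.
  by apply/funext => n; rewrite mulrAC divff ?mul1r.
have ch : Num.sqrt (Gvar n) @[n --> \oo] --> 0.
  by rewrite -[X in _ --> X]sqrtr0; exact: (cvg_continuous (@sqrt_continuous R) cv).
have tk2 : 0 < t * k2 by rewrite mulr_gt0.
have css : Num.sqrt (n.+1%:R * Gvar n) @[n --> \oo] --> Num.sqrt (t * k2).
  exact: (cvg_continuous (@sqrt_continuous R) cs).
have mJ : measurable_fun D J.
  by apply: (@measurable_fun_cvg _ _ _ D Gsum) => // n; exact: measurable_funTS.
split => //.
have cint : Rintegral P D (fun w => f (Gsum n w - n.+1%:R * Gmean n)) @[n --> \oo] -->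
    Rintegral P D (fun w => f (J w - t * k1)).
  apply: (@cvg_Rintegral_dominated _ _ _ P D _ _ (fun=> 1)) => //.
  - move=> n; apply: measurable_funTS; apply: (measurableT_comp f01.1).
    by apply: measurable_funB => //; exact: measurable_cst.
  - move=> w Dw; apply: (cvg_continuous fcont).
    by apply: cvgB => //; exact: SJ.
  - by apply: (@integrable_bounded _ _ _ _ _ _ 1) => // w _; rewrite normr1.
  - by move=> n w _; have /andP[h1 h2] := f01.2 (Gsum n w - n.+1%:R * Gmean n); rewrite ger0_norm.
have clow : tail_low (a / Num.sqrt (n.+1%:R * Gvar n)) -
    C * ((4 * (n.+1%:R * Rintegral P setT (fun w => radial z 0 (profile3 eps b M) (X (t / n.+1%:R) w)))
      + 4 * (`|n.+1%:R * Gmean n| * (Gmean n * Gmean n)))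
      + n.+1%:R * Gvar n * Num.sqrt (Gvar n)) @[n --> \oo] -->
    tail_low (a / Num.sqrt (t * k2)) - C * ((4 * (t * k3) + 4 * (`|t * k1| * (0 * 0))) + t * k2 * 0).
  apply: cvgB; first exact: cvg_tail_low.
  apply: cvgM; first exact: cvg_cst.
  apply: cvgD; last exact: cvgM.
  apply: cvgD; first by apply: cvgM => //; exact: cvg_cst.
  apply: cvgM; first exact: cvg_cst.
  by apply: cvgM; [exact: cvg_norm|exact: cvgM].
rewrite !mulr0 !addr0 in clow.
apply: (ler_cvg_to clow cint).
(* The step-size condition of the tail bound holds eventually because its limit form [0 < s^4] is
   strict. *)
have ccond : (a + 2 * Num.sqrt (n.+1%:R * Gvar n)) ^+ 3 * Num.sqrt (Gvar n) -
   Num.sqrt (n.+1%:R * Gvar n) ^+ 4 @[n --> \oo] --> (a + 2 * Num.sqrt (t * k2)) ^+ 3 * 0 - Num.sqrt (t * k2) ^+ 4.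
  have ex m : continuous (fun x : R => x ^+ m) by exact: exprn_continuous.
  apply: cvgB.
    apply: cvgM => //; apply: (cvg_continuous (ex 3)).
    apply: cvgD; first exact: cvg_cst.
    by apply: cvgM => //; exact: cvg_cst.
  exact: (cvg_continuous (ex 4) css).
rewrite mulr0 sub0r in ccond.
have lneg : - Num.sqrt (t * k2) ^+ 4 < 0 by rewrite oppr_lt0 exprn_gt0// sqrtr_gt0.
near=> n.
have nv : 0 < n.+1%:R * Gvar n by near: n; apply: (cvgr_gt _ cs).
have v0 : 0 < Gvar n by rewrite -(pmulr_rgt0 _ (ltr0Sn R n)).
have hs : (a + 2 * Num.sqrt (n.+1%:R * Gvar n)) ^+ 3 * Num.sqrt (Gvar n) <=
   Num.sqrt (n.+1%:R * Gvar n) ^+ 4.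
  by rewrite -subr_le0 ltW//; near: n; apply: (cvgr_lt _ ccond).
apply: le_trans (level_n v0 hs); rewrite lerD2l lerN2 ler_wpM2l//.
rewrite lerD//.
  rewrite mulrDr lerD//; first by rewrite mulrCA.
  have -> : `|Gmean n| ^+ 3 = `|Gmean n| * (Gmean n * Gmean n).
    by rewrite exprS -expr2 real_normK ?num_real.
  by rewrite normrM (ger0_norm (ler0n _ _)) le_eqVlt; apply/orP; left; apply/eqP; ring.
have -> : Num.sqrt (Gvar n) ^+ 3 = Gvar n * Num.sqrt (Gvar n).
  by rewrite exprSr sqr_sqrtr// ltW.
by rewrite mulrA.
Unshelve. all: by end_near. Qed.

End fixed_cutoff.
End cutoff_level.

Section jump_projection.
Context {R : realType} {d : nat}.
Variables (f : R -> d.-tuple R) (t : R) (fc : cadlag f) (t0 : 0 < t).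
Variables (z : d.-tuple R) (z1 : vnorm z <= 1) (eps b : R) (eps0 : 0 < eps) (b01 : 0 < b <= 1).

Lemma band_sqnorm (y : d.-tuple R) :
  ((eps ^+ 2 < vnorm y ^+ 2) && (vnorm y ^+ 2 <= b ^+ 2)) = (eps < vnorm y <= b).
Proof.
have b0 : 0 <= b by case/andP: b01 => /ltW.
by rewrite ltr_pXn2r ?nnegrE ?vnorm_ge0 ?(ltW eps0)// ler_pXn2r ?nnegrE ?vnorm_ge0.
Qed.

Lemma cvg_cproj (y : d.-tuple R) : cproj z eps b M' y @[M' --> \oo] -->
  (if eps < vnorm y <= b then dotv z y else 0).
Proof.
have -> : (if eps < vnorm y <= b then dotv z y else 0) = dotv z y * (if eps < vnorm y <= b then 1 else 0).
  by case: ifP; rewrite ?mulr1 ?mulr0.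
apply: cvgM; first exact: cvg_cst.
rewrite -band_sqnorm; exact: cvg_cutoff.
Qed.

Definition jump_sum : R := \sum_(i < d) tnth z i *
  (\sum_(s \in [set s | 0 < s <= t /\ eps < vnorm (path_jump f s) <= b]) tnth (path_jump f s) i).

(** One finite list [l] of jump times, depending on [eps] only, serves all [M]; both limits are then
    limits of finite sums. *)
Lemma cvg_cutoff_jump_sums : exists J : nat -> R,
  (forall M, \sum_(k < n.+1) cproj z eps b M (increment f t n k) @[n --> \oo] --> J M) /\
  J M @[M --> \oo] --> jump_sum.
Proof.
have [l [lu lt lsmall ljump]] := cadlag_jump_times fc (ltW t0) eps0.
exists (fun M => \sum_(p <- l) cproj z eps b M (path_jump f p)); split.
  move=> M; apply: (cvg_jump_sum fc t0 _ lu lt lsmall); first exact: cproj_continuous.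
  by move=> y; exact: cproj_small.
pose A := [set s | 0 < s <= t /\ eps < vnorm (path_jump f s) <= b].
(* The sum over the set [A] takes a default value on an infinite support; listing [A] turns it into
   an ordinary finite sum. *)
have AE : A = [set` [seq p <- l | p \in A]].
  apply/seteqP; split => s /=; rewrite mem_filter.
    move=> As; rewrite mem_set//=; case: As => /= st /andP[js _]; exact: ljump.
  by move=> /andP[+ _]; rewrite inE.
have -> : jump_sum = \sum_(p <- l) (if eps < vnorm (path_jump f p) <= b then dotv z (path_jump f p) else 0).
  have Fs i : \sum_(s \in A) tnth (path_jump f s) i =
      \sum_(p <- l) (if p \in A then tnth (path_jump f p) i else 0).
    by rewrite {1}AE -fsbig_seq ?filter_uniq// big_filter big_mkcond.
  rewrite /jump_sum -/A; under eq_bigr do rewrite Fs mulr_sumr.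
  rewrite exchange_big [LHS]big_seq [RHS]big_seq; apply: eq_bigr => p pl.
  have -> : (p \in A) = (eps < vnorm (path_jump f p) <= b).
    apply/idP/idP => [|bp]; first by rewrite inE => -[].
    by rewrite inE; split => //; exact: lt.
  by case: ifP => _ //; rewrite big1// => i _; rewrite mulr0.
by apply: cvg_sum_seq => p _; exact: cvg_cproj.
Qed.

End jump_projection.

(** * Sharp truncation to the band [eps < |y| <= b] *)

Section level_limits.
Context {R : realType} {d : nat} {dT : measure_display} {T : measurableType dT}.
Context (P : probability T R) (X : R -> T -> d.-tuple R) (gamma : d.-tuple R).
Context (Pi : {measure set (d.-tuple R) -> \bar R}).
Hypothesis XL : levy_process P X.
Hypothesis Xchar : char_triplet_nongauss P X gamma Pi.
Hypothesis Pi1 : Pi [set y | 1 < vnorm y] = 0%E.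
Variables (t : R) (t0 : 0 < t) (D : set T) (mD : measurable D) (D0 : P (~` D) = 0%E).
Hypothesis Dc : forall w, D w -> cadlag (X ^~ w).
Variables (z : d.-tuple R) (z1 : vnorm z <= 1) (b : R) (b01 : 0 < b <= 1).
Variables (f : R -> R) (a C : R) (a0 : 0 < a) (C0 : 0 <= C).
Hypotheses (f01 : unit_valued f) (fcont : continuous f) (fa : forall x, a <= x -> 1 <= f x).
Hypothesis fT : forall x, exists f1 f2 : R, forall u : R,
    `|f (x + u) - f x - u * f1 - u ^+ 2 / 2 * f2| <= C * `|u| ^+ 3.

Let mX s : measurable_fun setT (X s). Proof. by case: XL. Qed.
Let PiL : levy_measure Pi := Xchar.1.

Definition band_fun eps (g : d.-tuple R -> R) y := if eps < vnorm y <= b then g y else 0.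

Let integrable_sq c : Pi.-integrable setT (EFin \o (fun y => c * vnorm y ^+ 2)).
Proof.
apply: (@levy_integrable _ _ Pi PiL Pi1 _ `|c|).
  apply: measurable_funM; first exact: measurable_cst.
  by apply: measurable_funX; exact: measurable_vnorm.
by move=> y _; rewrite normrM [`|_ ^+ 2|]ger0_norm ?sqr_ge0.
Qed.

Section fixed_eps.
Variables (eps : R) (eps0 : 0 < eps) (eps1 : eps <= 1).

Let Q := Rintegral Pi setT (band_fun eps (fun y => dotv z y ^+ 2)).
Let rho := Rintegral Pi setT (band_fun eps (fun y => vnorm y ^+ 3)).
Let kap := Rintegral Pi setT (band_fun eps (dotv z)).

(** Domination of a first-order integrand: [|y| <= |y|^2 / eps] wherever the cutoff does not
    vanish. *)
Let cvg_kap : Rintegral Pi setT (cproj z eps b M) @[M --> \oo] --> kap.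
Proof.
apply: (cvg_Rintegral_dominated _ _ _ _ _ _ _ _ measurableT _ _ (integrable_sq eps^-1)).
- by move=> M; exact: measurable_cproj.
- by move=> y _; exact: cvg_cproj.
- move=> M y _; have [ye|ye] := ltP (vnorm y) eps.
    by rewrite cproj_small// normr0 mulr_ge0 ?sqr_ge0// invr_ge0 ltW.
  have /andP[c0 c1] := cutoff01 eps b M (vnorm y ^+ 2).
  apply: (@le_trans _ _ (vnorm y)).
    rewrite /cproj normrM -[leRHS]mulr1 ler_pM ?norm_dotv_le1//; by rewrite ger0_norm.
  by rewrite ler_pdivlMl// expr2 ler_wpM2r// vnorm_ge0.
Qed.

Let cvg_Q : Rintegral Pi setT (fun y => cproj z eps b M y ^+ 2) @[M --> \oo] --> Q.
Proof.
apply: (cvg_Rintegral_dominated _ _ _ _ _ _ _ _ measurableT _ _ (integrable_sq 1)).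
- by move=> M; apply: measurable_funX; exact: measurable_cproj.
- move=> y _; rewrite (_ : band_fun _ _ _ = (if eps < vnorm y <= b then dotv z y else 0) ^+ 2).
    by apply: (cvg_continuous (@exprn_continuous R 2)); exact: cvg_cproj.
  by rewrite /band_fun; case: ifP => // _; rewrite expr0n.
- move=> M y _; have /andP[c0 c1] := cutoff01 eps b M (vnorm y ^+ 2).
  rewrite normrX mul1r lerXn2r ?nnegrE ?vnorm_ge0//.
  rewrite /cproj normrM -[leRHS]mulr1 ler_pM ?norm_dotv_le1//; by rewrite ger0_norm.
Qed.

Let cvg_rho : Rintegral Pi setT (radial z 0 (profile3 eps b M)) @[M --> \oo] --> rho.
Proof.
apply: (cvg_Rintegral_dominated _ _ _ _ _ _ _ _ measurableT _ _ (integrable_sq 2)).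
- by move=> M; apply: measurable_radial; exact: lipb_profile3.
- move=> y _; under eq_fun do rewrite radial_profile3//.
  rewrite (_ : band_fun _ _ _ = vnorm y ^+ 3 * (if eps < vnorm y <= b then 1 else 0) ^+ 3).
    apply: cvgM; first exact: cvg_cst.
    apply: (cvg_continuous (@exprn_continuous R 3)); rewrite -band_sqnorm//; exact: cvg_cutoff.
  by rewrite /band_fun; case: ifP => // _; rewrite ?expr1n ?mulr1// expr0n mulr0.
- move=> M y _; have /andP[c0 c1] := cutoff01 eps b M (vnorm y ^+ 2).
  have n0 := vnorm_ge0 y.
  have [r2|r2] := leP 2 (vnorm y ^+ 2).
    by rewrite radial_profile3// cutoff_large// expr0n mulr0 normr0 mulr_ge0// sqr_ge0.
  have vy2 : vnorm y <= 2 by nra.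
  rewrite radial_profile3// normrM !normrX (ger0_norm n0) (ger0_norm c0) -[leRHS]mulr1.
  apply: ler_pM; rewrite ?exprn_ge0 ?exprn_ile1//.
  by rewrite exprS ler_wpM2r// sqr_ge0.
Qed.

Lemma eps_level_bound : 0 < Q ->
  measurable_fun D (fun w => jump_sum (X ^~ w) t z eps b) /\
  tail_low (a / Num.sqrt (t * Q)) - C * (4 * (t * rho))
  <= Rintegral P D (fun w => f (jump_sum (X ^~ w) t z eps b - t * kap)).
Proof.
move=> Q0.
(* The path-by-path limits are named by [lim], so that they become functions of [w] whose
   measurability can be proved. *)
pose J M w := lim (\sum_(k < n.+1) cproj z eps b M (increment (X ^~ w) t n k) @[n --> \oo]).
have JE w : D w -> (forall M, \sum_(k < n.+1) cproj z eps b M (increment (X ^~ w) t n k) @[n --> \oo] --> J M w) /\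
    J M w @[M --> \oo] --> jump_sum (X ^~ w) t z eps b.
  move=> Dw; have [J' [J1 J2]] := cvg_cutoff_jump_sums (Dc Dw) t0 z1 eps0 b01.
  have e M : J M w = J' M by apply: cvg_lim => //; exact: J1.
  by split; [move=> M; rewrite e|under eq_fun do rewrite e].
have mJ M : measurable_fun D (J M).
  apply: (@measurable_fun_cvg _ _ _ D (fun n w => \sum_(k < n.+1) cproj z eps b M (increment (X ^~ w) t n k))).
    move=> n; apply: measurable_funTS; apply: measurable_sum => k.
    have mG : measurable_fun setT (cproj z eps b M) by exact: measurable_cproj.
    have mI : measurable_fun setT (fun w => increment (X ^~ w) t n k) by exact: measurable_vsub.
    exact: (measurableT_comp mG mI).
  by move=> w Dw; have [] := JE w Dw.
split.
  by apply: (@measurable_fun_cvg _ _ _ D J) => // w Dw; have [] := JE w Dw.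
have cint : Rintegral P D (fun w => f (J M w - t * Rintegral Pi setT (cproj z eps b M))) @[M --> \oo] -->
    Rintegral P D (fun w => f (jump_sum (X ^~ w) t z eps b - t * kap)).
  apply: (@cvg_Rintegral_dominated _ _ _ P D _ _ (fun=> 1)) => //.
  - move=> M; apply: (measurableT_comp f01.1).
    by apply: measurable_funB => //; exact: measurable_cst.
  - move=> w Dw; apply: (cvg_continuous fcont); apply: cvgB; first by have [] := JE w Dw.
    by apply: cvgM => //; exact: cvg_cst.
  - by apply: (@integrable_bounded _ _ _ _ _ _ 1) => // w _; rewrite normr1.
  - move=> M w _; set u := _ - _; have /andP[h1 h2] := f01.2 u; by rewrite ger0_norm.
have tQ : 0 < t * Q by rewrite mulr_gt0.
have clow : tail_low (a / Num.sqrt (t * Rintegral Pi setT (fun y => cproj z eps b M y ^+ 2))) -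
   C * (4 * (t * Rintegral Pi setT (radial z 0 (profile3 eps b M)))) @[M --> \oo] -->
   tail_low (a / Num.sqrt (t * Q)) - C * (4 * (t * rho)).
  apply: cvgB.
    by apply: cvg_tail_low => //; apply: cvgM => //; exact: cvg_cst.
  apply: cvgM; first exact: cvg_cst.
  apply: cvgM; first exact: cvg_cst.
  by apply: cvgM => //; exact: cvg_cst.
apply: (ler_cvg_to clow cint); near=> M.
have q0 : 0 < Rintegral Pi setT (fun y => cproj z eps b M y ^+ 2).
  by near: M; apply: (cvgr_gt _ cvg_Q).
exact: (cutoff_level_bound XL Xchar Pi1 t0 mD D0 z1 b01 a0 C0 f01 fcont fa fT eps0 eps1
  (fun w Dw => (JE w Dw).1 M) q0).2.
Unshelve. all: by end_near. Qed.

End fixed_eps.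
End level_limits.

(** * Lower bound in one direction *)

Section projection.
Context {R : realType} {d : nat} {dT : measure_display} {T : measurableType dT}.
Context (P : probability T R) (X : R -> T -> d.-tuple R) (gamma : d.-tuple R).
Context (Pi : {measure set (d.-tuple R) -> \bar R}).
Hypothesis XL : levy_process P X.
Hypothesis Xchar : char_triplet_nongauss P X gamma Pi.
Hypothesis Pi1 : Pi [set y | 1 < vnorm y] = 0%E.
Variables (t : R) (t0 : 0 < t) (D : set T) (mD : measurable D) (D0 : P (~` D) = 0%E).
Hypothesis Dc : forall w, D w -> cadlag (X ^~ w).
Variables (z : d.-tuple R) (z1 : vnorm z <= 1) (b : R) (b01 : 0 < b <= 1).
Variables (f : R -> R) (a C : R) (a0 : 0 < a) (C0 : 0 <= C).
Hypotheses (f01 : unit_valued f) (fcont : continuous f) (fa : forall x, a <= x -> 1 <= f x).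
Hypothesis fT : forall x, exists f1 f2 : R, forall u : R,
    `|f (x + u) - f x - u * f1 - u ^+ 2 / 2 * f2| <= C * `|u| ^+ 3.
Variable Y : T -> d.-tuple R.
Hypothesis HY : forall w, D w -> forall i,
  Yapprox X Pi b t eps w i @[eps --> 0^'+] --> tnth (Y w) i.

Let PiL : levy_measure Pi := Xchar.1.

Let measurable_bfun eps (g : d.-tuple R -> R) :
  measurable_fun setT g -> measurable_fun setT (band_fun b eps g).
Proof.
move=> mg; apply: measurable_fun_ifT => //; apply: measurable_and.
  by apply: measurable_fun_ltr => //; exact: measurable_vnorm.
by apply: measurable_fun_ler => //; exact: measurable_vnorm.
Qed.

Lemma Rintegral_band eps (g : d.-tuple R -> R) :
  Rintegral Pi [set y | eps < vnorm y <= b] g = Rintegral Pi setT (band_fun b eps g).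
Proof.
rewrite Rintegral_mkcond; apply: eq_Rintegral => y _.
by rewrite /band_fun patchE; case: ifP => h; case: ifP => // h'; move: h h'; rewrite ?inE/=; [move=> ->|move=> /negP h h'; case: h; rewrite inE].
Qed.

(** Matches the compensator of [<z, y>] with the coordinatewise one of [Yapprox]; the coordinates
    are integrable on the band because it stays away from 0. *)
Let kap_sum eps : 0 < eps -> Rintegral Pi setT (band_fun b eps (dotv z)) =
  \sum_(i < d) tnth z i * Rintegral Pi [set y | eps < vnorm y <= b] (fun y => tnth y i).
Proof.
move=> eps0.
have mi i : measurable_fun setT (fun y : d.-tuple R => tnth y i) by exact: measurable_tnth.
have ig i : Pi.-integrable setT (EFin \o (band_fun b eps (fun y => tnth y i))).
  apply: (@levy_integrable _ _ Pi PiL Pi1 _ eps^-1); first exact: measurable_bfun.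
  move=> y _; rewrite /band_fun; case: ifP => [/andP[ey _]|_]; last first.
    by rewrite normr0 mulr_ge0 ?sqr_ge0// invr_ge0 ltW.
  rewrite (le_trans (tnth_le_vnorm _ _))// ler_pdivlMl// expr2 ler_wpM2r ?vnorm_ge0//.
  exact: ltW.
rewrite (_ : band_fun b eps (dotv z) = (fun y => \sum_(i < d) tnth z i * band_fun b eps (fun y => tnth y i) y)).
  rewrite /index_enum; elim: (Finite.enum _) => [|i l IH].
    rewrite big_nil (_ : (fun y => _) = fun=> 0); last by apply/funext => y; rewrite big_nil.
    by rewrite /Rintegral integral0.
  rewrite big_cons -IH Rintegral_band -(RintegralZl _ measurableT (ig i)) -RintegralD//.
  - by congr Rintegral; apply/funext => y; rewrite big_cons.
  - exact: integrable_scale.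
  - elim: l {IH} => [|j l IH].
      rewrite (_ : (fun y => _) = fun=> 0); first exact: integrable0.
      by apply/funext => y; rewrite big_nil.
    rewrite (_ : (fun y => _) = (fun y => tnth z j * band_fun b eps (fun y0 => tnth y0 j) y +
       \sum_(i <- l) tnth z i * band_fun b eps (fun y0 => tnth y0 i) y)).
      by apply: integrable_add => //; exact: integrable_scale.
    by apply/funext => y; rewrite big_cons.
apply/funext => y; rewrite /band_fun; case: ifP => // _.
by rewrite big1// => i _; rewrite mulr0.
Qed.

Let jump_sum_Yapprox eps w : 0 < eps ->
  jump_sum (X ^~ w) t z eps b - t * Rintegral Pi setT (band_fun b eps (dotv z)) =
  \sum_(i < d) tnth z i * Yapprox X Pi b t eps w i.
Proof.
move=> eps0; rewrite kap_sum// mulr_sumr -sumrB; apply: eq_bigr => i _.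
by rewrite /Yapprox mulrBr (mulrCA t).
Qed.

Let eps_ (j : nat) : R := j.+1%:R^-1.

Let eps_gt0 j : 0 < eps_ j. Proof. by rewrite invr_gt0. Qed.

Let eps_le1 j : eps_ j <= 1. Proof. by rewrite invf_le1// ler1n. Qed.

Let cvg_eps : eps_ j @[j --> \oo] --> 0. Proof. exact: cvg_harmonic. Qed.

(** No band contains the origin although the ball does; hence the condition on [g] at 0. *)
Let cvg_band_fun (g : d.-tuple R -> R) y : (vnorm y = 0 -> g y = 0) ->
  band_fun b (eps_ j) g y @[j --> \oo] --> (if vnorm y <= b then g y else 0).
Proof.
move=> g0; apply: cvg_near_cst.
have [y0|y0] := eqVneq (vnorm y) 0.
  by apply: nearW => j; rewrite /band_fun g0// !if_same.
have yp : 0 < vnorm y by rewrite lt_neqAle eq_sym y0 vnorm_ge0.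
near=> j; rewrite /band_fun (_ : eps_ j < vnorm y)//.
by near: j; apply: (cvgr_lt _ cvg_eps).
Unshelve. all: by end_near. Qed.

Let integrable_sq c : Pi.-integrable setT (EFin \o (fun y => c * vnorm y ^+ 2)).
Proof.
apply: (@levy_integrable _ _ Pi PiL Pi1 _ `|c|).
  apply: measurable_funM; first exact: measurable_cst.
  by apply: measurable_funX; exact: measurable_vnorm.
by move=> y _; rewrite normrM [`|_ ^+ 2|]ger0_norm ?sqr_ge0.
Qed.

Definition ball_var := Rintegral Pi setT (fun y => if vnorm y <= b then dotv z y ^+ 2 else 0).
Definition ball_third := Rintegral Pi setT (fun y => if vnorm y <= b then vnorm y ^+ 3 else 0).

Let mv n : measurable_fun setT (fun y : d.-tuple R => vnorm y ^+ n).
Proof. by apply: measurable_funX; exact: measurable_vnorm. Qed.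

Let cvg_var : Rintegral Pi setT (band_fun b (eps_ j) (fun y => dotv z y ^+ 2)) @[j --> \oo]
  --> ball_var.
Proof.
apply: (cvg_Rintegral_dominated _ _ _ _ _ _ _ _ measurableT _ _ (integrable_sq 1)).
- by move=> j; apply: measurable_bfun; apply: measurable_funX; exact: measurable_dotv.
- move=> y _; apply: cvg_band_fun => /vnorm_eq0->.
  by rewrite dotvC dotv0l expr0n.
- move=> j y _; rewrite mul1r /band_fun; case: ifP => _; last by rewrite normr0 sqr_ge0.
  by rewrite normrX lerXn2r ?nnegrE ?vnorm_ge0// norm_dotv_le1.
Qed.

Let cvg_third : Rintegral Pi setT (band_fun b (eps_ j) (fun y => vnorm y ^+ 3)) @[j --> \oo]
  --> ball_third.
Proof.
apply: (cvg_Rintegral_dominated _ _ _ _ _ _ _ _ measurableT _ _ (integrable_sq 1)).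
- by move=> j; exact: measurable_bfun.
- by move=> y _; apply: cvg_band_fun => ->; rewrite expr0n.
- move=> j y _; rewrite mul1r /band_fun; case: ifP => [/andP[_ yb]|_]; last by rewrite normr0 sqr_ge0.
  rewrite ger0_norm ?exprn_ge0 ?vnorm_ge0// exprS ler_piMl ?sqr_ge0//.
  by rewrite (le_trans yb)//; case/andP: b01.
Qed.

Lemma projection_bound : 0 < ball_var ->
  tail_low (a / Num.sqrt (t * ball_var)) - C * (4 * (t * ball_third)) <=
  Rintegral P D (fun w => f (dotv z (Y w))).
Proof.
move=> Q0.
have bound j := eps_level_bound XL Xchar Pi1 t0 mD D0 Dc z1 b01 a0 C0 f01 fcont fa fT (eps_gt0 j) (eps_le1 j).
pose Z j w := jump_sum (X ^~ w) t z (eps_ j) b - t * Rintegral Pi setT (band_fun b (eps_ j) (dotv z)).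
have cZ w : D w -> Z j w @[j --> \oo] --> dotv z (Y w).
  move=> Dw; rewrite /Z; under eq_fun do rewrite jump_sum_Yapprox//.
  rewrite (_ : dotv z (Y w) = \sum_(i < d) tnth z i * tnth (Y w) i)//.
  apply: cvg_sum_seq => i _; apply: cvgM; first exact: cvg_cst.
  by move/cvg_at_rightP: (@HY w Dw i); apply; split.
have tQ : 0 < t * ball_var by rewrite mulr_gt0.
have clow : tail_low (a / Num.sqrt (t * Rintegral Pi setT (band_fun b (eps_ j) (fun y => dotv z y ^+ 2)))) -
   C * (4 * (t * Rintegral Pi setT (band_fun b (eps_ j) (fun y => vnorm y ^+ 3)))) @[j --> \oo] -->
   tail_low (a / Num.sqrt (t * ball_var)) - C * (4 * (t * ball_third)).
  apply: cvgB.
    by apply: cvg_tail_low => //; apply: cvgM => //; exact: cvg_cst.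
  apply: cvgM; first exact: cvg_cst.
  apply: cvgM; first exact: cvg_cst.
  by apply: cvgM => //; exact: cvg_cst.
have pos : \forall j \near \oo, 0 < Rintegral Pi setT (band_fun b (eps_ j) (fun y => dotv z y ^+ 2)).
  exact: (cvgr_gt _ cvg_var).
(* The bound and the measurability of the jump sums are available only where the band variance is
   positive, so the sequence starts at [N]. *)
have [N _ HN] := pos.
have cint : Rintegral P D (fun w => f (Z (N + j)%N w)) @[j --> \oo] -->
    Rintegral P D (fun w => f (dotv z (Y w))).
  apply: (@cvg_Rintegral_dominated _ _ _ P D _ _ (fun=> 1)) => //.
  - move=> j; apply: (measurableT_comp f01.1).
    apply: measurable_funB; last exact: measurable_cst.
    by have [] := bound (N + j)%N (HN _ (leq_addr _ _)).
  - move=> w Dw; apply: (cvg_continuous fcont).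
    by have := cZ w Dw; rewrite -(cvg_shiftn N); under eq_fun do rewrite addnC.
  - by apply: (@integrable_bounded _ _ _ _ _ _ 1) => // w _; rewrite normr1.
  - move=> j w _; have /andP[h1 h2] := f01.2 (Z (N + j)%N w); by rewrite ger0_norm.
move: clow; rewrite -(cvg_shiftn N) => clow.
apply: (ler_cvg_to clow cint); near=> j.
rewrite /= (addnC j N); exact: (bound (N + j)%N (HN _ (leq_addr _ _))).2.
Unshelve. all: by end_near. Qed.

End projection.

(** The exponent of [tail_low] is [w^2/2 + 4 w + 7]. With [kap = (1 + eta)^2 - 1], the linear term
    is absorbed by [4 w <= kap w^2 / 2 + 8 / kap], which leaves [(1 + eta)^2 w^2 / 2] and the
    constant [7 + 8 / kap]. *)
Lemma tail_low_ge (R : realType) (eta delta u w : R) : 0 < eta ->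
  (1 + eta) ^+ 3 <= 1 + delta -> 0 <= w -> w <= (1 + eta) ^+ 2 * u ->
  expR (- (7 + 8 / (2 * eta + eta ^+ 2))) / 2 * expR (- (u ^+ 2 * (1 + delta) ^+ 2 / 2)) <= tail_low w.
Proof.
move=> e0 ed w0 wu.
set kap := 2 * eta + eta ^+ 2.
have k0 : 0 < kap by rewrite addr_gt0 ?mulr_gt0 ?exprn_gt0.
rewrite /tail_low mulrAC ler_pM2r ?invr_gt0// -expRD ler_expR.
rewrite -opprD lerN2.
have h1 : 4 * w <= kap * w ^+ 2 / 2 + 8 / kap.
  have : 0 <= (kap * w - 4) ^+ 2 / (2 * kap) by rewrite divr_ge0 ?sqr_ge0// mulr_ge0// ltW.
  rewrite [X in 0 <= X -> _](_ : _ = kap * w ^+ 2 / 2 + 8 / kap - 4 * w); first by rewrite subr_ge0.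
  by field; rewrite gt_eqF.
have h2 : (1 + eta) * w <= (1 + delta) * u.
  have u0 : 0 <= u.
    have e2 : 0 < (1 + eta) ^+ 2 by rewrite exprn_gt0// addr_gt0.
    by rewrite -(pmulr_rge0 _ e2) (le_trans w0).
  apply: (@le_trans _ _ ((1 + eta) ^+ 3 * u)); last by rewrite ler_wpM2r.
  by rewrite exprS -mulrA ler_wpM2l// addr_ge0// ltW.
have h3 : ((1 + eta) * w) ^+ 2 <= ((1 + delta) * u) ^+ 2.
  have p0 : 0 <= (1 + eta) * w by rewrite mulr_ge0// addr_ge0// ltW.
  by rewrite lerXn2r ?nnegrE// (le_trans p0).
have e1 : ((1 + eta) * w) ^+ 2 = w ^+ 2 + kap * w ^+ 2 by rewrite /kap; ring.
have e2 : ((1 + delta) * u) ^+ 2 = u ^+ 2 * (1 + delta) ^+ 2 by ring.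
rewrite e1 e2 in h3.
move: h1 h3; set A := kap * w ^+ 2; set B := u ^+ 2 * _; set E := 8 / kap => h1 h3.
have -> : (w + 2) ^+ 2 = w ^+ 2 + 4 * w + 4 by ring.
lra.
Qed.

Section scaled_step.
Context {R : realType}.
Variables (x eta : R) (x0 : 0 < x) (eta0 : 0 < eta).

Definition step_fun (v : R) : R := spline3 (3 / (eta * x) * (v - x)).

Let c0 : 0 < 3 / (eta * x). Proof. by rewrite divr_gt0// mulr_gt0. Qed.

Lemma continuous_step_fun : continuous step_fun.
Proof.
move=> v; apply: (@cvg_comp _ _ _ (fun v : R => 3 / (eta * x) * (v - x)) spline3);
  last exact: continuous_spline3.
apply: cvgM; first exact: cvg_cst.
by apply: cvgB; [exact: cvg_id|exact: cvg_cst].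
Qed.

Lemma step_fun_unit_valued : unit_valued step_fun.
Proof.
split; last by move=> v; exact: spline3_01.
exact: (continuous_measurable_fun continuous_step_fun).
Qed.

Lemma step_fun_eq0 v : v <= x -> step_fun v = 0.
Proof. by move=> vx; rewrite /step_fun spline3_eq0// pmulr_rle0// subr_le0. Qed.

Lemma step_fun_ge1 v : (1 + eta) * x <= v -> 1 <= step_fun v.
Proof.
move=> vx; rewrite /step_fun spline3_eq1// mulrAC ler_pdivlMr ?mulr_gt0// ler_pM2l//; lra.
Qed.

(** Squeezing the step from [0, 3] to [x, (1 + eta) x] multiplies the cubic constant 2 by
    [(3 / (eta x))^3], whence 54. *)
Lemma step_fun_taylor v : exists f1 f2 : R, forall u : R,
  `|step_fun (v + u) - step_fun v - u * f1 - u ^+ 2 / 2 * f2| <= 54 / (eta * x) ^+ 3 * `|u| ^+ 3.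
Proof.
set c := 3 / (eta * x); pose r := c * (v - x).
exists (c * spline3_d1 r), (c ^+ 2 * spline3_d2 r) => u.
have := spline3_taylor r (c * u).
rewrite normrM (gtr0_norm c0) [(_ * `|u|) ^+ 3]exprMn => H.
rewrite [leRHS](_ : _ = 2 * (c ^+ 3 * `|u| ^+ 3)); last first.
  by rewrite /c; field; rewrite !gt_eqF.
apply: le_trans H; rewrite /step_fun -/c -/r.
have -> : c * (v + u - x) = r + c * u by rewrite /r; ring.
by rewrite le_eqVlt; apply/orP; left; apply/eqP; congr (`|_|); field.
Qed.

End scaled_step.

Section one_direction.
Context {R : realType} {d : nat} {dT : measure_display} {T : measurableType dT}.
Context (P : probability T R) (X : R -> T -> d.-tuple R) (gamma : d.-tuple R).
Context (Pi : {measure set (d.-tuple R) -> \bar R}).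
Hypothesis XL : levy_process P X.
Hypothesis Xchar : char_triplet_nongauss P X gamma Pi.
Hypothesis Pi1 : Pi [set y | 1 < vnorm y] = 0%E.
Variables (t : R) (t0 : 0 < t) (b : R) (b01 : 0 < b <= 1).
Variable Y : T -> d.-tuple R.
Hypothesis mY : measurable_fun setT Y.
Hypothesis YX : {ae P, forall w, forall i : 'I_d,
        Yapprox X Pi b t eps w i @[eps --> 0^'+] --> tnth (Y w) i}.

Lemma one_direction_bound (z : d.-tuple R) (x eta : R) : vnorm z <= 1 -> 0 < x -> 0 < eta ->
  0 < ball_var Pi z b ->
  ((tail_low ((1 + eta) * x / Num.sqrt (t * ball_var Pi z b))
    - 54 / (eta * x) ^+ 3 * (4 * (t * ball_third Pi b)))%:E
   <= P [set w | (x <= vnorm (Y w))%R])%E.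
Proof.
move=> z1 x0 eta0 V0.
have cad : {ae P, forall w, cadlag (fun t => X t w)} by case: XL.
have [N1 [mN1 N10 sN1]] := cad; have [N2 [mN2 N20 sN2]] := YX.
pose N := N1 `|` N2.
have mN : measurable N by exact: measurableU.
have N0 : P N = 0%E by rewrite null_set_setU.
(* A measurable event of full probability on which paths are cadlag and the limit defining [Y]
   exists. *)
pose D := ~` N; have mD : measurable D by exact: measurableC.
have D0 : P (~` D) = 0%E by rewrite setCK.
have Dc w : D w -> cadlag (X ^~ w).
  by move=> Dw; apply: contrapT => nc; apply: Dw; left; exact: sN1.
have HY w : D w -> forall i, Yapprox X Pi b t eps w i @[eps --> 0^'+] --> tnth (Y w) i.
  by move=> Dw; apply: contrapT => nc; apply: Dw; right; exact: sN2.
have a0 : 0 < (1 + eta) * x by rewrite mulr_gt0// addr_gt0.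
have C0 : 0 <= 54 / (eta * x) ^+ 3 by rewrite divr_ge0// exprn_ge0// mulr_ge0// ltW.
have B := projection_bound XL Xchar Pi1 t0 mD D0 Dc z1 b01 a0 C0
  (step_fun_unit_valued x eta) (continuous_step_fun (eta := eta)) (step_fun_ge1 x0 eta0) (step_fun_taylor x0 eta0) HY V0.
apply: (@le_trans _ _ (Rintegral P D (fun w => step_fun x eta (dotv z (Y w))))%:E).
  by rewrite lee_fin.
have mf : measurable_fun setT (fun w => step_fun x eta (dotv z (Y w))).
  apply: (measurableT_comp (step_fun_unit_valued x eta).1).
  exact: (measurableT_comp (measurable_dotv z) mY).
have f01 v := (step_fun_unit_valued x eta).2 v.
have iF : P.-integrable D (EFin \o (fun w => step_fun x eta (dotv z (Y w)))).
  apply: (@integrable_bounded _ _ _ _ _ _ 1) => //; first exact: measurable_funTS.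
  by move=> w _; have /andP[h0 h1] := f01 (dotv z (Y w)); rewrite ger0_norm.
rewrite /Rintegral fineK; last exact: (integrable_fin_num mD iF).
have mE : measurable [set w | x <= vnorm (Y w)].
  rewrite (_ : [set _ | _] = setT `&` (fun w => vnorm (Y w)) @^-1` `[x, +oo[%classic); last first.
    by apply/seteqP; split => w /=; rewrite in_itv/= andbT; [split|case].
  by apply: (measurableT_comp measurable_vnorm mY) => //; exact: measurable_itv.
(* [step_fun] vanishes up to [x] and [<z, Y> <= |Y|], so it lies below the indicator of
   [|Y| >= x]. *)
apply: (@le_trans _ _ (\int[P]_(w in D) (\1_[set w | x <= vnorm (Y w)] w)%:E)%E).
  apply: ge0_le_integral => //.
  - by move=> w _; rewrite lee_fin; have /andP[] := f01 (dotv z (Y w)).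
  - by apply: measurable_funTS; exact/measurable_EFinP.
  - by apply: measurable_funTS; apply/measurable_EFinP; exact: measurable_indic.
  move=> w _; rewrite lee_fin indicE.
  have [xv|vx] := leP x (vnorm (Y w)).
    by rewrite mem_set//; have /andP[] := f01 (dotv z (Y w)).
  rewrite step_fun_eq0 ?ler0n// (le_trans (ler_norm _))// (le_trans (norm_dotv_le1 z1 _))//.
  exact: ltW.
rewrite integral_indic//; apply: le_measure; rewrite ?inE//; first exact: measurableI.
Qed.

End one_direction.

Unset Implicit Arguments.

Lemma ball_varE {R : realType} {d : nat} (Pi : {measure set (d.-tuple R) -> \bar R})
    (z : d.-tuple R) (b : R) :
  fine (\int[Pi]_(y in [set y | (vnorm y <= b)%R]) (dotv y z ^+ 2)%:E)%E = ball_var Pi z b.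
Proof.
rewrite -[LHS]/(Rintegral Pi _ (fun y => dotv y z ^+ 2)) Rintegral_mkcond.
apply: eq_Rintegral => y _; rewrite patchE dotvC.
by case: (leP (vnorm y) b) => h; [rewrite mem_set|rewrite memNset//= => /(le_lt_trans)/(_ h); rewrite ltxx].
Qed.

Lemma ball_thirdE {R : realType} {d : nat} (Pi : {measure set (d.-tuple R) -> \bar R}) (b : R) :
  Rintegral Pi [set y | 0 < vnorm y <= b] (fun y => vnorm y ^+ 3) = ball_third Pi b.
Proof.
rewrite Rintegral_mkcond; apply: eq_Rintegral => y _; rewrite patchE.
have -> : (y \in [set y | 0 < vnorm y <= b]) = (0 < vnorm y <= b).
  by apply/idP/idP; rewrite inE.
have [y0|y0] := eqVneq (vnorm y) 0; first by rewrite y0 expr0n !if_same.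
by rewrite (lt_neqAle 0) eq_sym y0 vnorm_ge0.
Qed.

Theorem theorem3p6 (R : realType) (delta : R) (hdelta : 0 < delta) :
  exists C1 C2 : R, 0 < C1 /\ 0 < C2 /\
  forall (d : nat) (dT : measure_display) (T : measurableType dT)
         (P : probability T R) (X : R -> T -> d.-tuple R) (gamma : d.-tuple R)
         (Pi : {measure set (d.-tuple R) -> \bar R}),
    levy_process P X ->
    char_triplet_nongauss P X gamma Pi ->
    Pi [set y | 1 < vnorm y] = 0%E ->
    forall b : R, 0 < b -> b <= 1 ->
    forall t x : R, 0 < t -> 0 < x ->
    forall Y : T -> d.-tuple R, measurable_fun setT Y ->
    {ae P, forall w, forall i : 'I_d,
        Yapprox X Pi b t eps w i @[eps --> 0^'+] --> tnth (Y w) i} ->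
    ((gauss_term C1 delta x t (fine (Vb Pi b))
      - C2 * t * Rintegral Pi [set y | 0 < vnorm y <= b] (fun y => vnorm y ^+ 3)
        / x ^+ 3)%:E
     <= P [set w | (x <= vnorm (Y w))%R])%E.
Proof.
(* One factor [1 + eta] is lost in each of the cutoff, the choice of [z] and the
   absorption of the linear term of the exponent. *)
pose eta := Num.min delta 1 / 7.
have m0 : 0 < Num.min delta 1 by rewrite lt_min hdelta ltr01.
have eta0 : 0 < eta by rewrite divr_gt0.
have eta7 : 7 * eta <= delta.
  by rewrite /eta mulrC divfK ?pnatr_eq0// ge_min lexx.
have eta1 : eta <= 1.
  have : Num.min delta 1 <= 1 by rewrite ge_min lexx orbT.
  by rewrite /eta ler_pdivrMr// mul1r => /le_trans; apply; rewrite ler1n.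
have ed : (1 + eta) ^+ 3 <= 1 + delta.
  have e2 : eta * eta <= eta by rewrite ler_piMr// ltW.
  have e3 : eta * eta * eta <= eta by rewrite (le_trans _ e2)// ler_piMr// ltW// mulr_gt0.
  have -> : (1 + eta) ^+ 3 = 1 + 3 * eta + 3 * (eta * eta) + eta * eta * eta by ring.
  lra.
(* The first constant is that of [tail_low_ge]; 216 is 54 from the rescaled step times 4 from
   centring. *)
exists (expR (- (7 + 8 / (2 * eta + eta ^+ 2))) / 2), (216 / eta ^+ 3).
split; first by rewrite divr_gt0 ?expR_gt0.
split; first by rewrite divr_gt0 ?exprn_gt0.
move=> d dT T P X gamma Pi XL Xchar Pi1 b b0 b1 t x t0 x0 Y mY YX.
have b01 : 0 < b <= 1 by rewrite b0.
rewrite ball_thirdE.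
have rho0 : 0 <= ball_third Pi b.
  by apply: Rintegral_ge0 => y _; case: ifP => // _; rewrite exprn_ge0// vnorm_ge0.
(* Without positive variance the Gaussian term is 0 and the bound is trivially at most 0. *)
rewrite /gauss_term; case: ifPn => [V0|_]; last first.
  apply: (@le_trans _ _ 0%E) => //; rewrite lee_fin sub0r oppr_le0 divr_ge0 ?exprn_ge0 ?(ltW x0)//.
  by rewrite mulr_ge0// mulr_ge0 ?(ltW t0)// divr_ge0// exprn_ge0// ltW.
set V := fine (Vb Pi b) in V0 *.
(* [fine] sends infinite values to 0, so [V > 0] already forces the supremum to be finite. *)
have Vfin : Vb Pi b = V%:E.
  by rewrite /V fineK//; move: V0; rewrite /V; case: (Vb Pi b) => //=; rewrite ltxx.
have e1 : 1 < (1 + eta) ^+ 2 by rewrite exprn_egt1// ltrDl.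
have e0 : 0 < (1 + eta) ^+ 2 by rewrite (lt_trans _ e1).
have VV : ((V / (1 + eta) ^+ 2)%:E < Vb Pi b)%E.
  by rewrite Vfin lte_fin ltr_pdivrMr// ltr_pMr.
(* A direction within the factor [(1 + eta)^2] of the supremum; attainment is not invoked. *)
have [_ [z z1 <-] zV] := ereal_sup_gt VV.
set I := (\int[Pi]_(y in _) _)%E in zV.
have IV : (I <= V%:E)%E by rewrite -Vfin; apply: ereal_sup_ubound; exists z.
have Ifin : I \is a fin_num.
  rewrite fin_real// (lt_trans _ zV) ?ltNyr//=; exact: (le_lt_trans IV (ltry _)).
have QV : V / (1 + eta) ^+ 2 <= ball_var Pi z b.
  by rewrite -ball_varE -/I -lee_fin fineK// ltW.
have Q0 : 0 < ball_var Pi z b by apply: lt_le_trans QV; rewrite divr_gt0.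
have := one_direction_bound XL Xchar Pi1 t0 b01 mY YX z1 x0 eta0 Q0.
apply: le_trans; rewrite lee_fin lerB//; last first.
  rewrite le_eqVlt; apply/orP; left; apply/eqP.
  by field; rewrite !gt_eqF.
pose u := x / Num.sqrt (t * V).
have tV : 0 < t * V by rewrite mulr_gt0.
have sV : 0 < Num.sqrt (t * V) by rewrite sqrtr_gt0.
have tQ : 0 < t * ball_var Pi z b by rewrite mulr_gt0.
have sQ : 0 < Num.sqrt (t * ball_var Pi z b) by rewrite sqrtr_gt0.
have -> : - (x ^+ 2 * (1 + delta) ^+ 2) / (2 * t * V) = - (u ^+ 2 * (1 + delta) ^+ 2 / 2).
  rewrite /u expr_div_n sqr_sqrtr ?(ltW tV)//.
  by field; rewrite !gt_eqF.
apply: (tail_low_ge eta0 ed).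
  by rewrite divr_ge0 ?sqrtr_ge0// mulr_ge0 ?(ltW x0)// addr_ge0// ltW.
rewrite ler_pdivrMr//.
have key : Num.sqrt (t * V) <= (1 + eta) * Num.sqrt (t * ball_var Pi z b).
  have p1 : 0 <= 1 + eta by rewrite addr_ge0// ltW.
  rewrite -(@ler_pXn2r _ 2)// ?nnegrE ?mulr_ge0 ?sqrtr_ge0// exprMn !sqr_sqrtr ?(ltW tV) ?(ltW tQ)//.
  by rewrite mulrCA ler_pM2l// mulrC -ler_pdivrMr.
have -> : (1 + eta) ^+ 2 * u * Num.sqrt (t * ball_var Pi z b) =
  (1 + eta) * x * ((1 + eta) * Num.sqrt (t * ball_var Pi z b)) / Num.sqrt (t * V).
  by rewrite /u; field; rewrite gt_eqF.
rewrite ler_pdivlMr// ler_pM2l// mulr_gt0// addr_gt0//.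
Qed.
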